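(* Let $\mu$ be a ($\sigma$-finite) Borel measure on $M_k(\mathbb{C})$ with $\int \|v\|^2\,d\mu(v)<\infty$ and $\int v^*v\,d\mu(v)=\mathrm{Id}_{\mathbb{C}^k}$, and let $\Pi$ be the associated transition kernel on $\mathrm{P}(\mathbb{C}^k)$. Assume (Pur). Then there exists a set $\{F_j\}_{j=1}^d$ of mutually orthogonal subspaces of $\mathbb{C}^k$ such that for each $j\in\{1,\dots,d\}$ there exists a unique $\Pi$-invariant probability measure $\nu_j$ supported on $\mathrm{P}(F_j)$, and the set of $\Pi$-invariant probability measures is the convex hull of $\{\nu_j\}_{j=1}^d$.
   Context: $k\ge1$ is an integer, $\mathbb{N}=\{1,2,\dots\}$. $\mathrm{P}(\mathbb{C}^k)$ is the projective space with Borel $\sigma$-algebra $\mathcal{B}$; $\hat x$ is the class of $x\neq0$; given $\hat x$, $x$ denotes an arbitrary unit representative; $v\cdot\hat x$ is the class of $vx$ when $vx\ne0$. For a subspace $F$, $\mathrm{P}(F)=\{\hat x: x\in F\setminus\{0\}\}$. Transition kernel: for $S\in\mathcal{B}$, $\Pi(\hat x,S)=\int_{M_k(\mathbb{C})}\mathbf{1}_S(v\cdot\hat x)\|vx\|^2\,d\mu(v)$ (the integrand is $0$ when $vx=0$). A probability measure $\nu$ on $(\mathrm{P}(\mathbb{C}^k),\mathcal B)$ is $\Pi$-invariant if $\nu\Pi=\nu$. $\mu^{\otimes n}$ is the $n$-fold product measure. $X\propto Y$ means $X=\lambda Y$ for some $\lambda\in\mathbb{C}$. (Pur): any nonzero orthogonal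 projector $\pi$ on $\mathbb{C}^k$ such that for every $n\in\mathbb{N}$, $\pi v_1^*\cdots v_n^*v_n\cdots v_1\pi\propto\pi$ for $\mu^{\otimes n}$-almost all $(v_1,\dots,v_n)$, is of rank one. *)

(* Defs.v *)
From HB Require Import structures.
From mathcomp Require Import all_boot all_order all_algebra.
From mathcomp Require Import complex.
From mathcomp Require Import all_classical all_reals all_analysis.

Set Implicit Arguments.
Unset Strict Implicit.
Unset Printing Implicit Defensive.

Import Order.TTheory GRing.Theory Num.Theory.
Import numFieldNormedType.Exports.

Local Open Scope classical_set_scope.
Local Open Scope ring_scope.
Local Open Scope complex_scope.
Local Open Scope sesquilinear_scope.
Local Open Scope quotient_scope.

(* MathComp-Analysis puts the norm topology on every numFieldType, but these
   instances are not found on the concrete type [R[i]]. *)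
HB.instance Definition _ (R : realType) :=
  PseudoPointedMetric.copy R[i] (R[i])^o.

Notation borel T := (g_sigma_algebraType (@open T)).

(* Throughout, the dimension of the ambient space is [k.+1], i.e. at least 1:
   a measurable type of MathComp-Analysis is inhabited. *)

Section hermitian_space.
Context {R : realType}.

Definition hdot n (x y : 'cV[R[i]]_n) : R[i] := (x ^t* *m y) 0 0.

Definition hnorm n (x : 'cV[R[i]]_n) : R := Num.sqrt (complex.Re (hdot x x)).

Definition opnorm n (v : 'M[R[i]]_n) : R :=
  sup [set hnorm (v *m x) | x in [set x : 'cV[R[i]]_n | hnorm x = 1]].

Definition orthogonalv n (F G : {vspace 'cV[R[i]]_n}) : Prop :=
  forall x y, x \in F -> y \in G -> hdot x y = 0.

Definition orthogonal_projector n (p : 'M[R[i]]_n) : Prop :=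
  p *m p = p /\ p ^t* = p.

Definition proportional n (X Y : 'M[R[i]]_n) : Prop :=
  exists l : R[i], X = l *: Y.

End hermitian_space.

Section projective_space.
Context {R : realType} {k : nat}.

Definition nzvec : Type := {x : 'cV[R[i]]_k.+1 | x != 0}.

HB.instance Definition _ := Choice.on nzvec.
HB.instance Definition _ := SubType.on nzvec.
HB.instance Definition _ := Topological.copy nzvec
  (initial_topology (\val : nzvec -> 'cV[R[i]]_k.+1)).

Lemma const_mx1_neq0 : (const_mx 1 : 'cV[R[i]]_k.+1) != 0.
Proof. by apply/eqP => /matrixP/(_ 0 0)/eqP; rewrite !mxE oner_eq0. Qed.

HB.instance Definition _ := isPointed.Build nzvec
  (exist (fun x : 'cV[R[i]]_k.+1 => x != 0) _ const_mx1_neq0).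

Definition collinear (x y : nzvec) : bool :=
  `[< exists l : R[i], \val x = l *: \val y :> 'cV[R[i]]_k.+1 >].

Lemma collinear_refl : reflexive collinear.
Proof. by move=> x; apply/asboolP; exists 1; rewrite scale1r. Qed.

Lemma collinear_sym : symmetric collinear.
Proof.
suff imp x y : collinear x y -> collinear y x by move=> x y; apply/idP/idP; exact: imp.
move=> /asboolP[l xly]; apply/asboolP; exists l^-1; rewrite xly scalerA mulVf ?scale1r//.
by apply: contraTneq (valP x) => l0; rewrite xly l0 scale0r eqxx.
Qed.

Lemma collinear_trans : transitive collinear.
Proof.
move=> y x z /asboolP[l xly] /asboolP[m ymz]; apply/asboolP.
by exists (l * m); rewrite xly ymz scalerA.
Qed.

Canonical collinear_equiv :=
  EquivRel collinear collinear_refl collinear_sym collinear_trans.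

End projective_space.
Arguments nzvec : clear implicits.

Definition proj_space (R : realType) (k : nat) : Type :=
  quotient_topology {eq_quot (@collinear R k)}.
HB.instance Definition _ R k := Quotient.on (proj_space R k).
HB.instance Definition _ R k := Topological.on (proj_space R k).
HB.instance Definition _ R k := Pointed.on (proj_space R k).

Section kernel.
Context {R : realType} {k : nat}.
Local Notation Mk := 'M[R[i]]_k.+1.
Local Notation PC := (borel (proj_space R k)).

Definition proj_class (x : nzvec R k) : PC := \pi_(proj_space R k) x.

Definition unit_rep (p : PC) : 'cV[R[i]]_k.+1 :=
  let x := \val (repr (p : proj_space R k)) in ((hnorm x)^-1)%:C *: x.

(* [None] when [v] vanishes on the line [p] *)
Definition proj_act (v : Mk) (p : PC) : option PC :=
  omap proj_class (insub (v *m unit_rep p)).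

Definition proj_sub (F : {vspace 'cV[R[i]]_k.+1}) : set PC :=
  [set proj_class x | x in [set x : nzvec R k | \val x \in F]].

Definition trans_kernel (mu : {measure set (borel Mk) -> \bar R}) (p : PC) (S : set PC)
    : \bar R :=
  \int[mu]_v (if proj_act v p is Some q
              then \1_S q * hnorm ((v : Mk) *m unit_rep p) ^+ 2 else 0)%:E.

Definition invariant_measure (mu : {measure set (borel Mk) -> \bar R})
    (nu : probability PC R) : Prop :=
  forall S : set PC, measurable S ->
    (\int[nu]_p trans_kernel mu p S = nu S)%E.

Definition in_convex_hull d (nus : 'I_d -> probability PC R)
    (nu : probability PC R) : Prop :=
  exists t : 'I_d -> R,
    [/\ forall j, 0 <= t j, \sum_j t j = 1 &
        forall S : set PC, measurable S ->
          (nu S = \sum_j (t j)%:E * nus j S)%E].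

(* entrywise Bochner integral; meaningful when all entries are integrable *)
Definition mx_integral (mu : {measure set (borel Mk) -> \bar R}) (f : Mk -> Mk) : Mk :=
  \matrix_(i, j) ((\int[mu]_v complex.Re (f v i j))
                  +i* (\int[mu]_v complex.Im (f v i j))).

End kernel.

Section power_measure.
Context d (T : measurableType d) {R : realType}.

Definition tcons n (p : T * n.-tuple T) : n.+1.-tuple T := [tuple of p.1 :: p.2].

Lemma measurable_tcons n : measurable_fun [set: (T * n.-tuple T)%type] (@tcons n).
Proof. exact: (measurable_cons measurable_fst measurable_snd). Qed.

Variable mu : {sigma_finite_measure set T -> \bar R}.

Section step.
Variables (n : nat) (mun : {sigma_finite_measure set (n.-tuple T) -> \bar R}).

Definition power_step : set (n.+1.-tuple T) -> \bar R :=
  pushforward (mu \x mun)%E (@tcons n).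

Let pushforward_measure : {measure set (n.+1.-tuple T) -> \bar R} :=
  measure_function_pushforward__canonical__measure_function_Measure
    (mu \x mun)%E (@measurable_tcons n).

Let power_step0 : power_step set0 = 0%E.
Proof. exact: (measure0 pushforward_measure). Qed.

Let power_step_ge0 A : (0 <= power_step A)%E.
Proof. exact: (measure_ge0 pushforward_measure). Qed.

Let power_step_sigma_additive : semi_sigma_additive power_step.
Proof. exact: (@measure_semi_sigma_additive _ _ _ pushforward_measure). Qed.

HB.instance Definition _ := isMeasure.Build _ _ _ power_step
  power_step0 power_step_ge0 power_step_sigma_additive.

Lemma power_step_sigma_finite : sigma_finite setT power_step.
Proof.
have /sigma_finiteP[F [FT Fnd Ffin]] := sigma_finiteT mu.
have /sigma_finiteP[G [GT Gnd Gfin]] := sigma_finiteT mun.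
pose g (t : n.+1.-tuple T) : T * n.-tuple T := (thead t, [tuple of behead t]).
have mg : measurable_fun setT g.
  by apply/measurable_fun_pairP; split;
    [exact: measurable_tnth|exact: measurable_behead].
have gK : cancel (@tcons n) g by case=> x t; congr pair; exact: val_inj.
exists (fun i => g @^-1` (F i `*` G i)).
  apply/esym; rewrite -subTset => t _.
  have [i _ Fi] : (\bigcup_i F i) (g t).1 by rewrite -FT.
  have [j _ Gj] : (\bigcup_j G j) (g t).2 by rewrite -GT.
  exists (maxn i j) => //; split.
    exact: (subsetPset _ _ (Fnd _ _ (leq_maxl i j))).
  exact: (subsetPset _ _ (Gnd _ _ (leq_maxr i j))).
move=> i; have [mF Foo] := Ffin i; have [mG Goo] := Gfin i; split.
  by rewrite -[X in measurable X]setTI; apply: mg => //; exact: measurableX.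
rewrite /power_step /pushforward -comp_preimage.
rewrite (_ : g \o _ = id) ?preimage_id; last by apply/funext => x; exact: gK.
by rewrite product_measure1E// lte_mul_pinfty// ge0_fin_numE.
Qed.

HB.instance Definition _ :=
  Measure_isSigmaFinite.Build _ _ _ power_step power_step_sigma_finite.

End step.

Fixpoint power_measure n : {sigma_finite_measure set (n.-tuple T) -> \bar R} :=
  match n with
  | 0 => \d_([tuple] : 0.-tuple T)
  | m.+1 => power_step (power_measure m)
  end.

End power_measure.

Definition purification (R : realType) (k : nat)
    (mu : {sigma_finite_measure set (borel 'M[R[i]]_k.+1) -> \bar R}) : Prop :=
  forall p : 'M[R[i]]_k.+1, p != 0 -> orthogonal_projector p ->
    (forall n, (0 < n)%N ->
       {ae power_measure mu n, forall t : n.-tuple (borel 'M[R[i]]_k.+1),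
          proportional
            (p * (\prod_(v <- t) (v : 'M[R[i]]_k.+1) ^t* )
               * (\prod_(v <- rev t) (v : 'M[R[i]]_k.+1)) * p) p}) ->
    \rank p = 1%N.

(* Main.v *)
(* Functions on P(C^k) are viewed as functions of degree two on C^k, on which the kernel acts
   by (K f)(x) = \int f(v x) dmu(v); the same operator K acts on functions of matrices. The
   purity |A^* A|^2 / |A|^2 increases under K, and by (Pur) its iterates converge to the
   invariant function |A|^2: on average, long products v_n ... v_1 are close to rank one, so
   K^n f is asymptotically a quadratic form. Hence an invariant measure nu is determined by
   its barycenter \int u u^* dnu(u), which is a fixed point of rho |-> \int v rho v^* dmu(v).
   Conversely, a fixed point B B^* of trace one is the barycenter of a limit of Cesaro means
   started from the columns of B (an ultrafilter limit, made a measure by Daniell's theorem).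
   The positive and negative parts of a Hermitian fixed point are fixed, and a comparison of
   measures shows that the negative part of rho - rho' is at most rho'. It follows that the
   positive fixed points are exactly the nonnegative combinations of a maximal family of
   pairwise orthogonal ones; F_j is the range of the j-th one, nu_j its invariant measure. *)
Require Import Defs.
From HB Require Import structures.
From mathcomp Require Import all_boot all_order all_algebra.
From mathcomp Require Import complex.
From mathcomp Require Import all_classical all_reals all_analysis.
From mathcomp Require Import measurable_realfun.
From mathcomp Require Import ring lra.

Set Implicit Arguments.
Unset Strict Implicit.
Unset Printing Implicit Defensive.

Import Order.TTheory GRing.Theory Num.Theory.
Import numFieldNormedType.Exports.

Local Open Scope classical_set_scope.
Local Open Scope ring_scope.
Local Open Scope complex_scope.
Local Open Scope sesquilinear_scope.
Local Open Scope quotient_scope.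

Local Notation Re := complex.Re.
Local Notation Im := complex.Im.

(** The action on lines is undefined where [v x = 0] and the kernel carries the weight [|v x|^2];
    functions of degree two absorb both, and they let the same operator act on matrices, so that
    started at the identity it averages over the products [v_n ... v_1] themselves. Only second
    moments of [mu] are finite, so regularity is stated as a bound linear in squared norms: [K]
    preserves [nsq], hence integrates such a bound exactly, and all iterates share one modulus of
    continuity. (Pur) is applied at a single matrix, one of maximal purity in a compact set, so no
    almost sure convergence of products is needed. The orthogonality of the [F_j] is the delicate
    point: for a general trace preserving positive map, such as the identity, extremal fixed states
    need not be orthogonal. Here injectivity of the barycenter lifts a linear relation between fixed
    points to one between invariant measures, and the latter may be tested on functions that are not
    quadratic. *)

Section complex_numbers.
Context {R : realType}.
Implicit Types z w : R[i].

Definition csq z : R := Re z ^+ 2 + Im z ^+ 2.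

Lemma ReD z w : Re (z + w) = Re z + Re w.
Proof. by case: z w => [a b] [c d]. Qed.

Lemma ReN z : Re (- z) = - Re z.
Proof. by case: z. Qed.

Lemma ReB z w : Re (z - w) = Re z - Re w.
Proof. by rewrite ReD ReN. Qed.

Lemma ReM z w : Re (z * w) = Re z * Re w - Im z * Im w.
Proof. by case: z w => [a b] [c d]. Qed.

Lemma ImM z w : Im (z * w) = Re z * Im w + Im z * Re w.
Proof. by case: z w => [a b] [c d]. Qed.

Lemma ImD z w : Im (z + w) = Im z + Im w.
Proof. by case: z w => [a b] [c d]. Qed.

Lemma ReJ z : Re z^* = Re z.
Proof. by case: z. Qed.

Lemma ImJ z : Im z^* = - Im z.
Proof. by case: z. Qed.

Lemma Re_sum I (r : seq I) (P : pred I) (F : I -> R[i]) :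
  Re (\sum_(i <- r | P i) F i) = \sum_(i <- r | P i) Re (F i).
Proof. by elim/big_rec2: _ => // i x y _ <-; rewrite ReD. Qed.

Lemma Im_sum I (r : seq I) (P : pred I) (F : I -> R[i]) :
  Im (\sum_(i <- r | P i) F i) = \sum_(i <- r | P i) Im (F i).
Proof. by elim/big_rec2: _ => // i x y _ <-; rewrite ImD. Qed.

Lemma complex_ext z w : Re z = Re w -> Im z = Im w -> z = w.
Proof. by case: z w => [a b] [c d] /= -> ->. Qed.

Lemma csq_ge0 z : 0 <= csq z.
Proof. by rewrite addr_ge0// sqr_ge0. Qed.

Lemma csq0 : csq 0 = 0.
Proof. by rewrite /csq /= expr0n /= addr0. Qed.

Lemma csq_eq0 z : csq z = 0 -> z = 0.
Proof.
move=> /eqP; rewrite paddr_eq0 ?sqr_ge0// !sqrf_eq0 => /andP[/eqP a /eqP b].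
exact: complex_ext.
Qed.

Lemma csqM z w : csq (z * w) = csq z * csq w.
Proof. by rewrite /csq ReM ImM; ring. Qed.

Lemma csqJ z : csq z^* = csq z.
Proof. by rewrite /csq ReJ ImJ sqrrN. Qed.

Lemma csqR (r : R) : csq r%:C = r ^+ 2.
Proof. by rewrite /csq /= expr0n /= addr0. Qed.

Lemma csqE z : csq z = Re (z^* * z).
Proof. by rewrite ReM ReJ ImJ /csq; ring. Qed.

Lemma conjMcsq z : z^* * z = (csq z)%:C.
Proof. by apply: complex_ext; rewrite ?csqE// ImM ReJ ImJ /=; ring. Qed.

(* Cauchy-Schwarz: expand the square of [S a_j - w c_j^*] *)
Lemma csq_sum_le (I : finType) (a c : I -> R[i]) :
  csq (\sum_i a i * c i) <= (\sum_i csq (a i)) * (\sum_i csq (c i)).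
Proof.
set w := \sum_i _; set A := \sum_i _; set S := \sum_i _.
have S0 : 0 <= S by apply: sumr_ge0 => i _; exact: csq_ge0.
have [Sz|Snz] := eqVneq S 0.
  have cz i : c i = 0.
    move/psumr_eq0P : Sz => /(_ (fun i _ => csq_ge0 _)) /(_ i isT); exact: csq_eq0.
  rewrite /w big1 ?csq0; last by move=> i _; rewrite cz mulr0.
  by rewrite Sz mulr0.
have Sp : 0 < S by rewrite lt_def Snz.
have H : 0 <= \sum_i csq (S%:C * a i - w * (c i)^*).
  by apply: sumr_ge0 => i _; exact: csq_ge0.
have E i : csq (S%:C * a i - w * (c i)^*) =
   S ^+ 2 * csq (a i) - 2 * S * Re (w^* * (a i * c i)) + csq w * csq (c i).
  by case: (a i) (c i) (w) => [a1 a2] [c1 c2] [w1 w2]; rewrite /csq /=; ring.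
move: H; rewrite (eq_bigr _ (fun i _ => E i)) big_split /= sumrB -!mulr_sumr.
rewrite -/A -/S -Re_sum -mulr_sumr -/w -csqE.
have -> : S ^+ 2 * A - 2 * S * csq w + csq w * S = S * (A * S - csq w) by ring.
by rewrite pmulr_rge0// subr_ge0.
Qed.

End complex_numbers.

(* Sealed: failing unifications of matrix expressions over [R[i]] would unfold the whole
   real closed field construction. *)
HB.lock Definition rtr (R : realType) n (A : 'M[R[i]]_n) : R := Re (\tr A).
HB.lock Definition nsq (R : realType) m n (A : 'M[R[i]]_(m, n)) : R :=
  \sum_i \sum_j csq (A i j).
HB.lock Definition adj (R : realType) m n (A : 'M[R[i]]_(m, n)) : 'M[R[i]]_(n, m) := A ^t*.
HB.lock Definition cmul (R : realType) m n p (A : 'M[R[i]]_(m, n)) (B : 'M[R[i]]_(n, p)) :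
  'M[R[i]]_(m, p) := A *m B.

Local Notation "A ** B" := (cmul A B) (at level 40, left associativity) : ring_scope.

(** * Real trace pairing and Hilbert-Schmidt norm *)

Section trace_form.
Context {R : realType}.
Local Notation C := R[i].

Lemma rtrE n (A : 'M[C]_n) : rtr A = Re (\tr A).
Proof. by rewrite rtr.unlock. Qed.

Lemma nsq_sum m n (A : 'M[C]_(m, n)) : nsq A = \sum_i \sum_j csq (A i j).
Proof. by rewrite nsq.unlock. Qed.

Lemma adjE m n (A : 'M[C]_(m, n)) : adj A = A ^t*.
Proof. by rewrite adj.unlock. Qed.

Lemma cmulE m n p (A : 'M[C]_(m, n)) (B : 'M[C]_(n, p)) : A ** B = A *m B.
Proof. by rewrite cmul.unlock. Qed.

Lemma cmulA m n p q (A : 'M[C]_(m, n)) (B : 'M[C]_(n, p)) (D : 'M[C]_(p, q)) :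
  A ** (B ** D) = A ** B ** D.
Proof. by rewrite !cmulE mulmxA. Qed.

Lemma cmulDl m n p (A B : 'M[C]_(m, n)) (D : 'M[C]_(n, p)) :
  (A + B) ** D = A ** D + B ** D.
Proof. by rewrite !cmulE mulmxDl. Qed.

Lemma cmulDr m n p (A : 'M[C]_(m, n)) (B D : 'M[C]_(n, p)) :
  A ** (B + D) = A ** B + A ** D.
Proof. by rewrite !cmulE mulmxDr. Qed.

Lemma cmulBl m n p (A B : 'M[C]_(m, n)) (D : 'M[C]_(n, p)) :
  (A - B) ** D = A ** D - B ** D.
Proof. by rewrite !cmulE mulmxBl. Qed.

Lemma cmulBr m n p (A : 'M[C]_(m, n)) (B D : 'M[C]_(n, p)) :
  A ** (B - D) = A ** B - A ** D.
Proof. by rewrite !cmulE mulmxBr. Qed.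

Lemma cmulNr m n p (A : 'M[C]_(m, n)) (D : 'M[C]_(n, p)) : A ** (- D) = - (A ** D).
Proof. by rewrite !cmulE mulmxN. Qed.

Lemma cmulZl m n p (a : C) (A : 'M[C]_(m, n)) (D : 'M[C]_(n, p)) :
  (a *: A) ** D = a *: (A ** D).
Proof. by rewrite !cmulE scalemxAl. Qed.

Lemma cmulZr m n p (a : C) (A : 'M[C]_(m, n)) (D : 'M[C]_(n, p)) :
  A ** (a *: D) = a *: (A ** D).
Proof. by rewrite !cmulE scalemxAr. Qed.

Lemma cmul1l m n (A : 'M[C]_(m, n)) : 1%:M ** A = A.
Proof. by rewrite cmulE mul1mx. Qed.

Lemma cmul1r m n (A : 'M[C]_(m, n)) : A ** 1%:M = A.
Proof. by rewrite cmulE mulmx1. Qed.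

Lemma cmul0l m n p (A : 'M[C]_(n, p)) : (0 : 'M[C]_(m, n)) ** A = 0.
Proof. by rewrite cmulE mul0mx. Qed.

Lemma cmul0r m n p (A : 'M[C]_(m, n)) : A ** (0 : 'M[C]_(n, p)) = 0.
Proof. by rewrite cmulE mulmx0. Qed.

Lemma cmul_suml m n p I (r : seq I) (F : I -> 'M[C]_(m, n)) (D : 'M[C]_(n, p)) :
  (\sum_(i <- r) F i) ** D = \sum_(i <- r) F i ** D.
Proof. by apply: (big_morph (fun X => X ** D)) => [X Y|]; rewrite ?cmulDl ?cmul0l. Qed.

Lemma cmul_mx m n p (A : 'M[C]_(m, n)) (B : 'M[C]_(n, p)) i j :
  (A ** B) i j = \sum_k A i k * B k j.
Proof. by rewrite cmulE mxE. Qed.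

Lemma cmul_col m n p (A : 'M[C]_(m, n)) (B : 'M[C]_(n, p)) j :
  col j (A ** B) = A ** col j B.
Proof.
by apply/matrixP => i l; rewrite mxE !cmul_mx; apply: eq_bigr => q _; rewrite mxE.
Qed.

Lemma rtrD n (A B : 'M[C]_n) : rtr (A + B) = rtr A + rtr B.
Proof. by rewrite !rtrE mxtraceD ReD. Qed.

Lemma rtrN n (A : 'M[C]_n) : rtr (- A) = - rtr A.
Proof. by rewrite !rtrE raddfN /= ReN. Qed.

Lemma rtrB n (A B : 'M[C]_n) : rtr (A - B) = rtr A - rtr B.
Proof. by rewrite rtrD rtrN. Qed.

Lemma rtr0 n : rtr (0 : 'M[C]_n) = 0.
Proof. by rewrite !rtrE mxtrace0. Qed.

Lemma rtrZ n (r : R) (A : 'M[C]_n) : rtr (r%:C *: A) = r * rtr A.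
Proof. by rewrite !rtrE mxtraceZ ReM /= mul0r subr0. Qed.

Lemma rtr_sum n I (r : seq I) (P : pred I) (F : I -> 'M[C]_n) :
  rtr (\sum_(i <- r | P i) F i) = \sum_(i <- r | P i) rtr (F i).
Proof. by apply: (big_morph _ (@rtrD n) (@rtr0 n)). Qed.

Lemma rtrC m n (A : 'M[C]_(m, n)) (B : 'M[C]_(n, m)) : rtr (A ** B) = rtr (B ** A).
Proof. by rewrite !rtrE !cmulE mxtrace_mulC. Qed.

Lemma adjK m n (A : 'M[C]_(m, n)) : adj (adj A) = A.
Proof. by rewrite !adjE trmxCK. Qed.

Lemma adj_mx m n (A : 'M[C]_(m, n)) i j : adj A i j = (A j i)^*.
Proof. by rewrite adjE !mxE. Qed.

Lemma adjM m n p (A : 'M[C]_(m, n)) (B : 'M[C]_(n, p)) :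
  adj (A ** B) = adj B ** adj A.
Proof. by rewrite !cmulE !adjE trmx_mul map_mxM. Qed.

Lemma adjD m n (A B : 'M[C]_(m, n)) : adj (A + B) = adj A + adj B.
Proof. by rewrite !adjE linearD /= map_mxD. Qed.

Lemma adjN m n (A : 'M[C]_(m, n)) : adj (- A) = - adj A.
Proof. by rewrite !adjE linearN /= map_mxN. Qed.

Lemma adjB m n (A B : 'M[C]_(m, n)) : adj (A - B) = adj A - adj B.
Proof. by rewrite adjD adjN. Qed.

Lemma adjZ m n (a : C) (A : 'M[C]_(m, n)) : adj (a *: A) = a^* *: adj A.
Proof. by apply/matrixP => i j; rewrite mxE !adj_mx mxE rmorphM. Qed.

Lemma adjZR m n (r : R) (A : 'M[C]_(m, n)) : adj (r%:C *: A) = r%:C *: adj A.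
Proof.
apply/matrixP => i j; rewrite mxE !adj_mx mxE; apply: complex_ext.
  by rewrite ReJ !ReM ReJ /= !mul0r.
by rewrite ImJ !ImM ReJ ImJ /= !mul0r !addr0 mulrN.
Qed.

Lemma adj1 n : adj (1%:M : 'M[C]_n) = 1%:M.
Proof. by rewrite !adjE trmx1 map_mx1. Qed.

Lemma rtrJ n (A : 'M[C]_n) : rtr (adj A) = rtr A.
Proof. by rewrite !rtrE /mxtrace !Re_sum; apply: eq_bigr => i _; rewrite adj_mx ReJ. Qed.

Lemma nsqE m n (A : 'M[C]_(m, n)) : nsq A = rtr (adj A ** A).
Proof.
rewrite !rtrE /mxtrace Re_sum nsq_sum exchange_big /=; apply: eq_bigr => i _.
by rewrite cmul_mx Re_sum; apply: eq_bigr => j _; rewrite adj_mx csqE.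
Qed.

Lemma nsq_ge0 m n (A : 'M[C]_(m, n)) : 0 <= nsq A.
Proof. by rewrite nsq_sum; apply: sumr_ge0 => i _; apply: sumr_ge0 => j _; exact: csq_ge0. Qed.

Lemma csq_le_nsq m n (A : 'M[C]_(m, n)) i j : csq (A i j) <= nsq A.
Proof.
rewrite !nsq_sum (bigD1 i)//= (bigD1 j)//= -addrA lerDl addr_ge0//.
  by apply: sumr_ge0 => ? _; exact: csq_ge0.
by apply: sumr_ge0 => ? _; apply: sumr_ge0 => ? _; exact: csq_ge0.
Qed.

Lemma nsq0 m n : nsq (0 : 'M[C]_(m, n)) = 0.
Proof. by rewrite !nsq_sum big1// => i _; rewrite big1// => j _; rewrite mxE csq0. Qed.

Lemma nsq_eq0 m n (A : 'M[C]_(m, n)) : nsq A = 0 -> A = 0.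
Proof.
move=> A0; apply/matrixP => i j; rewrite mxE; apply: csq_eq0; apply/eqP.
by rewrite eq_le csq_ge0 -A0 csq_le_nsq.
Qed.

Lemma nsq_gt0 m n (A : 'M[C]_(m, n)) : A != 0 -> 0 < nsq A.
Proof. by move=> A0; rewrite lt_def nsq_ge0 andbT; apply: contra A0 => /eqP/nsq_eq0 ->. Qed.

Lemma nsqZ m n (a : C) (A : 'M[C]_(m, n)) : nsq (a *: A) = csq a * nsq A.
Proof.
rewrite !nsq_sum mulr_sumr; apply: eq_bigr => i _; rewrite mulr_sumr.
by apply: eq_bigr => j _; rewrite mxE csqM.
Qed.

Lemma nsqN m n (A : 'M[C]_(m, n)) : nsq (- A) = nsq A.
Proof.
by rewrite -scaleN1r nsqZ /csq /= oppr0 expr0n /= addr0 sqrrN expr1n mul1r.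
Qed.

Lemma nsqJ m n (A : 'M[C]_(m, n)) : nsq (adj A) = nsq A.
Proof.
rewrite !nsq_sum exchange_big; apply: eq_bigr => i _; apply: eq_bigr => j _.
by rewrite adj_mx csqJ.
Qed.

Lemma rtr_adjC m n (A B : 'M[C]_(m, n)) : rtr (adj A ** B) = rtr (adj B ** A).
Proof. by rewrite -(rtrJ (adj A ** B)) adjM adjK. Qed.

Lemma nsqD m n (A B : 'M[C]_(m, n)) : nsq (A + B) = nsq A + nsq B + 2 * rtr (adj A ** B).
Proof.
rewrite !nsqE adjD cmulDl !cmulDr !rtrD (rtr_adjC B A).
by ring.
Qed.

Lemma nsqB m n (A B : 'M[C]_(m, n)) : nsq (A - B) = nsq A + nsq B - 2 * rtr (adj A ** B).
Proof. by rewrite nsqD nsqN cmulNr rtrN mulrN. Qed.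

(** Young's inequality, from [nsq (s A - B) >= 0] and [nsq (s A + B) >= 0]. Unlike Cauchy-Schwarz it
    contains no square root, so it can be integrated term by term. *)
Lemma rtr_adj_le m n (A B : 'M[C]_(m, n)) (s : R) : 0 < s ->
  `|rtr (adj A ** B)| * 2 <= s * nsq A + s^-1 * nsq B.
Proof.
move=> s0; have si0 : 0 < s^-1 by rewrite invr_gt0.
have ss : s^-1 * s = 1 by rewrite mulVf// gt_eqF.
have h1 := mulr_ge0 (ltW si0) (nsq_ge0 (s%:C *: A - B)).
have h2 := mulr_ge0 (ltW si0) (nsq_ge0 (s%:C *: A + B)).
have Z : rtr (adj (s%:C *: A) ** B) = s * rtr (adj A ** B).
  by rewrite adjZR cmulZl rtrZ.
rewrite nsqB nsqZ csqR Z in h1; rewrite nsqD nsqZ csqR Z in h2.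
have E (t : R) : s^-1 * (s ^+ 2 * nsq A + nsq B + 2 * (s * t)) =
  (s^-1 * s) * s * nsq A + s^-1 * nsq B + 2 * (s^-1 * s) * t by ring.
rewrite -mulrN -mulrN E ss in h1; rewrite E ss in h2.
by case: (ler0P (rtr (adj A ** B))) => _; lra.
Qed.

Lemma nsq_le2 m n (A B : 'M[C]_(m, n)) : nsq A <= 2 * nsq B + 2 * nsq (A - B).
Proof.
have H := nsq_ge0 (B - (A - B)); have : nsq A = nsq (B + (A - B)) by rewrite addrC subrK.
by rewrite nsqB in H; rewrite nsqD; lra.
Qed.

Lemma nsq_cmul_le m n p (A : 'M[C]_(m, n)) (B : 'M[C]_(n, p)) :
  nsq (A ** B) <= nsq A * nsq B.
Proof.
rewrite !nsq_sum mulr_suml; apply: ler_sum => i _.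
rewrite [X in _ * X](exchange_big _ _ _ _ _) /= mulr_sumr; apply: ler_sum => j _.
by rewrite cmul_mx csq_sum_le.
Qed.

Lemma nsq_col m n (A : 'M[C]_(m, n)) : nsq A = \sum_j nsq (col j A).
Proof.
rewrite nsq_sum exchange_big; apply: eq_bigr => j _ /=; rewrite nsq_sum; apply: eq_bigr => i _.
by rewrite big_ord1 mxE.
Qed.

End trace_form.

(** * Topology of matrix spaces through the Hilbert-Schmidt norm *)

Section matrix_topology.
Context {R : realType}.
Local Notation C := R[i].

Lemma normc_csq (z : C) : `|z| = (Num.sqrt (csq z))%:C.
Proof. by rewrite normc_def. Qed.

Lemma nbhs_nsqP m n (A : 'M[C]_(m, n)) (U : set 'M[C]_(m, n)) :
  nbhs A U <-> exists2 e : R, 0 < e & forall B : 'M[C]_(m, n), nsq (A - B) < e -> U B.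
Proof.
split.
  move=> /nbhs_ballP[e e0 eU].
  (* Radii of balls are elements of [R[i]]; a positive one is real. *)
  have [e1 e10 ee1] : exists2 e1 : R, 0 < e1 & e = e1%:C.
    have er : e \is Num.real by rewrite ger0_real// ltW.
    exists (Re e); last by rewrite RRe_real.
    by move: e0; rewrite /= -{1}(RRe_real er) ltcR.
  exists (e1 ^+ 2); first by rewrite exprn_gt0.
  move=> B AB; apply: eU; split => // i j; rewrite /ball /= ee1 normc_csq ltcR.
  have := csq_le_nsq (A - B) i j; rewrite !mxE => h.
  have h2 := le_lt_trans h AB.
  by rewrite -[e1]gtr0_norm// -sqrtr_sqr ltr_sqrt// exprn_gt0.
move=> [e e0 eU]; apply/nbhs_ballP.
(* There are [m * n] entries, each of squared modulus at most [r ^+ 2 = e / N.+1]; the successor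
   keeps the divisor positive and the final inequality strict. *)
pose N := (m * n)%N; pose r := Num.sqrt (e / N.+1%:R).
have r2 : r ^+ 2 * N.+1%:R = e.
  by rewrite sqr_sqrtr ?divr_ge0 ?ltW// divfK.
have r0 : 0 < r by rewrite sqrtr_gt0 divr_gt0.
exists r%:C; first by rewrite /= ltcR.
move=> B [_ AB]; apply: eU.
have h i j : csq ((A - B) i j) <= r ^+ 2.
  have := AB i j; rewrite /ball /= normc_csq ltcR !mxE => h1.
  have := ltW h1; rewrite -ler_sqr ?nnegrE ?sqrtr_ge0 ?(ltW r0)//.
  by rewrite sqr_sqrtr// csq_ge0.
apply: (@le_lt_trans _ _ (\sum_(i < m) \sum_(j < n) r ^+ 2)).
  by rewrite nsq_sum; apply: ler_sum => i _; apply: ler_sum => j _.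
rewrite !sumr_const !card_ord -mulrnA mulnC -/N -r2 -[X in X < _]mulr_natr.
by rewrite ltr_pM2l ?exprn_gt0// ltr_nat.
Qed.

Lemma continuous_nsqP m n (f : 'M[C]_(m, n) -> R) :
  continuous f <-> forall (A : 'M[C]_(m, n)) (e : R), 0 < e ->
    exists2 d : R, 0 < d & forall B : 'M[C]_(m, n), nsq (A - B) < d -> `|f A - f B| < e.
Proof.
split=> [fc A e e0|H A].
  have /cvgrPdist_lt/(_ e e0) := fc A.
  by move=> /nbhs_nsqP.
apply/(@cvgrPdist_lt _ R^o _ (nbhs A) (nbhs_filter A) f (f A)) => e e0.
by apply/nbhs_nsqP; exact: H.
Qed.

(** Optimized over [s], the bound reads [2 * c * sqrt (nsq A + nsq B) * sqrt (nsq (A - B))]: a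
    Lipschitz condition of degree two. *)
Definition qlip m n (c : R) (f : 'M[C]_(m, n) -> R) := forall (s : R) (A B : 'M[C]_(m, n)), 0 < s ->
  `|f A - f B| <= c * (s * (nsq A + nsq B) + s^-1 * nsq (A - B)).

Lemma qlip_continuous m n c (f : 'M[C]_(m, n) -> R) :
  0 <= c -> qlip c f -> continuous f.
Proof.
move=> c0 fl; apply/continuous_nsqP => A e e0.
set a := nsq A; have a0 : 0 <= a by exact: nsq_ge0.
(* When [nsq (A - B) < 1], [nsq A + nsq B <= 3 * a + 2]; then [s] and [d] make each of the two terms
   equal to [e / 2]. Using [c + 1] covers [c = 0]. *)
set D := 2 * (c + 1) * (3 * a + 2).
have D0 : 0 < D by rewrite !mulr_gt0//; lra.
set s := e / D; have s0 : 0 < s by rewrite divr_gt0.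
set d := s * e / (2 * (c + 1)).
have d0 : 0 < d by rewrite !(divr_gt0, mulr_gt0)//; lra.
exists (Num.min 1 d); first by rewrite lt_min ltr01.
move=> B; rewrite lt_min => /andP[AB1 ABd].
have hB : nsq B <= 2 * a + 2.
  have := nsq_le2 B A; rewrite -/a -opprB nsqN; lra.
have h := fl s A B s0; apply: le_lt_trans h _.
apply: (@lt_le_trans _ _ ((c + 1) * (s * (3 * a + 2) + s^-1 * d))).
  have h1 : s * (nsq A + nsq B) <= s * (3 * a + 2) by rewrite ler_pM2l// -/a; lra.
  have h2 : s^-1 * nsq (A - B) < s^-1 * d by rewrite ltr_pM2l ?invr_gt0.
  apply: (@le_lt_trans _ _ ((c + 1) * (s * (nsq A + nsq B) + s^-1 * nsq (A - B)))).
    rewrite ler_wpM2r//; last lra.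
    by rewrite addr_ge0// mulr_ge0 ?addr_ge0 ?nsq_ge0 ?invr_ge0// ltW.
  by rewrite ltr_pM2l; lra.
have n1 : c + 1 != 0 by rewrite gt_eqF//; lra.
have n2 : 3 * a + 2 != 0 by rewrite gt_eqF//; lra.
have n3 : e != 0 by rewrite gt_eqF.
rewrite le_eqVlt; apply/orP; left; apply/eqP; rewrite /d /s /D; field.
by rewrite n1 n2 n3.
Qed.

Lemma Im_opp (z : C) : Im (- z) = - Im z.
Proof. by case: z. Qed.

Lemma nsq_qlip m n : qlip 1 (@nsq R m n).
Proof.
move=> s A B s0.
have E : nsq A - nsq B = rtr (adj (A + B) ** (A - B)).
  by rewrite !nsqE adjD cmulDl !cmulBr rtrD !rtrB (rtr_adjC B A); ring.
have h := rtr_adj_le (A + B) (A - B) s0; rewrite -E in h.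
have h2 : nsq (A + B) <= 2 * nsq A + 2 * nsq B.
  by have := nsq_le2 (A + B) A; rewrite (addrC A B) addrK.
have h3 : s * nsq (A + B) <= s * (2 * nsq A + 2 * nsq B) by rewrite ler_pM2l.
have h4 : 0 <= s^-1 * nsq (A - B) by rewrite mulr_ge0 ?nsq_ge0// invr_ge0 ltW.
by rewrite mul1r; lra.
Qed.

(** Otherwise the complement of a ball around a cluster point would belong to the ultrafilter. It
    serves for the compactness of the sphere and for the limit of Cesaro means. *)
Lemma ultra_bounded_cvg T (F : set_system T) (g : T -> R) (M : R) :
  UltraFilter F -> F [set x | `|g x| <= M] -> exists l : R, g @ F --> l.
Proof.
move=> FU FM; have FP : ProperFilter F by case: FU.
have [|l [_ lc]] := @segment_compact R (- M) M (g @ F) _.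
  suff : F (g @^-1` `[- M, M]%classic) by [].
  by apply: filterS FM => x /= xM; rewrite in_itv /= -ler_norml.
exists l; apply/cvgrPdist_lt => e e0.
have [//|nF] := in_ultra_setVsetC [set x | `|l - g x| < e] FU.
have := lc (g @` (~` [set x | `|l - g x| < e])) (ball l e).
case.
- suff : F (g @^-1` (g @` (~` [set x | `|l - g x| < e]))) by [].
  by apply: filterS nF => x xF; exists x.
- exact: nbhsx_ballx e e0.
by move=> _ [[x xe <-]] /= xb.
Qed.

(** Entries are bounded on the sphere, so their real and imaginary parts converge along any
    ultrafilter; convergence of entries makes [nsq (L - A)] tend to zero. *)
Lemma sphere_compact m n : compact [set A : 'M[C]_(m, n) | nsq A = 1].
Proof.
rewrite compact_ultra => F FU FS; have FP : ProperFilter F by case: FU.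
have cv (g : 'M[C]_(m, n) -> R) : (forall A, nsq A = 1 -> `|g A| <= 1) ->
    exists l : R, g @ F --> l.
  move=> gb; apply: (@ultra_bounded_cvg _ _ _ 1) => //.
  by apply: filterS FS => A /gb.
have sq1 (x y : R) : x ^+ 2 + y ^+ 2 <= 1 -> `|x| <= 1.
  move=> h; rewrite -(@ler_pXn2r _ 2)// ?nnegrE// expr1n real_normK ?num_real//.
  by apply: le_trans h; rewrite lerDl sqr_ge0.
have cRe i j : exists l : R, (fun A : 'M[C]_(m, n) => Re (A i j)) @ F --> l.
  by apply: cv => A A1; apply: (@sq1 _ (Im (A i j))); rewrite -A1; exact: csq_le_nsq.
have cIm i j : exists l : R, (fun A : 'M[C]_(m, n) => Im (A i j)) @ F --> l.
  by apply: cv => A A1; apply: (@sq1 _ (Re (A i j))); rewrite addrC -A1; exact: csq_le_nsq.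
pose L := \matrix_(i, j) (xget 0 [set l | (fun A : 'M[C]_(m, n) => Re (A i j)) @ F --> l] +i*
  xget 0 [set l | (fun A : 'M[C]_(m, n) => Im (A i j)) @ F --> l])%C.
have LRe i j : (fun A : 'M[C]_(m, n) => Re (A i j)) @ F --> Re (L i j).
  by rewrite mxE; apply: (xgetPex 0 (cRe i j)).
have LIm i j : (fun A : 'M[C]_(m, n) => Im (A i j)) @ F --> Im (L i j).
  by rewrite mxE; apply: (xgetPex 0 (cIm i j)).
move: L LRe LIm => L LRe LIm.
have c1 : (fun A => nsq (L - A)) @ F --> (0 : R).
  have -> : 0 = nsq (L - L) :> R by rewrite subrr nsq0.
  rewrite nsq_sum; under eq_cvg do rewrite nsq_sum.
  apply: cvg_big => [|i _]; first exact: add_continuous.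
  apply: cvg_big => [|j _]; first exact: add_continuous.
  have h1 : (fun A : 'M[C]_(m, n) => Re ((L - A) i j)) @ F --> Re ((L - L) i j).
    under eq_cvg do rewrite !mxE ReB.
    by rewrite mxE [in X in nbhs X]mxE ReB; apply: cvgB; [exact: cvg_cst|exact: LRe].
  have h2 : (fun A : 'M[C]_(m, n) => Im ((L - A) i j)) @ F --> Im ((L - L) i j).
    under eq_cvg do rewrite !mxE ImD Im_opp.
    by rewrite mxE [in X in nbhs X]mxE ImD Im_opp; apply: cvgB; [exact: cvg_cst|exact: LIm].
  rewrite /csq; under eq_cvg do rewrite !expr2.
  by rewrite !expr2; apply: cvgD; apply: cvgM.
have FL : F --> L.
  move=> U /nbhs_nsqP[e e0 eU].
  move/cvgrPdist_lt : c1 => /(_ e e0); apply: filterS => A /=.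
  by rewrite sub0r normrN ger0_norm ?nsq_ge0//; exact: eU.
exists L; split => //=.
apply/eqP; rewrite -subr_eq0; apply/eqP.
have nc : continuous (@nsq R m n).
  exact: (@qlip_continuous _ _ 1 _ ler01 (@nsq_qlip _ _)).
have h2 : (fun A => nsq A) @ F --> nsq L by apply: cvg_comp FL (nc L).
have h3 : (fun A : 'M[C]_(m, n) => nsq A) @ F --> (1 : R).
  by apply/cvgrPdist_lt => e e0; apply: filterS FS => A /= ->; rewrite subrr normr0.
by have /= -> := cvg_unique _ h2 h3; rewrite ?subrr//; exact: Rhausdorff.
Qed.

Lemma continuous_measurable_fun (X : ptopologicalType) (f : X -> R) :
  continuous f -> measurable_fun (setT : set (borel X)) f.
Proof.
move=> fc; apply: (measurability _ (RGenOInfty.measurableE R)) => //.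
move=> _ [_ [r ->] <-]; rewrite setTI; apply: sub_sigma_algebra.
by move/continuousP : fc; apply; exact: rray_open.
Qed.

End matrix_topology.

(** * Integrals of real-valued functions *)

Section real_integral.
Context d (T : measurableType d) {R : realType} (mu : {measure set T -> \bar R}).
Implicit Types f g : T -> R.

Definition rintegrable f := mu.-integrable setT (EFin \o f).

Lemma rintegrableD f g :
  rintegrable f -> rintegrable g -> rintegrable (fun x => f x + g x).
Proof.
move=> fi gi; have := @integrableD _ _ _ mu setT measurableT _ _ fi gi.
by apply: eq_integrable => // x _ /=; rewrite EFinD.
Qed.

Lemma rintegrableZ (r : R) f : rintegrable f -> rintegrable (fun x => r * f x).
Proof.
move=> fi; have := @integrableZl _ _ _ mu setT measurableT r _ fi.
by apply: eq_integrable => // x _ /=; rewrite EFinM.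
Qed.

Lemma rintegrableB f g :
  rintegrable f -> rintegrable g -> rintegrable (fun x => f x - g x).
Proof.
move=> fi gi; have := @integrableB _ _ _ mu setT measurableT _ _ fi gi.
by apply: eq_integrable => // x _ /=; rewrite EFinB.
Qed.

Lemma rintegrable_sum I (s : seq I) (h : I -> T -> R) :
  (forall i, rintegrable (h i)) -> rintegrable (fun x => \sum_(i <- s) h i x).
Proof.
move=> hi; have := @integrable_sum _ _ _ mu setT measurableT _ s xpredT (fun i => EFin \o h i).
move=> /(_ (fun i _ => hi i)); apply: eq_integrable => // x _ /=.
by rewrite sumEFin.
Qed.

Lemma rintegrable_measurable f : rintegrable f -> measurable_fun setT f.
Proof. by move=> /integrableP[mf _]; exact/measurable_EFinP. Qed.

Lemma rintegrable_le f g : measurable_fun setT f -> rintegrable g ->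
  (forall x, `|f x| <= g x) -> rintegrable f.
Proof.
move=> mf gi fg; apply: le_integrable gi => //; first exact/measurable_EFinP.
by move=> x _ /=; rewrite lee_fin (le_trans (fg x))// ler_norm.
Qed.

Lemma rint_sum I (s : seq I) (h : I -> T -> R) : (forall i, rintegrable (h i)) ->
  \int[mu]_x (\sum_(i <- s) h i x) = \sum_(i <- s) \int[mu]_x h i x.
Proof.
move=> hi; elim: s => [|i s ih].
  rewrite big_nil; under eq_Rintegral do rewrite big_nil.
  by rewrite Rintegral_cst// mul0r.
under eq_Rintegral do rewrite big_cons.
rewrite RintegralD// ?big_cons ?ih//; first exact: hi.
exact: (@rintegrable_sum _ s h hi).
Qed.

Lemma rint_le f g : rintegrable f -> rintegrable g -> (forall x, f x <= g x) ->
  \int[mu]_x f x <= \int[mu]_x g x.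
Proof. by move=> fi gi fg; apply: le_Rintegral. Qed.

Lemma rint_absB_le f g h : rintegrable f -> rintegrable g -> rintegrable h ->
  (forall x, `|f x - g x| <= h x) ->
  `|\int[mu]_x f x - \int[mu]_x g x| <= \int[mu]_x h x.
Proof.
move=> fi gi hi fgh; rewrite -RintegralB//.
apply: (le_trans (le_normr_Rintegral measurableT (rintegrableB fi gi))).
apply: rint_le => //.
have := rintegrableB fi gi; move=> /integrable_abse.
by apply: eq_integrable.
Qed.

Lemma rint_ge0_ae f : rintegrable f -> (forall x, 0 <= f x) ->
  \int[mu]_x f x <= 0 -> {ae mu, forall x, f x = 0}.
Proof.
move=> fi f0 i0.
have i0' : (\int[mu]_x `|(EFin \o f) x| = 0)%E.
  under eq_integral => x _ do rewrite /= ger0_norm//.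
  have /fineK <- := integrable_fin_num measurableT fi.
  congr EFin; apply/eqP; rewrite eq_le; apply/andP; split=> //.
  by apply: fine_ge0; apply: integral_ge0 => x _; rewrite lee_fin.
have /ae_eq_integral_abs := i0'.
move=> /(_ measurableT); case/integrableP : (fi) => mf _ /(_ mf).
by apply: filterS => x /(_ I) /= [].
Qed.

Lemma rint_ae f g : rintegrable f -> rintegrable g -> {ae mu, forall x, f x = g x} ->
  \int[mu]_x f x = \int[mu]_x g x.
Proof.
move=> fi gi fg; congr fine; apply: ae_eq_integral => //.
- by case/integrableP : fi.
- by case/integrableP : gi.
- by apply: filterS fg => x /= -> _.
Qed.

Lemma rint_ae_le f g : rintegrable f -> rintegrable g -> {ae mu, forall x, f x <= g x} ->
  \int[mu]_x f x <= \int[mu]_x g x.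
Proof.
move=> fi gi fg.
(* The maximum of [f] and [g] dominates [f] everywhere and equals [g] almost everywhere. *)
have mi : rintegrable (fun x => Num.max (f x) (g x)).
  apply: (@rintegrable_le _ (fun x => `|f x| + `|g x|)).
  - by apply: measurable_maxr; exact: rintegrable_measurable.
  - by apply: rintegrableD; [move: (integrable_abse fi)|move: (integrable_abse gi)];
      apply: eq_integrable.
  - move=> x; have := normr_ge0 (f x); have := normr_ge0 (g x).
    by case: (leP (f x) (g x)) => _; lra.
rewrite (@rint_ae g (fun x => Num.max (f x) (g x)))//.
  by apply: rint_le => // x; rewrite le_max lexx.
by apply: filterS fg => x /max_r ->.
Qed.

Lemma rint_cvg (f_ : nat -> T -> R) f g :
  (forall n, measurable_fun setT (f_ n)) -> (forall x, f_ n x @[n --> \oo] --> f x) ->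
  rintegrable g -> (forall n x, `|f_ n x| <= g x) ->
  rintegrable f /\ \int[mu]_x f_ n x @[n --> \oo] --> \int[mu]_x f x.
Proof.
move=> mf ff gi fg.
have mlim : measurable_fun setT f by exact: (measurable_fun_cvg mf).
have ffE x : (EFin \o f_ ^~ x) @ \oo --> (f x)%:E.
  by apply: cvg_EFin; [exact: nearW|exact: ff].
have [fi _ cv] := @dominated_convergence _ _ _ mu setT measurableT
  (fun n => EFin \o f_ n) (EFin \o f) (EFin \o g)
  (fun n => (measurable_EFinP _ _).2 (mf n)) ((measurable_EFinP _ _).2 mlim)
  (aeW _ (fun x _ => ffE x)) gi (aeW _ (fun x n _ => fg n x)).
split=> //; apply: fine_cvg.
by rewrite fineK//; exact: integrable_fin_num.
Qed.

End real_integral.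

(** * Quadratic functions and the Markov operator *)

Section quadratic_functions.
Context {R : realType}.
Local Notation C := R[i].

Definition qhom m n (f : 'M[C]_(m, n) -> R) :=
  forall (a : C) (A : 'M[C]_(m, n)), f (a *: A) = csq a * f A.

(* Continuous functions of degree two; the AM-GM form of the Lipschitz bound [qlip] is
   preserved, with the same constant, by the Markov operator. *)
Definition qfun m n (f : 'M[C]_(m, n) -> R) := qhom f /\ exists2 c, 0 <= c & qlip c f.

Lemma qhom0 m n (f : 'M[C]_(m, n) -> R) : qhom f -> f 0 = 0.
Proof. by move=> fh; rewrite -(scale0r (0 : 'M[C]_(m, n))) fh csq0 mul0r. Qed.

Lemma qhomR m n (f : 'M[C]_(m, n) -> R) (r : R) (A : 'M[C]_(m, n)) :
  qhom f -> f (r%:C *: A) = r ^+ 2 * f A.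
Proof. by move=> fh; rewrite fh csqR. Qed.

Lemma qlip_bound m n c (f : 'M[C]_(m, n) -> R) (A : 'M[C]_(m, n)) :
  qlip c f -> f 0 = 0 -> `|f A| <= 2 * c * nsq A.
Proof.
move=> fl f0; have := fl 1 A 0 ltr01; rewrite f0 !subr0 nsq0 invr1 !mul1r addr0.
by move=> h; apply: le_trans h _; lra.
Qed.

Lemma qlip_weaken m n c c' (f : 'M[C]_(m, n) -> R) : c <= c' -> qlip c f -> qlip c' f.
Proof.
move=> cc fl s A B s0; apply: le_trans (fl s A B s0) _; rewrite ler_wpM2r//.
by rewrite addr_ge0// mulr_ge0 ?addr_ge0 ?nsq_ge0 ?invr_ge0// ltW.
Qed.

Lemma qlipD m n c c' (f g : 'M[C]_(m, n) -> R) : qlip c f -> qlip c' g ->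
  qlip (c + c') (fun A => f A + g A).
Proof.
move=> fl gl s A B s0; rewrite mulrDl.
have := fl s A B s0; have := gl s A B s0.
set X := c * _; set Y := c' * _ => h1 h2.
have -> : f A + g A - (f B + g B) = (f A - f B) + (g A - g B) by ring.
by apply: le_trans (ler_normD _ _) _; lra.
Qed.

Lemma qlipZ m n c (r : R) (f : 'M[C]_(m, n) -> R) : qlip c f ->
  qlip (`|r| * c) (fun A => r * f A).
Proof.
move=> fl s A B s0; rewrite -mulrBr normrM -mulrA ler_wpM2l//.
exact: fl.
Qed.

Lemma qlip_pos m n c (f : 'M[C]_(m, n) -> R) : qlip c f ->
  qlip c (fun A => Num.max (f A) 0).
Proof.
move=> fl s A B s0; apply: le_trans (fl s A B s0).
by rewrite ler_norml; case: (leP (f A) 0) => ?; case: (leP (f B) 0) => ?;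
  case: (ler0P (f A - f B)) => ?; apply/andP; split; lra.
Qed.

(** The hypotheses make [f] the pointwise infimum of [G]; a bound common to the members passes to
    it. This gives the regularity of the distance to a closed set. *)
Lemma qlip_sup m n c (G : set ('M[C]_(m, n) -> R)) (f : 'M[C]_(m, n) -> R) :
  (forall g, G g -> qlip c g) -> (forall A g, G g -> f A <= g A) ->
  (forall A e, 0 < e -> exists2 g, G g & g A < f A + e) -> qlip c f.
Proof.
move=> Gl fG Gf s A B s0; set X := c * _.
have H (A' B' : 'M[C]_(m, n)) : (forall g, G g -> `|g A' - g B'| <= X) -> f A' - f B' <= X.
  move=> h; apply/ler_addgt0Pr => e e0; have [g Gg ge] := Gf B' e e0.
  have := fG A' g Gg; have := h g Gg; rewrite ler_norml => /andP[_]; lra.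
have h1 := H A B (fun g Gg => Gl g Gg s A B s0).
have h2 : f B - f A <= X by apply: H => g Gg; rewrite distrC; exact: Gl.
by rewrite ler_norml; apply/andP; split; lra.
Qed.

Lemma qfunD m n (f g : 'M[C]_(m, n) -> R) : qfun f -> qfun g -> qfun (fun A => f A + g A).
Proof.
move=> [fh [c c0 fl]] [gh [c' c'0 gl]]; split; first by move=> a A; rewrite fh gh mulrDr.
by exists (c + c'); [rewrite addr_ge0|exact: qlipD].
Qed.

Lemma qfunZ m n (r : R) (f : 'M[C]_(m, n) -> R) : qfun f -> qfun (fun A => r * f A).
Proof.
move=> [fh [c c0 fl]]; split; first by move=> a A; rewrite fh mulrCA.
by exists (`|r| * c); [rewrite mulr_ge0|exact: qlipZ].
Qed.

Lemma qfunB m n (f g : 'M[C]_(m, n) -> R) : qfun f -> qfun g -> qfun (fun A => f A - g A).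
Proof.
move=> ff gf; have := qfunD ff (qfunZ (-1) gf).
by congr qfun; apply/funext => A; rewrite mulN1r.
Qed.

Lemma qfun_pos m n (f : 'M[C]_(m, n) -> R) : qfun f -> qfun (fun A => Num.max (f A) 0).
Proof.
move=> [fh [c c0 fl]]; split; last by exists c => //; exact: qlip_pos.
by move=> a A; rewrite fh -{1}(mulr0 (csq a)) -maxr_pMr ?csq_ge0.
Qed.

Lemma qfun_cst0 m n : qfun (fun _ : 'M[C]_(m, n) => 0 : R).
Proof.
split; first by move=> a A; rewrite mulr0.
by exists 0 => // s A B s0; rewrite subrr normr0 mul0r.
Qed.

Lemma qfun_sum m n (I : Type) (s : seq I) (f : I -> 'M[C]_(m, n) -> R) :
  (forall i, qfun (f i)) -> qfun (fun A => \sum_(i <- s) f i A).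
Proof.
move=> fq; elim: s => [|i s ih].
  have := @qfun_cst0 m n; congr qfun; apply/funext => A; by rewrite big_nil.
have := qfunD (fq i) ih; congr qfun; apply/funext => A; by rewrite big_cons.
Qed.

Lemma qfun_nsq m n : qfun (@nsq R m n).
Proof. by split; [move=> a A; rewrite nsqZ|exists 1; [|exact: nsq_qlip]]. Qed.

Lemma conjMZ m n (a : C) (A : 'M[C]_(m, n)) : a^* *: (a *: A) = (csq a)%:C *: A.
Proof. by rewrite scalerA conjMcsq. Qed.

Lemma qlip_form m n (Y : 'M[C]_m) (Z : 'M[C]_n) :
  qlip (1 + nsq Y * nsq Z) (fun A => rtr (adj A ** (Y ** A ** Z))).
Proof.
move=> s A B s0.
(* Change one factor at a time: each difference is linear in [A - B], and Young's inequality applies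
   with weight [s^-1] or [s]. *)
have -> : rtr (adj A ** (Y ** A ** Z)) - rtr (adj B ** (Y ** B ** Z)) =
    rtr (adj (A - B) ** (Y ** A ** Z)) + rtr (adj B ** (Y ** (A - B) ** Z)).
  by rewrite adjB cmulBl cmulBr cmulBl cmulBr !rtrB; ring.
apply: le_trans (ler_normD _ _) _.
have si0 : 0 < s^-1 by rewrite invr_gt0.
have h1 := rtr_adj_le (A - B) (Y ** A ** Z) si0; rewrite invrK in h1.
have h2 := rtr_adj_le B (Y ** (A - B) ** Z) s0.
have hm (D : 'M[C]_(m, n)) : nsq (Y ** D ** Z) <= nsq Y * nsq Z * nsq D.
  apply: le_trans (nsq_cmul_le _ _) _; rewrite mulrAC ler_wpM2r ?nsq_ge0//.
  exact: nsq_cmul_le.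
have h3 := ler_wpM2l (ltW s0) (hm A).
have h4 := ler_wpM2l (ltW si0) (hm (A - B)).
have p1 := mulr_ge0 (ltW s0) (nsq_ge0 A); have p2 := mulr_ge0 (ltW s0) (nsq_ge0 B).
have p3 := mulr_ge0 (ltW si0) (nsq_ge0 (A - B)).
have k0 : 0 <= nsq Y * nsq Z by rewrite mulr_ge0 ?nsq_ge0.
have q1 := mulr_ge0 k0 p1; have q2 := mulr_ge0 k0 p2; have q3 := mulr_ge0 k0 p3.
move: (rtr _) (rtr _) h1 h2 => x y; move: (nsq Y * nsq Z) h3 h4 k0 q1 q2 q3 => k.
move: (nsq (Y ** A ** Z)) (nsq (Y ** _ ** Z)) => u v.
move: (nsq A) (nsq B) (nsq (A - B)) p1 p2 p3 => a b e; move: s^-1 => t.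
move=> *; lra.
Qed.

Lemma qfun_form m n (Y : 'M[C]_m) (Z : 'M[C]_n) :
  qfun (fun A => rtr (adj A ** (Y ** A ** Z))).
Proof.
split; last first.
  by exists (1 + nsq Y * nsq Z); [rewrite addr_ge0// mulr_ge0 ?nsq_ge0|exact: qlip_form].
by move=> a A; rewrite adjZ cmulZl cmulZr cmulZl cmulZr conjMZ rtrZ.
Qed.

(* With the convention [0 / 0 = 0] at [A = 0]. *)
Definition qprod m n (f g : 'M[C]_(m, n) -> R) : 'M[C]_(m, n) -> R :=
  fun A => f A * g A / nsq A.

Lemma qfun_prod m n (f g : 'M[C]_(m, n) -> R) : qfun f -> qfun g -> qfun (qprod f g).
Proof.
move=> [fh [c c0 fl]] [gh [c' c'0 gl]].
have f0 := qhom0 fh; have g0 := qhom0 gh.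
split.
  move=> a A; rewrite /qprod fh gh nsqZ; have [->|a0] := eqVneq (csq a) 0.
    by rewrite !mul0r.
  have [->|A0] := eqVneq (nsq A) 0; first by rewrite mulr0 invr0 !mulr0.
  by field; rewrite A0 a0.
(* The quotients by [nsq] are bounded by [2 * c] and [2 * c']; the two terms of the identity [E]
   cost [2 * c * c'] and [6 * c * c'] times the bracket. *)
exists (8 * c * c'); first by rewrite !mulr_ge0.
move=> s A B s0; rewrite /qprod.
have bd (h : 'M[C]_(m, n) -> R) e (D : 'M[C]_(m, n)) : 0 <= e -> qlip e h -> h 0 = 0 ->
    `|h D / nsq D| <= 2 * e.
  move=> e0 hl h0; have := qlip_bound D hl h0; have [->|/nsq_gt0 D0] := eqVneq D 0.
    by move=> _; rewrite h0 mul0r normr0 mulr_ge0.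
  by rewrite normrM normfV (gtr0_norm D0) ler_pdivrMr.
have b1 := bd _ _ B c0 fl f0; have b2 := bd _ _ A c'0 gl g0.
have E : f A * g A / nsq A - f B * g B / nsq B = (f A - f B) * (g A / nsq A) +
   (f B / nsq B) * ((g A - g B) + (g A / nsq A) * (nsq B - nsq A)).
  have [->|/nsq_gt0/lt0r_neq0 A0] := eqVneq A 0; have [->|/nsq_gt0/lt0r_neq0 B0] := eqVneq B 0.
  - by rewrite f0 nsq0; ring.
  - by rewrite f0 g0 nsq0 !(mul0r, mulr0, sub0r, add0r, subr0, addr0); ring.
  - by rewrite f0 g0 nsq0 !(mul0r, mulr0, sub0r, add0r, subr0, addr0); ring.
  - by field; rewrite A0 B0.
rewrite E; set X := s * _ + _.
have X0 : 0 <= X.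
  by rewrite /X addr_ge0// mulr_ge0 ?addr_ge0 ?nsq_ge0 ?invr_ge0// ltW.
have l1 : `|f A - f B| <= c * X := fl s A B s0.
have l2 : `|g A - g B| <= c' * X := gl s A B s0.
have l3 : `|nsq B - nsq A| <= X by rewrite distrC -[X]mul1r; exact: nsq_qlip.
apply: le_trans (ler_normD _ _) _.
rewrite (normrM (f A - f B)) (normrM (f B / nsq B)).
have t1 : `|f A - f B| * `|g A / nsq A| <= (c * X) * (2 * c') by apply: ler_pM.
have t2 : `|g A - g B + g A / nsq A * (nsq B - nsq A)| <= c' * X + (2 * c') * X.
  by apply: le_trans (ler_normD _ _) _; rewrite normrM lerD// ler_pM.
have t3 : `|f B / nsq B| * `|g A - g B + g A / nsq A * (nsq B - nsq A)| <=
  (2 * c) * (c' * X + (2 * c') * X) by apply: ler_pM.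
by apply: le_trans (lerD t1 t3) _; rewrite le_eqVlt; apply/orP; left; apply/eqP; ring.
Qed.

Lemma qfun_continuous m n (f : 'M[C]_(m, n) -> R) : qfun f -> continuous f.
Proof. by move=> [_ [c c0 fl]]; exact: qlip_continuous fl. Qed.

End quadratic_functions.

Section markov_operator.
Context {R : realType} {k : nat}.
Local Notation C := R[i].
Local Notation Mk := 'M[C]_k.+1.
Variable mu : {measure set (borel Mk) -> \bar R}.
Hypothesis mu_nsq : rintegrable mu (fun v : borel Mk => nsq (v : Mk)).
Hypothesis mu_form : forall Y : Mk,
  \int[mu]_v rtr (adj (v : Mk) ** (v : Mk) ** Y) = rtr Y.

Definition markov m (f : 'M[C]_(k.+1, m) -> R) (A : 'M[C]_(k.+1, m)) : R :=
  \int[mu]_v f ((v : Mk) ** A).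

Lemma qlip_orbit m c (f : 'M[C]_(k.+1, m) -> R) (A : 'M[C]_(k.+1, m)) :
  0 <= c -> qlip c f -> qlip (c * nsq A) (fun v : Mk => f (v ** A)).
Proof.
move=> c0 fl s v w s0; apply: le_trans (fl s _ _ s0) _; rewrite -mulrA ler_wpM2l//.
have h1 := nsq_cmul_le v A; have h2 := nsq_cmul_le w A; have h3 := nsq_cmul_le (v - w) A.
rewrite cmulBl in h3.
have si0 : 0 < s^-1 by rewrite invr_gt0.
have h4 : s * (nsq (v ** A) + nsq (w ** A)) <= s * ((nsq v + nsq w) * nsq A).
  by rewrite ler_pM2l// mulrDl lerD.
have h5 := ler_wpM2l (ltW si0) h3.
lra.
Qed.

Lemma orbit_measurable m (f : 'M[C]_(k.+1, m) -> R) (A : 'M[C]_(k.+1, m)) :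
  qfun f -> measurable_fun setT (fun v : borel Mk => f ((v : Mk) ** A)).
Proof.
move=> [_ [c c0 fl]]; apply: (@continuous_measurable_fun R Mk).
by apply: (qlip_continuous _ (qlip_orbit A c0 fl)); rewrite mulr_ge0// nsq_ge0.
Qed.

Lemma orbit_nsq_integrable m (A : 'M[C]_(k.+1, m)) :
  rintegrable mu (fun v : borel Mk => nsq ((v : Mk) ** A)).
Proof.
apply: (@rintegrable_le _ _ _ mu _ (fun v : borel Mk => nsq A * nsq (v : Mk))).
- exact: orbit_measurable (@qfun_nsq _ _ _).
- exact: rintegrableZ.
- by move=> v; rewrite ger0_norm ?nsq_ge0// mulrC nsq_cmul_le.
Qed.

Lemma orbit_integrable m (f : 'M[C]_(k.+1, m) -> R) (A : 'M[C]_(k.+1, m)) :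
  qfun f -> rintegrable mu (fun v : borel Mk => f ((v : Mk) ** A)).
Proof.
move=> fq; have [fh [c c0 fl]] := fq.
apply: (@rintegrable_le _ _ _ mu _ (fun v : borel Mk => 2 * c * nsq ((v : Mk) ** A))).
- exact: orbit_measurable.
- exact/rintegrableZ/orbit_nsq_integrable.
- by move=> v; apply: qlip_bound => //; exact: qhom0.
Qed.

(** By cyclicity the integrand pairs [adj v ** v] with [A Z A^*]: the Gram matrix [A^* A] is
    preserved on average. The invariance of [nsq] and of the tangents to the purity comes from
    this. *)
Lemma markov_form m (Z : 'M[C]_m) (A : 'M[C]_(k.+1, m)) :
  markov (fun B => rtr (adj B ** B ** Z)) A = rtr (adj A ** A ** Z).
Proof.
rewrite -(rtrC Z) (_ : Z ** _ = (Z ** adj A) ** A); last by rewrite cmulA.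
rewrite rtrC -mu_form; apply: eq_Rintegral => v _.
rewrite adjM -(rtrC Z); rewrite -[RHS]rtrC.
by rewrite -!cmulA -[RHS]rtrC -!cmulA.
Qed.

Lemma markov_nsq m (A : 'M[C]_(k.+1, m)) : markov (@nsq R _ _) A = nsq A.
Proof.
rewrite nsqE -[adj A ** A]cmul1r -markov_form; apply: eq_Rintegral => v _.
by rewrite cmul1r nsqE.
Qed.

Lemma markovD m (f g : 'M[C]_(k.+1, m) -> R) (A : 'M[C]_(k.+1, m)) : qfun f -> qfun g ->
  markov (fun B => f B + g B) A = markov f A + markov g A.
Proof. by move=> fq gq; apply: RintegralD => //; exact: orbit_integrable. Qed.

Lemma markovZ m (r : R) (f : 'M[C]_(k.+1, m) -> R) (A : 'M[C]_(k.+1, m)) : qfun f ->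
  markov (fun B => r * f B) A = r * markov f A.
Proof. by move=> fq; apply: RintegralZl => //; exact: orbit_integrable. Qed.

Lemma markovB m (f g : 'M[C]_(k.+1, m) -> R) (A : 'M[C]_(k.+1, m)) : qfun f -> qfun g ->
  markov (fun B => f B - g B) A = markov f A - markov g A.
Proof. by move=> fq gq; apply: RintegralB => //; exact: orbit_integrable. Qed.

Lemma markov_le m (f g : 'M[C]_(k.+1, m) -> R) (A : 'M[C]_(k.+1, m)) : qfun f -> qfun g ->
  (forall B, f B <= g B) -> markov f A <= markov g A.
Proof. by move=> fq gq fg; apply: rint_le => //; exact: orbit_integrable. Qed.

(** The right side of the bound is a combination of values of [nsq], which is invariant, so
    integrating it at [v A] and [v B] reproduces it. All iterates of [f] are thus equicontinuous
    with one constant. *)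
Lemma markov_qlip m c (f : 'M[C]_(k.+1, m) -> R) : qfun f -> qlip c f ->
  qlip c (markov f).
Proof.
move=> fq fl s A B s0.
apply: (@le_trans _ _ (\int[mu]_v (c * (s * (nsq ((v : Mk) ** A) + nsq ((v : Mk) ** B))
   + s^-1 * nsq ((v : Mk) ** (A - B)))))); last first.
  have iA := orbit_nsq_integrable A; have iB := orbit_nsq_integrable B.
  have iAB := orbit_nsq_integrable (A - B).
  have i1 := rintegrableD iA iB; have i2 := rintegrableZ s i1.
  have i3 := rintegrableZ s^-1 iAB; have i4 := rintegrableD i2 i3.
  rewrite RintegralZl// RintegralD// RintegralZl// RintegralD// RintegralZl//.
  by rewrite -!/(markov _ _) !markov_nsq.
apply: rint_absB_le; try exact: orbit_integrable.
- do 2 apply: rintegrableD || apply: rintegrableZ.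
    by apply: rintegrableZ; apply: rintegrableD; exact: orbit_nsq_integrable.
  by apply: rintegrableZ; exact: orbit_nsq_integrable.
- by move=> v; have := fl s ((v : Mk) ** A) ((v : Mk) ** B) s0; rewrite cmulBr.
Qed.

Lemma markov_qfun m (f : 'M[C]_(k.+1, m) -> R) : qfun f -> qfun (markov f).
Proof.
move=> fq; have [fh [c c0 fl]] := fq; split; last by exists c => //; exact: markov_qlip.
move=> a A; rewrite -[RHS]RintegralZl//; last exact: orbit_integrable.
by apply: eq_Rintegral => v _; rewrite cmulZr fh.
Qed.

Lemma markov_cvg m (f_ : nat -> 'M[C]_(k.+1, m) -> R) (f : 'M[C]_(k.+1, m) -> R) c A :
  (forall n, qfun (f_ n)) -> (forall n B, `|f_ n B| <= c * nsq B) ->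
  (forall B, f_ n B @[n --> \oo] --> f B) ->
  markov (f_ n) A @[n --> \oo] --> markov f A.
Proof.
move=> fq fb ff.
have [] := @rint_cvg _ _ _ mu (fun n (v : borel Mk) => f_ n ((v : Mk) ** A))
  (fun v : borel Mk => f ((v : Mk) ** A)) (fun v : borel Mk => c * nsq ((v : Mk) ** A)).
- by move=> n; exact: orbit_measurable.
- by move=> v; exact: ff.
- exact/rintegrableZ/orbit_nsq_integrable.
- by move=> n v; exact: fb.
- by [].
Qed.

Definition iter_markov m n (f : 'M[C]_(k.+1, m) -> R) := iter n (@markov m) f.

Lemma iter_markov_qfun m n (f : 'M[C]_(k.+1, m) -> R) : qfun f -> qfun (iter_markov n f).
Proof. by move=> fq; elim: n => //= n; exact: markov_qfun. Qed.

Lemma iter_markov_qlip m c n (f : 'M[C]_(k.+1, m) -> R) : qfun f -> qlip c f ->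
  qlip c (iter_markov n f).
Proof.
move=> fq fl; elim: n => //= n ih; apply: markov_qlip => //; exact: iter_markov_qfun.
Qed.

Lemma iter_markovD m n (f g : 'M[C]_(k.+1, m) -> R) (A : 'M[C]_(k.+1, m)) :
  qfun f -> qfun g ->
  iter_markov n (fun B => f B + g B) A = iter_markov n f A + iter_markov n g A.
Proof.
move=> fq gq; elim: n A => //= n ih A.
rewrite -markovD; [|exact: iter_markov_qfun|exact: iter_markov_qfun].
by congr markov; apply/funext => B; exact: ih.
Qed.

Lemma iter_markovZ m n r (f : 'M[C]_(k.+1, m) -> R) (A : 'M[C]_(k.+1, m)) :
  qfun f -> iter_markov n (fun B => r * f B) A = r * iter_markov n f A.
Proof.
move=> fq; elim: n A => //= n ih A; rewrite -markovZ; last exact: iter_markov_qfun.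
by congr markov; apply/funext => B; exact: ih.
Qed.

Lemma iter_markovB m n (f g : 'M[C]_(k.+1, m) -> R) (A : 'M[C]_(k.+1, m)) :
  qfun f -> qfun g ->
  iter_markov n (fun B => f B - g B) A = iter_markov n f A - iter_markov n g A.
Proof.
move=> fq gq; elim: n A => //= n ih A.
rewrite -markovB; [|exact: iter_markov_qfun|exact: iter_markov_qfun].
by congr markov; apply/funext => B; exact: ih.
Qed.

Lemma iter_markov_le m n (f g : 'M[C]_(k.+1, m) -> R) (A : 'M[C]_(k.+1, m)) :
  qfun f -> qfun g -> (forall B, f B <= g B) -> iter_markov n f A <= iter_markov n g A.
Proof.
move=> fq gq fg; elim: n A => //= n ih A.
by apply: markov_le => //; exact: iter_markov_qfun.
Qed.

Lemma iter_markov_fix m n (f : 'M[C]_(k.+1, m) -> R) :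
  (forall A, markov f A = f A) -> iter_markov n f = f.
Proof. by move=> ff; elim: n => //= n ->; apply/funext => A; exact: ff. Qed.

Lemma iter_markov_nsq m n (A : 'M[C]_(k.+1, m)) : iter_markov n (@nsq R _ _) A = nsq A.
Proof. by rewrite iter_markov_fix// => B; exact: markov_nsq. Qed.

Lemma iter_markovSr m n (f : 'M[C]_(k.+1, m) -> R) :
  iter_markov n.+1 f = iter_markov n (markov f).
Proof. by rewrite /iter_markov iterSr. Qed.

End markov_operator.

(** * Positive matrices *)

Section hermitian_matrices.
Context {R : realType}.
Local Notation C := R[i].

Definition dg n (d : 'I_n -> R) : 'M[C]_n := diag_mx (\row_i (d i)%:C).

Lemma dg_mx n (d : 'I_n -> R) i j : dg d i j = (if i == j then d i else 0)%:C.
Proof. by rewrite !mxE; case: eqP => [->|]; rewrite ?mulr1n ?mulr0n. Qed.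

Lemma dgM n (d e : 'I_n -> R) : dg d ** dg e = dg (fun i => d i * e i).
Proof.
rewrite cmulE mulmx_diag; congr diag_mx; apply/matrixP => i j; rewrite !mxE.
by rewrite -rmorphM.
Qed.

Lemma adj_dg n (d : 'I_n -> R) : adj (dg d) = dg d.
Proof.
apply/matrixP => i j; rewrite adj_mx !dg_mx eq_sym.
by case: eqP => [->|_]; apply: complex_ext => //=; rewrite oppr0.
Qed.

Lemma dgB n (d e : 'I_n -> R) : dg d - dg e = dg (fun i => d i - e i).
Proof.
apply/matrixP => i j; rewrite mxE [(- dg e) i j]mxE !dg_mx; case: eqP => _.
  by rewrite -rmorphB.
by rewrite -rmorphB subrr.
Qed.

Definition herm n (A : 'M[C]_n) := adj A = A.

Lemma spectral n (A : 'M[C]_n) : herm A -> exists (U : 'M[C]_n) (d : 'I_n -> R),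
  [/\ U ** adj U = 1%:M, adj U ** U = 1%:M & A = adj U ** dg d ** U].
Proof.
move=> hA; have hs : A \is hermsymmx.
  by rewrite qualifE /= expr0 scale1r; apply/eqP; rewrite -[in LHS]hA adjE.
have := hermitian_normalmx hs => /orthomx_spectralP.
have Uu := spectral_unitarymx A; have dr := hermitian_spectral_diag_real hs.
rewrite invmx_unitary//; set U := spectralmx A; set D := spectral_diag A => E.
exists U, (fun i => Re (D 0 i)).
have UU : U ** adj U = 1%:M by rewrite cmulE adjE; apply/unitarymxP.
have Dd : diag_mx D = dg (fun i => Re (D 0 i)).
  congr diag_mx; apply/matrixP => i j; rewrite ord1 mxE; apply/esym/RRe_real.
  by move/mxOverP : dr.
split=> //; last by rewrite !cmulE adjE -Dd.
by move: UU; rewrite !cmulE => /mulmx1C.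
Qed.

Definition fcalc n (U : 'M[C]_n) d := adj U ** dg d ** U.

Lemma fcalcM n (U : 'M[C]_n) d e : U ** adj U = 1%:M ->
  fcalc U d ** fcalc U e = fcalc U (fun i => d i * e i).
Proof.
move=> UU; rewrite /fcalc -!cmulA (cmulA U) UU cmul1l -dgM.
by rewrite !cmulA.
Qed.

Lemma herm_fcalc n (U : 'M[C]_n) d : herm (fcalc U d).
Proof. by rewrite /herm /fcalc !adjM adjK adj_dg !cmulA. Qed.

Lemma fcalcB n (U : 'M[C]_n) d e :
  fcalc U d - fcalc U e = fcalc U (fun i => d i - e i).
Proof. by rewrite /fcalc -dgB cmulBr cmulBl. Qed.

Lemma fcalc_ext n (U : 'M[C]_n) d e : d =1 e -> fcalc U d = fcalc U e.
Proof. by move=> /funext ->. Qed.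

Definition psd n (A : 'M[C]_n) :=
  herm A /\ forall y : 'cV[C]_n, 0 <= rtr (adj y ** (A ** y)).

Lemma psd_sq m n (B : 'M[C]_(n, m)) : psd (B ** adj B).
Proof.
split; first by rewrite /herm adjM adjK.
move=> y; rewrite -cmulA cmulA (_ : adj y ** B = adj (adj B ** y)).
  by rewrite -nsqE nsq_ge0.
by rewrite adjM adjK.
Qed.

Lemma psd_fcalc n (U : 'M[C]_n) d : U ** adj U = 1%:M ->
  (forall i, 0 <= d i) -> psd (fcalc U d).
Proof.
move=> UU d0; rewrite (@fcalc_ext _ _ _ (fun i => Num.sqrt (d i) * Num.sqrt (d i))).
  by rewrite -fcalcM// -{2}(herm_fcalc U (fun i => Num.sqrt (d i))); exact: psd_sq.
by move=> i; rewrite -expr2 sqr_sqrtr.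
Qed.

Lemma psd_factor n (A : 'M[C]_n) : psd A -> exists B : 'M[C]_n, A = B ** adj B.
Proof.
move=> [hA pA]; have [U [d [UU U'U E]]] := spectral hA.
have d0 i : 0 <= d i.
  (* Tested on the [i]-th eigenvector, the form returns the eigenvalue [d i]. *)
  have := pA (adj U ** delta_mx i 0); rewrite adjM adjK E.
  rewrite -(cmulA (adj (delta_mx i 0))) (cmulA U) -!(cmulA (adj U)) (cmulA U (adj U)) UU cmul1l.
  rewrite -!cmulA (cmulA U (adj U)) UU cmul1l.
  rewrite rtrE /mxtrace big_ord1 cmul_mx (bigD1 i)//= big1 ?addr0.
    rewrite adj_mx mxE !eqxx cmul_mx (bigD1 i)//= big1 ?addr0.
      rewrite (_ : delta_mx i 0 i ord0 = 1); last by rewrite mxE !eqxx.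
      by rewrite dg_mx eqxx ReM /= !(mulr1, oppr0, mul0r, mulr0, subr0, mul1r, addr0).
    by move=> j ji; rewrite dg_mx eq_sym (negbTE ji); exact: mul0r.
  by move=> j ji; rewrite adj_mx mxE (negbTE ji) conjc0 mul0r.
exists (fcalc U (fun i => Num.sqrt (d i))).
rewrite herm_fcalc fcalcM// E; apply: fcalc_ext => i.
by rewrite -expr2 sqr_sqrtr.
Qed.

Lemma psdZ n (r : R) (A : 'M[C]_n) : 0 <= r -> psd A -> psd (r%:C *: A).
Proof.
move=> r0 [hA pA]; split; first by rewrite /herm adjZR hA.
by move=> y; rewrite cmulZl cmulZr rtrZ mulr_ge0.
Qed.

Lemma rtr_sq m n (B : 'M[C]_(n, m)) : rtr (B ** adj B) = nsq B.
Proof. by rewrite rtrC nsqE. Qed.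

Lemma psd_rtr n (A : 'M[C]_n) : psd A -> 0 <= rtr A.
Proof. by move=> /psd_factor[B ->]; rewrite rtr_sq nsq_ge0. Qed.

Lemma psd_rtr0 n (A : 'M[C]_n) : psd A -> rtr A = 0 -> A = 0.
Proof. by move=> /psd_factor[B ->]; rewrite rtr_sq => /nsq_eq0 ->; rewrite cmul0l. Qed.

Lemma psd_conj m n (A : 'M[C]_n) (B : 'M[C]_(m, n)) : psd A -> psd (B ** A ** adj B).
Proof.
by move=> /psd_factor[D ->]; rewrite cmulA -cmulA -adjM; exact: psd_sq.
Qed.

Lemma rtr_psd_mul n (A B : 'M[C]_n) : psd A -> psd B -> 0 <= rtr (A ** B).
Proof.
move=> pA /psd_factor[D ->]; rewrite cmulA rtrC cmulA.
by have := psd_conj (adj D) pA; rewrite adjK => /psd_rtr.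
Qed.

(** For [A = D D^*] and [B = E E^*], [rtr (A ** B)] is [nsq (adj D ** E)]. *)
Lemma rtr_psd_mul0 n (A B : 'M[C]_n) : psd A -> psd B -> rtr (A ** B) = 0 -> A ** B = 0.
Proof.
move=> /psd_factor[D ->] /psd_factor[E ->] h.
have : nsq (adj D ** E) = 0.
  by rewrite -rtr_sq -h adjM adjK -(cmulA D) (rtrC D) !cmulA.
by move=> /nsq_eq0 z; rewrite -cmulA (cmulA (adj D)) z cmul0l cmul0r.
Qed.

Lemma psd_mul0_sym n (A B : 'M[C]_n) : herm A -> herm B -> A ** B = 0 -> B ** A = 0.
Proof.
move=> hA hB z; rewrite -[LHS]adjK adjM hA hB z.
by apply: nsq_eq0; rewrite nsqJ nsq0.
Qed.

Definition projector n (P : 'M[C]_n) := herm P /\ P ** P = P.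

Lemma projector_psd n (P : 'M[C]_n) : projector P -> psd P.
Proof. by move=> [hP PP]; rewrite -PP -{2}hP; exact: psd_sq. Qed.

Lemma projectorC n (P : 'M[C]_n) : projector P -> projector (1%:M - P).
Proof.
move=> [hP PP]; split; first by rewrite /herm adjB adj1 hP.
by rewrite cmulBl !cmulBr !cmul1l cmul1r PP subrr subr0.
Qed.

(** The projector is kept because later arguments separate [A1] from [A2] by testing against [P] and
    [1 - P]. *)
Lemma jordan n (A : 'M[C]_n) : herm A -> exists P A1 A2 : 'M[C]_n,
  [/\ projector P, psd A1, psd A2, A = A1 - A2 & P ** A1 = A1 /\ P ** A2 = 0].
Proof.
move=> hA; have [U [d [UU U'U E]]] := spectral hA.
exists (fcalc U (fun i => if 0 < d i then 1 else 0)),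
  (fcalc U (fun i => Num.max (d i) 0)), (fcalc U (fun i => Num.max (- d i) 0)).
split.
- split; first exact: herm_fcalc.
  by rewrite fcalcM//; apply: fcalc_ext => i; case: ifP; rewrite ?mulr1 ?mulr0.
- by apply: psd_fcalc => // i; rewrite le_max lexx orbT.
- by apply: psd_fcalc => // i; rewrite le_max lexx orbT.
- rewrite E fcalcB; apply: fcalc_ext => i.
  case: (ltrP 0 (d i)) => di.
    by rewrite max_r ?subr0// oppr_le0 ltW.
  by rewrite max_l ?oppr_ge0// sub0r opprK.
- rewrite !fcalcM//; split.
    apply: fcalc_ext => i; case: ltrP => di; first by rewrite mul1r.
    exact: mul0r.
  rewrite (@fcalc_ext _ _ _ (fun i => d i - d i)).
    by rewrite -fcalcB subrr.
  move=> i; rewrite subrr; case: ltrP => di; last by rewrite mul0r.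
  by rewrite mul1r max_r// oppr_le0 ltW.
Qed.

(** [D] is the pseudo-inverse of [A]. Writing the projector as [A ** D] lets relations satisfied by
    [A] be transported to its range. *)
Lemma range_projector m n (A : 'M[C]_(n, m)) :
  exists D : 'M[C]_(m, n), projector (A ** D) /\ (A ** D) ** A = A.
Proof.
have [hA _] := psd_sq A; have [U [d [UU U'U E]]] := spectral hA.
have E' : A ** adj A = fcalc U d by [].
(* Since [0^-1 = 0], [d i / d i] is the indicator of the nonzero eigenvalues. *)
exists (adj A ** fcalc U (fun i => (d i)^-1)).
have PE : A ** (adj A ** fcalc U (fun i => (d i)^-1)) = fcalc U (fun i => d i / d i).
  by rewrite cmulA E' fcalcM.
rewrite PE; split.
  split; first exact: herm_fcalc.
  rewrite fcalcM//; apply: fcalc_ext => i.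
  by have [->|d0] := eqVneq (d i) 0; rewrite ?invr0 ?mulr0// divff// mulr1.
set P := fcalc _ _; have PA : P ** (A ** adj A) = A ** adj A.
  rewrite E' fcalcM//; apply: fcalc_ext => i.
  by have [->|d0] := eqVneq (d i) 0; rewrite ?mulr0// divff// mul1r.
apply/eqP; rewrite -subr_eq0; apply/eqP/nsq_eq0.
rewrite -rtr_sq adjB adjM herm_fcalc -/P cmulBl !cmulBr.
rewrite -(cmulA P A (adj A ** P)) (cmulA A (adj A) P) -(cmulA P A (adj A)).
by rewrite (cmulA P (A ** adj A) P) PA subrr rtr0.
Qed.

Lemma rtr_delta m n (X : 'M[C]_(m, n)) (a : C) i j :
  rtr (X ** (a *: delta_mx j i)) = Re (a * X i j).
Proof.
rewrite cmulZr rtrE mxtraceZ; congr (Re (_ * _)).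
rewrite /mxtrace (bigD1 i)//= cmul_mx (bigD1 j)//= mxE !eqxx mulr1 !big1 ?addr0//.
  move=> l li; rewrite cmul_mx big1// => q _.
  by rewrite mxE (negbTE li) andbF mulr0.
by move=> q qj; rewrite mxE (negbTE qj) mulr0.
Qed.

(** The real part of the trace separates matrices because the test matrices are complex: a factor
    ['i] brings imaginary parts into the real part. *)
Lemma rtr_inj n (X Y : 'M[C]_n) : (forall Z, rtr (Z ** X) = rtr (Z ** Y)) -> X = Y.
Proof.
move=> h; apply/matrixP => i j; apply: complex_ext.
  by have := h (1 *: delta_mx j i); rewrite !(rtrC (_ *: _)) !rtr_delta !mul1r.
have := h ('i *: delta_mx j i); rewrite !(rtrC (_ *: _)) !rtr_delta !ReM /=.
by rewrite !mul0r !mul1r !sub0r => /oppr_inj.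
Qed.

Lemma nsq_outer m n (u : 'cV[C]_m) (w : 'rV[C]_n) : nsq (u ** w) = nsq u * nsq w.
Proof.
rewrite !nsq_sum [in X in _ * X]big_ord1 mulr_suml; apply: eq_bigr => i _.
rewrite big_ord1 mulr_sumr; apply: eq_bigr => j _.
by rewrite cmul_mx big_ord1 csqM.
Qed.

Lemma gram_cV n (u : 'cV[C]_n) : adj u ** u = (nsq u)%:C%:M.
Proof.
apply/matrixP => i j; rewrite !ord1 [in RHS]mxE eqxx mulr1n; apply: complex_ext.
  by rewrite nsqE rtrE /mxtrace big_ord1.
by rewrite cmul_mx Im_sum big1// => q _; rewrite adj_mx conjMcsq.
Qed.

Lemma nsq_scalar1 (a : C) : nsq (a%:M : 'M[C]_1) = csq a.
Proof. by rewrite nsq_sum !big_ord1 mxE eqxx mulr1n. Qed.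

(** Equality case of [nsq (adj A ** A) <= nsq A ^+ 2]: when the range lies in a line, [A] is an
    outer product [u ** w]. *)
Lemma nsq_rank1 n (A P : 'M[C]_n) : \rank P = 1%N -> P ** A = A ->
  nsq (adj A ** A) = nsq A ^+ 2.
Proof.
move=> r1 PA; have [u [w ->]] : exists (u : 'cV[C]_n) (w : 'rV[C]_n), A = u ** w.
  rewrite -PA -(mulmx_base P); move: (col_base P) (row_base P); rewrite r1 => u w.
  by exists u, (w ** A); rewrite cmulA -(cmulE u).
have -> : adj (u ** w) ** (u ** w) = (nsq u)%:C *: (adj w ** w).
  by rewrite adjM -cmulA (cmulA (adj u)) gram_cV [in X in _ ** X]cmulE mul_scalar_mx cmulZr.
rewrite nsqZ csqR !nsq_outer nsqJ; ring.
Qed.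

End hermitian_matrices.

(** * Measurability of matrix-valued functions and of words *)

Section measurable_matrices.
Context {R : realType} {d : measure_display} {T : measurableType d}.
Local Notation C := R[i].

(** Entrywise measurability needs no sigma-algebra on rectangular matrices, and applies to words,
    which live on spaces of tuples. *)
Definition mxmeas m n (F : T -> 'M[C]_(m, n)) := forall i j,
  measurable_fun setT (fun t => Re (F t i j)) /\ measurable_fun setT (fun t => Im (F t i j)).

Lemma mxmeas_cst m n (A : 'M[C]_(m, n)) : mxmeas (fun=> A).
Proof. by move=> i j; split; exact: measurable_cst. Qed.

Lemma mxmeas_mul m n p (F : T -> 'M[C]_(m, n)) (G : T -> 'M[C]_(n, p)) :
  mxmeas F -> mxmeas G -> mxmeas (fun t => F t ** G t).
Proof.
move=> mF mG i j; split.
  rewrite (_ : (fun t => _) = (fun t => \sum_l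
     (Re (F t i l) * Re (G t l j) - Im (F t i l) * Im (G t l j)))).
    apply: measurable_sum => l; have [F1 F2] := mF i l; have [G1 G2] := mG l j.
    by apply: measurable_funB; exact: measurable_funM.
  by apply/funext => t; rewrite cmul_mx Re_sum; apply: eq_bigr => l _; rewrite ReM.
rewrite (_ : (fun t => _) = (fun t => \sum_l
   (Re (F t i l) * Im (G t l j) + Im (F t i l) * Re (G t l j)))).
  apply: measurable_sum => l; have [F1 F2] := mF i l; have [G1 G2] := mG l j.
  by apply: measurable_funD; exact: measurable_funM.
by apply/funext => t; rewrite cmul_mx Im_sum; apply: eq_bigr => l _; rewrite ImM.
Qed.

Lemma mxmeas_adj m n (F : T -> 'M[C]_(m, n)) : mxmeas F -> mxmeas (fun t => adj (F t)).
Proof.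
move=> mF i j; have [F1 F2] := mF j i; split.
  by rewrite (_ : (fun t => _) = (fun t => Re (F t j i)))//; apply/funext => t; rewrite adj_mx ReJ.
rewrite (_ : (fun t => _) = (fun t => - Im (F t j i))); first exact: measurable_funN.
by apply/funext => t; rewrite adj_mx ImJ.
Qed.

Lemma measurable_nsq m n (F : T -> 'M[C]_(m, n)) :
  mxmeas F -> measurable_fun setT (fun t => nsq (F t)).
Proof.
move=> mF; rewrite (_ : (fun t => _) = (fun t => \sum_i \sum_j
   (Re (F t i j) ^+ 2 + Im (F t i j) ^+ 2))).
  apply: measurable_sum => i; apply: measurable_sum => j; have [F1 F2] := mF i j.
  by apply: measurable_funD; exact: measurable_funX.
by apply/funext => t; rewrite nsq_sum.
Qed.

Lemma measurable_rtr n (F : T -> 'M[C]_n) :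
  mxmeas F -> measurable_fun setT (fun t => rtr (F t)).
Proof.
move=> mF; rewrite (_ : (fun t => _) = (fun t => \sum_i Re (F t i i))).
  by apply: measurable_sum => i; have [] := mF i i.
by apply/funext => t; rewrite rtrE /mxtrace Re_sum.
Qed.

Lemma measurable_inv (f : T -> R) :
  measurable_fun setT f -> measurable_fun setT (fun t => (f t)^-1).
Proof.
apply: measurableT_comp; rewrite -(setvU [set (0 : R)]).
apply/measurable_funU => //; first exact: measurableC.
split; last exact: measurable_fun_set1.
have cl : closed [set (0 : R)] by exact: closed_eq.
apply: open_continuous_measurable_fun; first exact: closed_openC.
by move=> x; rewrite inE /= => /eqP x0; exact: inv_continuous.
Qed.

End measurable_matrices.

Lemma mxmeas_comp (R : realType) d d' (T : measurableType d) (T' : measurableType d')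
    m n (F : T -> 'M[R[i]]_(m, n)) (g : T' -> T) :
  mxmeas F -> measurable_fun setT g -> mxmeas (fun t => F (g t)).
Proof.
move=> mF mg i j; have [F1 F2] := mF i j.
by split; [exact: (measurableT_comp F1 mg)|exact: (measurableT_comp F2 mg)].
Qed.

Section borel_matrices.
Context {R : realType} {k : nat}.
Local Notation C := R[i].
Local Notation Mk := 'M[C]_k.+1.

Lemma continuous_Re_entry i j : continuous (fun A : Mk => Re (A i j)).
Proof.
apply/continuous_nsqP => A e e0; exists (e ^+ 2); first exact: exprn_gt0.
move=> B h; rewrite -ReB; have h2 := csq_le_nsq (A - B) i j; rewrite !mxE in h2.
rewrite -(@ltr_pXn2r _ 2)// ?nnegrE ?ltW// real_normK ?num_real//.
apply: le_lt_trans (le_lt_trans h2 h); by rewrite /csq lerDl sqr_ge0.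
Qed.

Lemma continuous_Im_entry i j : continuous (fun A : Mk => Im (A i j)).
Proof.
apply/continuous_nsqP => A e e0; exists (e ^+ 2); first exact: exprn_gt0.
move=> B h; have h2 := csq_le_nsq (A - B) i j; rewrite !mxE in h2.
rewrite -Im_opp -ImD -(@ltr_pXn2r _ 2)// ?nnegrE ?ltW// real_normK ?num_real//.
apply: le_lt_trans (le_lt_trans h2 h); by rewrite /csq lerDr sqr_ge0.
Qed.

Lemma mxmeas_id : @mxmeas R _ (borel Mk) _ _ (fun v => v : Mk).
Proof.
move=> i j; split; apply: (@continuous_measurable_fun R Mk).
  exact: continuous_Re_entry.
exact: continuous_Im_entry.
Qed.

(** The first letter acts first, so prepending a letter multiplies the word on the right. This
    matches the order in which [power_measure] adds factors and [markov] is iterated. *)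
Definition word n (t : n.-tuple (borel Mk)) : Mk := \prod_(v <- rev t) (v : Mk).

Lemma word_tcons n (v : borel Mk) (t : n.-tuple (borel Mk)) :
  word (tcons (v, t)) = word t ** (v : Mk).
Proof. by rewrite /word /= rev_cons -cats1 big_cat /= big_seq1 cmulE. Qed.

Lemma mxmeas_word n : mxmeas (@word n).
Proof.
elim: n => [|n ih].
  rewrite (_ : @word 0 = fun=> 1); first exact: mxmeas_cst.
  by apply/funext => t; rewrite (tuple0 t) /word /= big_nil.
rewrite (_ : @word n.+1 = fun t => word [tuple of behead t] ** (thead t : Mk)).
  apply: mxmeas_mul.
    exact: mxmeas_comp ih (@measurable_behead _ _ n).
  exact: mxmeas_comp mxmeas_id (measurable_tnth ord0).
apply/funext => t; rewrite -word_tcons; congr word.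
by rewrite {1}(tuple_eta t); apply: val_inj.
Qed.

Lemma adj_prod (s : seq Mk) : adj (\prod_(v <- s) v) = \prod_(v <- rev s) v ^t*.
Proof.
elim: s => [|v s ih]; first by rewrite !big_nil; exact: adj1.
rewrite rev_cons -cats1 big_cat big_cons big_seq1 -ih.
transitivity (adj (v ** \prod_(w <- s) w)); first by rewrite cmulE.
by rewrite adjM cmulE -adjE.
Qed.

End borel_matrices.

(** * Purity and its convergence under (Pur) *)

Section purity.
Context {R : realType}.
Local Notation C := R[i].

(* With [X = A^* A], this is [tr (X^2) / tr X]: a convex function of [X], homogeneous of
   degree one, dominated by [tr X] with equality only in rank one. *)
Definition purity m n (A : 'M[C]_(m, n)) : R := nsq (adj A ** A) / nsq A.

(** For [Y] of trace one, this is the tangent at [Y] to the convex function [tr (X^2) / tr X],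
    evaluated at [X = A^* A]. It is linear in [X], hence invariant under [markov]. *)
Definition tangent m n (Y : 'M[C]_n) (A : 'M[C]_(m, n)) : R :=
  2 * rtr (adj A ** A ** Y) - nsq Y * nsq A.

Lemma qfun_gram m n (Z : 'M[C]_n) : qfun (fun A : 'M[C]_(m, n) => rtr (adj A ** A ** Z)).
Proof.
have := @qfun_form R m n 1%:M Z; congr qfun; apply/funext => A.
by rewrite cmul1l cmulA.
Qed.

Lemma qfun_tangent m n (Y : 'M[C]_n) : qfun (@tangent m n Y).
Proof. by apply: qfunB; apply: qfunZ; [exact: qfun_gram|exact: qfun_nsq]. Qed.

Lemma qfun_purity m n : qfun (@purity m n).
Proof.
pose g (Z : 'M[C]_n) (A : 'M[C]_(m, n)) := rtr (adj A ** A ** Z).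
(* The coefficients [1] and ['i] extract, up to sign, the real and imaginary parts of the entries of
   [A^* A], so the purity is a sum of squares of forms divided by [nsq]. *)
have -> : @purity m n = fun A => \sum_i \sum_j
  (qprod (g (1 *: delta_mx j i)) (g (1 *: delta_mx j i)) A +
   qprod (g ('i *: delta_mx j i)) (g ('i *: delta_mx j i)) A).
  apply/funext => A; rewrite /purity /qprod /g [in LHS]nsq_sum mulr_suml.
  apply: eq_bigr => i _; rewrite mulr_suml; apply: eq_bigr => j _.
  by rewrite !rtr_delta -mulrDl /csq !ReM /= !expr2; congr (_ / _); ring.
apply: qfun_sum => i; apply: qfun_sum => j.
by apply: qfunD; apply: qfun_prod; exact: qfun_gram.
Qed.

(** The convexity gap is an explicit square: it vanishes only if [A^* A] is [nsq A] times [Y], which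
    turns equality in Jensen's inequality into the proportionality that (Pur) speaks of. *)
Lemma purity_tangent m n (Y : 'M[C]_n) (A : 'M[C]_(m, n)) :
  purity A - tangent Y A = nsq A * nsq ((nsq A)^-1%:C *: (adj A ** A) - Y).
Proof.
have hX : adj (adj A ** A) = adj A ** A by rewrite adjM adjK.
have [->|/nsq_gt0/lt0r_neq0 A0] := eqVneq A 0.
  by rewrite (qhom0 (qfun_purity m n).1) (qhom0 (@qfun_tangent m n Y).1) subr0 nsq0 mul0r.
rewrite nsqB nsqZ csqR adjZR hX cmulZl rtrZ /purity /tangent.
by field.
Qed.

Lemma tangent_le_purity m n (Y : 'M[C]_n) (A : 'M[C]_(m, n)) : tangent Y A <= purity A.
Proof. by rewrite -subr_ge0 purity_tangent mulr_ge0 ?nsq_ge0. Qed.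

Lemma purity_eq_tangent m n (A : 'M[C]_(m, n)) :
  purity A = tangent ((nsq A)^-1%:C *: (adj A ** A)) A.
Proof. by apply/eqP; rewrite -subr_eq0 purity_tangent subrr nsq0 mulr0. Qed.

Lemma purity_ge0 m n (A : 'M[C]_(m, n)) : 0 <= purity A.
Proof. by rewrite divr_ge0 ?nsq_ge0. Qed.

Lemma purity_le m n (A : 'M[C]_(m, n)) : purity A <= nsq A.
Proof.
have [->|/nsq_gt0 A0] := eqVneq A 0.
  by rewrite (qhom0 (qfun_purity m n).1) nsq0.
by rewrite /purity ler_pdivrMr//; apply: le_trans (nsq_cmul_le _ _) _; rewrite nsqJ.
Qed.

Lemma normalize m n (A : 'M[C]_(m, n)) : A != 0 ->
  exists2 B : 'M[C]_(m, n), nsq B = 1 &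
    A = (Num.sqrt (nsq A))%:C *: B /\ forall f, qhom f -> f A = nsq A * f B.
Proof.
move=> A0; have a0 := nsq_gt0 A0; set r := Num.sqrt (nsq A).
have r0 : r != 0 by rewrite lt0r_neq0// sqrtr_gt0.
have r2 : r ^+ 2 = nsq A by rewrite sqr_sqrtr// ltW.
have E : A = r%:C *: (r^-1%:C *: A).
  by rewrite scalerA -rmorphM divff// scale1r.
exists (r^-1%:C *: A).
  by rewrite nsqZ csqR exprVn r2 mulVf// gt_eqF.
by split=> // f fh; rewrite {1}E qhomR// r2.
Qed.

Lemma qhom_le_sphere m n (f g : 'M[C]_(m, n) -> R) : qhom f -> qhom g ->
  (forall A, nsq A = 1 -> f A <= g A) -> forall A, f A <= g A.
Proof.
move=> fh gh fg A; have [->|A0] := eqVneq A 0; first by rewrite !qhom0.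
have [B B1 [_ BE]] := normalize A0.
by rewrite (BE f fh) (BE g gh) ler_wpM2l ?nsq_ge0// fg.
Qed.

End purity.

Section purification.
Context {R : realType} {k : nat}.
Local Notation C := R[i].
Local Notation Mk := 'M[C]_k.+1.
Variable mu : {sigma_finite_measure set (borel Mk) -> \bar R}.
Hypothesis mu_nsq : rintegrable mu (fun v : borel Mk => nsq (v : Mk)).
Hypothesis mu_form : forall Y : Mk,
  \int[mu]_v rtr (adj (v : Mk) ** (v : Mk) ** Y) = rtr Y.
Hypothesis mu_pur : purification mu.

Lemma markov_tangent m (Y : 'M[C]_m) (A : 'M[C]_(k.+1, m)) :
  markov mu (tangent Y) A = tangent Y A.
Proof.
rewrite markovB//; first last.
- exact/qfunZ/qfun_nsq.
- exact/qfunZ/qfun_gram.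
by rewrite !markovZ ?markov_form ?markov_nsq//; [exact: qfun_nsq|exact: qfun_gram].
Qed.

(** Jensen's inequality: the tangent that touches the purity at [A] is invariant and lies below the
    purity. *)
Lemma purity_markov m (A : 'M[C]_(k.+1, m)) : purity A <= markov mu (@purity R _ _) A.
Proof.
rewrite purity_eq_tangent -markov_tangent; apply: markov_le => //.
- exact: qfun_tangent.
- exact: qfun_purity.
- by move=> B; exact: tangent_le_purity.
Qed.

(** Joins the two points of view: iterates of the operator, and the product measures in (Pur). *)
Lemma integral_word (f : Mk -> R) n (A : Mk) : qfun f -> (forall B, 0 <= f B) ->
  (forall n A, measurable_fun setT (fun t : n.-tuple (borel Mk) => f (word t ** A))) ->
  (\int[power_measure mu n]_t (f (word t ** A))%:E = (iter_markov mu n f A)%:E)%E.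
Proof.
move=> fq f0 fm; elim: n A => [|n ih] A.
  have m0 : measurable_fun setT (fun t : 0.-tuple (borel Mk) => (f (word t ** A))%:E).
    by apply/measurable_EFinP; exact: (fm 0%N A).
  rewrite /= integral_dirac//.
  by rewrite diracT mul1e /word /= big_nil cmul1l.
have mg : measurable_fun setT (fun t : n.+1.-tuple (borel Mk) => (f (word t ** A))%:E).
  by apply/measurable_EFinP; exact: (fm n.+1 A).
have -> : (\int[power_measure mu n.+1]_t (f (word t ** A))%:E =
  \int[pushforward (mu \x power_measure mu n)%E (@tcons _ _ n)]_t (f (word t ** A))%:E)%E.
  by [].
rewrite ge0_integral_pushforward//; first last.
- by move=> t _; rewrite lee_fin.
- exact: measurable_tcons.
rewrite preimage_setT fubini_tonelli1//; first last.
- by move=> t; rewrite lee_fin.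
- exact: measurableT_comp mg (@measurable_tcons _ _ n).
have qn : qfun (iter_markov mu n f) by exact: iter_markov_qfun.
rewrite [iter_markov _ _ _ _]/= /markov /Rintegral fineK; last first.
  by apply: integrable_fin_num => //; exact: orbit_integrable.
by apply: eq_integral => v _; rewrite -ih; apply: eq_integral => t _ /=; rewrite word_tcons cmulA.
Qed.

(** Let [P = A ** D] project onto the range of [A] and let [W] be a word. Multiplied by [D^*] and
    [D] on the two sides, the proportionality of [A^* W^* W A] to [A^* A] becomes that of
    [P W^* W P] to [P]; (Pur) then says that the range is a line. *)
Lemma purification_rank1 (A : Mk) : A != 0 ->
  (forall n, {ae power_measure mu n, forall t,
     exists c : R, adj (word t ** A) ** (word t ** A) = c%:C *: (adj A ** A)}) ->
  nsq (adj A ** A) = nsq A ^+ 2.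
Proof.
move=> A0 H; have [D [[hP PP] PA]] := range_projector A.
set P := A ** D in hP PP PA; apply: (nsq_rank1 _ PA); apply: mu_pur.
- by apply: contra A0 => /eqP P0; rewrite -PA P0 cmul0l.
- by split; [rewrite -cmulE|rewrite -adjE].
move=> n n0; apply: filterS (H n) => t [c ct]; exists c%:C.
have -> : \prod_(v <- t) (v : Mk) ^t* = adj (word t).
  by rewrite /word adj_prod revK.
rewrite -/(word t) -[P * _]cmulE -[_ * word t]cmulE -[_ * P]cmulE.
rewrite -{1}hP /P adjM.
have -> : adj D ** adj A ** adj (word t) ** word t ** (A ** D) =
  adj D ** (adj (word t ** A) ** (word t ** A)) ** D by rewrite adjM !cmulA.
rewrite ct cmulZr cmulZl; congr (_ *: _).
by rewrite -/P -[RHS]PP -{1}hP /P adjM !cmulA.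
Qed.

Let purity_n n (A : Mk) : R := iter_markov mu n (@purity R _ _) A.

Let purity_n_homo (A : Mk) : nondecreasing_seq (purity_n ^~ A).
Proof.
apply/nondecreasing_seqP => n; rewrite /purity_n iter_markovSr.
apply: iter_markov_le => //; [exact: qfun_purity| |exact: purity_markov].
exact/markov_qfun/qfun_purity.
Qed.

Let purity_n_le n (A : Mk) : purity_n n A <= nsq A.
Proof.
rewrite -[leRHS](iter_markov_nsq mu_form n); apply: iter_markov_le => //.
- exact: qfun_purity.
- exact: qfun_nsq.
- exact: purity_le.
Qed.

Let purity_oo (A : Mk) : R := limn (purity_n ^~ A).

Let purity_cvg (A : Mk) : purity_n n A @[n --> \oo] --> purity_oo A.
Proof.
apply: nondecreasing_is_cvgn => //; exists (nsq A) => _ [n _ <-].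
exact: purity_n_le.
Qed.

Let qfun_purity_n n : qfun (purity_n n).
Proof. exact/iter_markov_qfun/qfun_purity. Qed.

Let qfun_purity_oo : qfun purity_oo.
Proof.
have [_ [c c0 cl]] := @qfun_purity R k.+1 k.+1.
split.
  move=> a A; have h1 := @purity_cvg (a *: A).
  have h2 : (fun n => purity_n n (a *: A)) @ \oo --> csq a * purity_oo A.
    under eq_cvg do rewrite (qfun_purity_n _).1.
    by apply: cvgMr; exact: purity_cvg.
  exact: cvg_unique h1 h2.
exists c => // s A B s0.
have h : (fun n => `|purity_n n A - purity_n n B|) @ \oo --> `|purity_oo A - purity_oo B|.
  by apply: cvg_norm; apply: cvgB; exact: @purity_cvg.
apply: (ler_cvg_to h (cvg_cst _)); apply: nearW => n.
by apply: iter_markov_qlip => //; exact: qfun_purity.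
Qed.

Let markov_purity_oo (A : Mk) : markov mu purity_oo A = purity_oo A.
Proof.
have h1 : markov mu (purity_n n) A @[n --> \oo] --> markov mu purity_oo A.
  apply: (@markov_cvg _ _ _ mu_nsq _ _ _ 1 A); [exact: qfun_purity_n| |exact: @purity_cvg].
  move=> n B; rewrite mul1r ger0_norm ?purity_n_le//.
  by apply: le_trans (purity_n_homo B (leq0n n)); exact: purity_ge0.
have h2 : markov mu (purity_n n) A @[n --> \oo] --> purity_oo A.
  by have := @purity_cvg A; rewrite -cvg_shiftS.
exact: cvg_unique h1 h2.
Qed.

Let purity_oo_le (A : Mk) : purity_oo A <= nsq A.
Proof. by apply: limr_le; [exact: purity_cvg|apply: nearW => n; exact: purity_n_le]. Qed.

Let purity_le_oo (A : Mk) : purity A <= purity_oo A.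
Proof. exact: (nondecreasing_cvgn_le (@purity_n_homo A) (@purity_cvg A) 0%N). Qed.

(* [psi] is harmonic, hence its zero set is absorbing; at a point of maximal purity of this
   zero set, equality holds in the convexity inequality for all words. *)
Let purity_oo_ge (A : Mk) : nsq A <= purity_oo A.
Proof.
set S := [set B : Mk | nsq B = 1].
have S0 : S !=set0.
  have /normalize[B B1 _] : (1%:M : Mk) != 0 by exact: oner_neq0.
  by exists B.
have cS : compact S by exact: sphere_compact.
have coo : {within S, continuous purity_oo}.
  by apply: continuous_subspaceT; exact: qfun_continuous.
have [A0 A0S A0min] := compact_EVT_min S0 cS coo; rewrite inE in A0S.
(* [M] is the minimum of [purity_oo] on the sphere, so [psi] is nonnegative and the claim reduces to
   [M >= 1]. *)
pose M := purity_oo A0; pose psi (B : Mk) := purity_oo B - M * nsq B.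
have qpsi : qfun psi by apply: qfunB => //; exact/qfunZ/qfun_nsq.
have psi_ge0 B : 0 <= psi B.
  have := @qhom_le_sphere R k.+1 k.+1 _ psi (@qfun_cst0 R k.+1 k.+1).1 qpsi.1.
  move=> /(_ _ B); apply => {}B B1.
  by rewrite /psi B1 mulr1 subr_ge0 A0min// inE.
have Kpsi B : markov mu psi B = psi B.
  rewrite markovB//; last exact/qfunZ/qfun_nsq.
  by rewrite markovZ ?markov_nsq ?markov_purity_oo//; exact: qfun_nsq.
set Z := S `&` psi @^-1` [set 0].
have cZ : compact Z.
  apply: compact_closedI => //; apply: closed_comp; last exact: closed_eq.
  by move=> B _; exact: qfun_continuous.
have Z0 : Z !=set0 by exists A0; split=> //=; rewrite /psi A0S mulr1 subrr.
have cpur : {within Z, continuous (@purity R k.+1 k.+1)}.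
  by apply: continuous_subspaceT; exact/qfun_continuous/qfun_purity.
have [A1 A1Z A1max] := compact_EVT_max Z0 cZ cpur; rewrite inE in A1Z.
have [A11 psi1] := A1Z; rewrite /S /= in A11; rewrite /= in psi1.
(* If [psi B = 0], the integral of [psi (v B)] is zero, so [psi (v B) = 0] for almost all [v]: the
   bound by the maximal purity propagates to all iterates. *)
have bound p B : psi B = 0 -> purity_n p B <= purity A1 * nsq B.
  elim: p B => [|p ih] B psiB.
    have [->|B0] := eqVneq B 0.
      by rewrite (qhom0 (qfun_purity_n 0).1) nsq0 mulr0.
    have [D D1 [_ DE]] := normalize B0.
    rewrite (DE (purity_n 0) (qfun_purity_n 0).1).
    rewrite mulrC ler_wpM2r ?nsq_ge0//; apply: A1max; rewrite inE; split => //=.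
    have := psiB; rewrite (DE _ qpsi.1) => /eqP; rewrite mulf_eq0.
    by rewrite gt_eqF ?nsq_gt0//= => /eqP.
  rewrite -(markov_nsq mu_form) -markovZ//; last exact: qfun_nsq.
  apply: rint_ae_le.
  - by apply: orbit_integrable => //; exact: qfun_purity_n.
  - by apply: rintegrableZ; exact: orbit_nsq_integrable.
  have : {ae mu, forall v : borel Mk, psi ((v : Mk) ** B) = 0}.
    apply: rint_ge0_ae => //; first exact: orbit_integrable.
    by have := Kpsi B; rewrite /markov psiB => ->.
  by apply: filterS => v; exact: ih.
pose X := adj A1 ** A1.
have tE : tangent X A1 = purity A1.
  by rewrite purity_eq_tangent A11 invr1 scale1r.
(* At [A1] the invariant tangent equals the maximal purity, which bounds every iterate of the
   purity. The iterates of the nonnegative gap [D] therefore vanish at [A1], and [D] vanishes along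
   almost all words. *)
pose D (B : Mk) := purity B - tangent X B.
have D_ge0 B : 0 <= D B by rewrite subr_ge0 tangent_le_purity.
have qD : qfun D by apply: qfunB; [exact: qfun_purity|exact: qfun_tangent].
have D0 p : iter_markov mu p D A1 = 0.
  apply/eqP; rewrite eq_le; apply/andP; split.
    rewrite iter_markovB//; [|exact: qfun_purity|exact: qfun_tangent].
    rewrite (iter_markov_fix _ (@markov_tangent _ X)) tE subr_le0.
    by have := bound p A1 psi1; rewrite A11 mulr1.
  have := iter_markov_le mu_nsq mu_form p A1 (@qfun_cst0 R k.+1 k.+1) qD D_ge0.
  by rewrite iter_markov_fix// => B; rewrite /markov Rintegral_cst// mul0r.
suff r1 : nsq (adj A1 ** A1) = nsq A1 ^+ 2.
  have M1 : 1 <= M.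
    have h : purity A1 = 1 by rewrite /purity r1 A11 expr1n divr1.
    have := purity_le_oo A1; rewrite h; move: psi1; rewrite /psi A11 mulr1; lra.
  have := psi_ge0 A; rewrite /psi subr_ge0; apply: le_trans.
  by rewrite ler_peMl// nsq_ge0.
apply: purification_rank1.
  by apply/eqP => A10; have := A11; rewrite A10 nsq0 => /esym/eqP; rewrite oner_eq0.
move=> n.
have mD p B : measurable_fun setT (fun t : p.-tuple (borel Mk) => D (word t ** B)).
  have mW : mxmeas (fun t : p.-tuple (borel Mk) => word t ** B).
    by apply: mxmeas_mul; [exact: mxmeas_word|exact: mxmeas_cst].
  have mG := mxmeas_mul (mxmeas_adj mW) mW.
  apply: measurable_funB.
    by apply: measurable_funM; [|apply: measurable_inv]; exact: measurable_nsq.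
  apply: measurable_funB; apply: measurable_funM => //.
    by apply: measurable_rtr; apply: mxmeas_mul => //; exact: mxmeas_cst.
  exact: measurable_nsq.
have iD : rintegrable (power_measure mu n) (fun t => D (word t ** A1)).
  apply/integrableP; split; first by apply/measurable_EFinP; exact: (mD n A1).
  under eq_integral do rewrite /= ger0_norm//.
  by rewrite integral_word// D0 ltry.
have := rint_ge0_ae iD (fun t => D_ge0 _); rewrite /Rintegral integral_word// D0.
move=> /(_ (lexx _)); apply: filterS => t; rewrite /D purity_tangent => /eqP.
(* A zero gap means that [W = 0] or that [W^* W] is [nsq W] times [X]; either way it is proportional
   to [X]. *)
set W := word t ** A1; rewrite mulf_eq0 => /orP[/eqP W0|/eqP/nsq_eq0/eqP].
  by exists 0; rewrite (nsq_eq0 W0) cmul0r scale0r.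
rewrite subr_eq0 => /eqP WX; exists (nsq W); rewrite -/X -WX scalerA -rmorphM.
have [W0|W0] := eqVneq (nsq W) 0; last by rewrite divff// scale1r.
by rewrite (nsq_eq0 W0) cmul0r scaler0.
Qed.

Theorem purification_cvg (A : Mk) :
  iter_markov mu n (@purity R _ _) A @[n --> \oo] --> nsq A.
Proof.
have := @purity_cvg A; rewrite (_ : purity_oo A = nsq A)//.
by apply/eqP; rewrite eq_le purity_oo_le purity_oo_ge.
Qed.

End purification.

(** * Functions on the projective space *)

Section projective_functions.
Context {R : realType} {k : nat}.
Local Notation C := R[i].
Local Notation V := 'cV[C]_k.+1.
Local Notation PC := (borel (proj_space R k)).

Lemma hnorm_sq n (x : 'cV[C]_n) : hnorm x ^+ 2 = nsq x.
Proof.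
rewrite /hnorm (_ : Re (hdot x x) = nsq x) ?sqr_sqrtr ?nsq_ge0//.
by rewrite nsqE rtrE /mxtrace big_ord1 /hdot cmulE adjE.
Qed.

Lemma hnorm_gt0 n (x : 'cV[C]_n) : x != 0 -> 0 < hnorm x.
Proof.
move=> /nsq_gt0 x0; rewrite lt_def sqrtr_ge0 andbT; apply/eqP => h.
by move: x0; rewrite -hnorm_sq h expr0n ltxx.
Qed.

Lemma proj_class_eq (x y : nzvec R k) (a : C) :
  \val x = a *: \val y -> proj_class x = proj_class y.
Proof. by move=> xy; apply/eqmodP/asboolP; exists a. Qed.

Lemma proj_class_repr (p : PC) : proj_class (repr (p : proj_space R k)) = p.
Proof. exact: reprK. Qed.

Lemma nsq_unit_rep (p : PC) : nsq (unit_rep p) = 1.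
Proof.
rewrite /unit_rep nsqZ csqR -hnorm_sq -exprMn mulVf ?expr1n//.
by rewrite gt_eqF// hnorm_gt0// (valP (repr (p : proj_space R k))).
Qed.

Lemma unit_rep_neq0 (p : PC) : unit_rep p != 0.
Proof.
apply/eqP => h; have := nsq_unit_rep p; rewrite h nsq0 => /esym/eqP.
by rewrite oner_eq0.
Qed.

Lemma proj_class_unit_rep (p : PC) (z : nzvec R k) : \val z = unit_rep p -> proj_class z = p.
Proof. by move=> zp; rewrite -[RHS]proj_class_repr; apply: proj_class_eq zp. Qed.

Lemma unit_rep_class (x : nzvec R k) : exists2 a : C,
  unit_rep (proj_class x) = a *: \val x & csq a = (nsq (\val x))^-1.
Proof.
have /eqmodP/asboolP[b E] : proj_class (repr (proj_class x : proj_space R k)) = proj_class x.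
  exact: proj_class_repr.
exists (((hnorm (\val (repr (proj_class x : proj_space R k))))^-1)%:C * b).
  by rewrite /unit_rep E scalerA.
have := nsq_unit_rep (proj_class x); rewrite /unit_rep E scalerA nsqZ => h.
have x0 := lt0r_neq0 (nsq_gt0 (valP x)).
by apply: (mulIf x0); rewrite mulVf// -E.
Qed.

Lemma qhom_class (q : V -> R) (x : nzvec R k) : qhom q ->
  q (unit_rep (proj_class x)) = q (\val x) / nsq (\val x).
Proof. by move=> qh; have [a -> ha] := unit_rep_class x; rewrite qh ha mulrC. Qed.

(* For a unit vector [x], the kernel sends [f] to [\int lift f (v x) dmu(v)] on the line of [x]. *)
Definition lift (f : PC -> R) (x : V) : R :=
  if insub x is Some z then f (proj_class z) * nsq x else 0.

Lemma lift0 f : lift f 0 = 0.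
Proof. by rewrite /lift insubF// eqxx. Qed.

Lemma lift_nz f (x : nzvec R k) : lift f (\val x) = f (proj_class x) * nsq (\val x).
Proof.
rewrite /lift; case: insubP => [z _ zx|]; last by rewrite (valP x).
by congr (f (proj_class _) * _); exact: val_inj.
Qed.

Lemma vec_cases (x : V) : x = 0 \/ exists z : nzvec R k, x = \val z.
Proof.
have [->|x0] := eqVneq x 0; [by left|right].
by exists (exist (fun x : V => x != 0) x x0).
Qed.

Lemma lift_unit f p : lift f (unit_rep p) = f p.
Proof.
have [/eqP|[z E]] := vec_cases (unit_rep p); first by rewrite (negbTE (unit_rep_neq0 p)).
by rewrite E lift_nz -E nsq_unit_rep mulr1 (proj_class_unit_rep (esym E)).
Qed.

Lemma lift_of (q : V -> R) : qhom q -> lift (fun p => q (unit_rep p)) = q.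
Proof.
move=> qh; apply/funext => x; have [->|[z ->]] := vec_cases x.
  by rewrite lift0 (qhom0 qh).
rewrite lift_nz qhom_class// divfK// gt_eqF// nsq_gt0//; exact: (valP z).
Qed.

(** The point [p] is common to all [g], so pointwise operations on functions transfer to their
    lifts. *)
Lemma liftE (x : V) : x != 0 -> exists p, forall g, lift g x = g p * nsq x.
Proof.
move=> x0; have [x00|[z ->]] := vec_cases x; first by rewrite x00 eqxx in x0.
by exists (proj_class z) => g; rewrite lift_nz.
Qed.

Lemma liftD f g x : lift (fun p => f p + g p) x = lift f x + lift g x.
Proof.
have [->|/liftE[p E]] := eqVneq x 0; first by rewrite !lift0 addr0.
by rewrite !E mulrDl.
Qed.

Lemma liftZ r f x : lift (fun p => r * f p) x = r * lift f x.
Proof.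
have [->|/liftE[p E]] := eqVneq x 0; first by rewrite !lift0 mulr0.
by rewrite !E mulrA.
Qed.

Lemma liftB f g x : lift (fun p => f p - g p) x = lift f x - lift g x.
Proof.
have [->|/liftE[p E]] := eqVneq x 0; first by rewrite !lift0 subr0.
by rewrite !E mulrBl.
Qed.

Lemma lift_pos f x : lift (fun p => Num.max (f p) 0) x = Num.max (lift f x) 0.
Proof.
have [->|/liftE[p E]] := eqVneq x 0; first by rewrite !lift0 maxxx.
by rewrite !E maxr_pMl ?nsq_ge0// mul0r.
Qed.

Lemma lift_cst r x : lift (fun=> r) x = r * nsq x.
Proof.
have [->|/liftE[p E]] := eqVneq x 0; first by rewrite lift0 nsq0 mulr0.
by rewrite E.
Qed.

Lemma lift_le f g x : (forall p, f p <= g p) -> lift f x <= lift g x.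
Proof.
move=> fg; have [->|/liftE[p E]] := eqVneq x 0; first by rewrite !lift0.
by rewrite !E ler_wpM2r ?nsq_ge0.
Qed.

(** A vector lattice containing the constants and rich enough to detect closed sets: the domain of
    the Daniell functional and the test functions for measures. *)
Definition lipP : set (PC -> R) := [set f | qfun (lift f)].

Lemma lipPD f g : lipP f -> lipP g -> lipP (fun p => f p + g p).
Proof.
move=> fq gq; have := qfunD fq gq; rewrite /lipP /=; congr qfun.
by apply/funext => x; rewrite liftD.
Qed.

Lemma lipPZ r f : lipP f -> lipP (fun p => r * f p).
Proof.
by move=> fq; have := qfunZ r fq; rewrite /lipP /=; congr qfun; apply/funext => x; rewrite liftZ.
Qed.

Lemma lipP_pos f : lipP f -> lipP (fun p => Num.max (f p) 0).
Proof.
move=> fq; have := qfun_pos fq; rewrite /lipP /=; congr qfun.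
by apply/funext => x; rewrite lift_pos.
Qed.

Lemma lipP_of q : qfun q -> lipP (fun p => q (unit_rep p)).
Proof. by move=> qq; rewrite /lipP /= lift_of//; exact: qq.1. Qed.

Lemma lipP_cst r : lipP (fun=> r).
Proof.
have := qfunZ r (@qfun_nsq R k.+1 1); rewrite /lipP /=; congr qfun.
by apply/funext => x; rewrite lift_cst.
Qed.

Lemma lipPB f g : lipP f -> lipP g -> lipP (fun p => f p - g p).
Proof.
move=> fq gq; have := qfunB fq gq; rewrite /lipP /=; congr qfun.
by apply/funext => x; rewrite liftB.
Qed.

Lemma lipP_bounded f : lipP f -> exists M, forall p, `|f p| <= M.
Proof.
move=> [fh [c c0 fl]]; exists (2 * c) => p; rewrite -lift_unit.
by have := qlip_bound (unit_rep p) fl (qhom0 fh); rewrite nsq_unit_rep mulr1.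
Qed.

Lemma lipP_continuous f : lipP f -> continuous (f : proj_space R k -> R).
Proof.
move=> fq; apply/quotient_continuous.
have -> : (f : proj_space R k -> R) \o \pi_(proj_space R k) =
    (fun z : nzvec R k => lift f (\val z) / nsq (\val z)).
  apply/funext => z /=; rewrite lift_nz mulfK// gt_eqF// nsq_gt0//; exact: (valP z).
move=> z; have vc : {for z, continuous (\val : nzvec R k -> V)} by exact: initial_continuous.
have c1 : {for z, continuous (fun w : nzvec R k => lift f (\val w))}.
  by apply: (continuous_comp vc); exact: qfun_continuous.
have c2 : {for z, continuous (fun w : nzvec R k => nsq (\val w))}.
  by apply: (continuous_comp vc); exact/qfun_continuous/qfun_nsq.
apply: (continuousM c1); apply: continuousV => //.
by rewrite gt_eqF// nsq_gt0//; exact: (valP z).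
Qed.

Lemma lipP_measurable f : lipP f -> measurable_fun setT f.
Proof.
move=> fq; apply: (@continuous_measurable_fun R (proj_space R k)).
exact: lipP_continuous.
Qed.

(** If it failed, unit representatives of points with [f_ n (p n) > e] would have a cluster point on
    the sphere, where every [lift (f_ m)] is at least [e] by monotonicity and continuity. The
    compactness used is that of the sphere, not of the quotient. *)
Lemma lipP_dini (f_ : nat -> PC -> R) : (forall n, lipP (f_ n)) ->
  (forall p, nonincreasing_seq (f_ ^~ p)) -> (forall p, f_ n p @[n --> \oo] --> (0 : R)) ->
  forall e, 0 < e -> exists n, forall p, f_ n p <= e.
Proof.
move=> fq fd f0 e e0; apply: contrapT => /forallNP H.
have {H} /choice[p Hp] n : exists p, e < f_ n p.
  by have /existsNP[p /negP] := H n; rewrite -ltNge => ?; exists p.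
have [|x [_ clx]] := @sphere_compact R k.+1 1 ((fun n => unit_rep (p n)) @ \oo) _.
  by exists 0%N => // n _; exact: nsq_unit_rep.
have {clx} H m : e <= lift (f_ m) x.
  rewrite leNgt; apply/negP => lt.
  have oU : nbhs x [set y | lift (f_ m) y < e].
    apply: open_nbhs_nbhs; split=> //.
    apply: (@open_comp _ _ (lift (f_ m)) [set r | r < e]); last exact: open_lt.
    by move=> y _; exact: (qfun_continuous (fq m)).
  have [] := clx [set unit_rep (p n) | n in [set n | (m <= n)%N]] _ _ oU.
    by exists m => // n mn; exists n.
  move=> _ [[n /= mn <-]]; rewrite lift_unit; apply/negP; rewrite -leNgt.
  by apply: le_trans (ltW (Hp n)) _; exact: fd.
have [x0|/liftE[q E]] := eqVneq x 0.
  by have := H 0%N; rewrite x0 lift0 leNgt e0.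
have h1 : (fun n => f_ n q * nsq x) @ \oo --> 0 * nsq x by apply: cvgMl; exact: f0.
have h2 : e <= 0 * nsq x.
  by apply: (ler_cvg_to (cvg_cst _) h1); apply: nearW => n; rewrite -E.
by move: h2; rewrite mul0r leNgt e0.
Qed.

Lemma nsq_sub_proj n (u x : 'cV[C]_n) : nsq u = 1 ->
  nsq (x - u ** (adj u ** x)) = nsq x - nsq (adj u ** x).
Proof.
move=> u1; rewrite nsqB nsq_outer u1 mul1r cmulA.
rewrite (_ : adj x ** u = adj (adj u ** x)); last by rewrite adjM adjK.
by rewrite -nsqE; ring.
Qed.

(** [d] is the infimum over [p] in [F] of [g p], the squared distance to the line of [p]. The
    constant of [g p] does not depend on [p], so the infimum keeps it. *)
Lemma lipP_closed (F : set (proj_space R k)) : closed F -> exists d : PC -> R,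
  [/\ lipP d, forall p, 0 <= d p & forall p, d p = 0 <-> F p].
Proof.
move=> cF; have [->|/set0P[p0 Fp0]] := eqVneq F set0.
  exists (fun=> 1); split=> //; first exact: lipP_cst.
  by move=> p; split=> // /eqP; rewrite oner_eq0.
pose g (p : PC) (x : V) := nsq x - nsq (adj (unit_rep p) ** x).
have gE p x : g p x = nsq x - rtr (adj x ** ((unit_rep p ** adj (unit_rep p)) ** x ** 1%:M)).
  by rewrite /g [X in _ - X]nsqE adjM adjK cmul1r !cmulA.
have g_ge0 p x : 0 <= g p x.
  rewrite subr_ge0; apply: le_trans (nsq_cmul_le _ _) _.
  by rewrite nsqJ nsq_unit_rep mul1r.
have gh p : qhom (g p) by move=> a x; rewrite /g cmulZr !nsqZ mulrBr.
pose c : R := 1 + (1 + nsq (1%:M : 'M[C]_1)).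
have gl p : qlip c (g p).
  rewrite (_ : g p = fun x => nsq x +
      -1 * rtr (adj x ** ((unit_rep p ** adj (unit_rep p)) ** x ** 1%:M))); last first.
    by apply/funext => x; rewrite gE mulN1r.
  apply: qlipD; first exact: nsq_qlip.
  have := @qlipZ R _ _ _ (-1) _ (@qlip_form R k.+1 1 (unit_rep p ** adj (unit_rep p)) 1%:M).
  rewrite normrN1 mul1r; apply: qlip_weaken; rewrite lerD2l ler_piMl ?nsq_ge0//.
  by apply: le_trans (nsq_cmul_le _ _) _; rewrite nsqJ nsq_unit_rep mulr1.
pose G (x : V) := [set g p x | p in (F : set PC)].
have Gi x : has_inf (G x).
  split; first by exists (g p0 x), p0.
  by exists 0 => _ [p _ <-]; exact: g_ge0.
pose d x := inf (G x).
have d_le p x : F p -> d x <= g p x by move=> Fp; apply: ge_inf; [exact: (Gi x).2|exists p].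
have d_adh x e : 0 < e -> exists2 p, F p & g p x < d x + e.
  by move=> e0; have [_ [p Fp <-] h] := inf_adherent e0 (Gi x); exists p.
have d_ge0 x : 0 <= d x by apply: lb_le_inf; [exact: (Gi x).1|move=> _ [p _ <-]].
have dl : qlip c d.
  apply: (@qlip_sup _ _ _ _ [set g p | p in (F : set PC)]).
  - by move=> _ [p _ <-].
  - by move=> x _ [p Fp <-]; exact: d_le.
  - by move=> x e e0; have [p Fp h] := d_adh x e e0; exists (g p) => //; exists p.
(* This inequality gives homogeneity: for [a != 0] the converse is its instance at [a^-1] and the
   vector [a *: x]. *)
have dh_le a x : d (a *: x) <= csq a * d x.
  apply/ler_addgt0Pr => e e0.
  have a1 : 0 < csq a + 1 by have := csq_ge0 a; lra.
  have [p Fp h] := d_adh x (e / (csq a + 1)) (divr_gt0 e0 a1).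
  apply: le_trans (d_le p _ Fp) _; rewrite gh.
  apply: (@le_trans _ _ (csq a * (d x + e / (csq a + 1)))).
    by rewrite ler_wpM2l ?csq_ge0// ltW.
  rewrite mulrDr lerD2l mulrCA ler_piMr ?ltW//.
  by rewrite ltr_pdivrMr//; have := csq_ge0 a; lra.
have dh : qhom d.
  move=> a x; apply/eqP; rewrite eq_le dh_le andTb.
  have [->|a0] := eqVneq a 0; first by rewrite csq0 mul0r.
  have ca0 : csq a != 0 by apply: contra a0 => /eqP/csq_eq0 ->.
  have := dh_le a^-1 (a *: x); rewrite scalerA mulVf// scale1r => h.
  have : csq a * csq a^-1 = 1 by rewrite -csqM divff// /csq /= expr0n addr0 expr1n.
  have := ler_wpM2l (csq_ge0 a) h; rewrite mulrA => h2 e1.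
  by move: h2; rewrite e1 mul1r.
have qd : qfun d.
  by split=> //; exists c => //; rewrite !addr_ge0 ?nsq_ge0.
exists (fun p => d (unit_rep p)); split; [exact: lipP_of|by []|].
move=> p; split; last first.
  move=> Fp; apply/eqP; rewrite eq_le d_ge0 andbT; apply: le_trans (d_le p _ Fp) _.
  by rewrite /g gram_cV !nsq_unit_rep nsq_scalar1 csqR expr1n subrr.
(* If the distance is zero and [p] is outside [F], some [q] in [F] is so near that the projection of
   [x] on its line stays in the open set [U] lying over the complement of [F]. The bound [1/2] keeps
   this projection nonzero; its class is [q], a contradiction. *)
move=> dp0; apply: contrapT => nFp.
have oF : open (~` F) by exact: closed_openC.
have [U oU UF] : open (\pi_(proj_space R k) @^-1` (~` F)).
  have /continuousP := @pi_continuous (nzvec R k) {eq_quot (@collinear R k)}.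
  exact.
pose z0 : nzvec R k := exist (fun x : V => x != 0) _ (unit_rep_neq0 p).
have Up : U (unit_rep p).
  rewrite -[unit_rep p]/(\val z0) -[U _]/((\val @^-1` U) z0) UF /=.
  by rewrite -/(proj_class z0) (@proj_class_unit_rep p z0).
have /nbhs_nsqP[e e0 eU] : nbhs (unit_rep p) U by exact: open_nbhs_nbhs.
have e20 : 0 < Num.min e (2^-1 : R) by rewrite lt_min e0 invr_gt0 ltr0n.
have [q Fq] := d_adh (unit_rep p) _ e20; rewrite dp0 add0r lt_min => /andP[ge g2].
set u := unit_rep q in ge g2; set x := unit_rep p in ge g2.
pose S := adj u ** x.
have gS : nsq (x - u ** S) = g q x.
  exact: (nsq_sub_proj x (nsq_unit_rep q)).
have Uy : U (u ** S) by apply: eU; rewrite gS.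
have Se : u ** S = S 0 0 *: u by rewrite [in LHS](mx11_scalar S) cmulE mul_mx_scalar.
have y0 : u ** S != 0.
  apply/eqP => y0; move: gS g2; rewrite y0 subr0 (nsq_unit_rep p) => <-.
  by rewrite ltNge => /negP; apply; rewrite invf_le1 ?ler1n// ltr0n.
pose z : nzvec R k := exist (fun x : V => x != 0) _ y0.
have : (\val @^-1` U) z by [].
rewrite UF /= -/(proj_class z); apply.
rewrite (_ : proj_class z = q)//.
rewrite -[RHS]proj_class_repr; apply: (@proj_class_eq _ _ (S 0 0 * _)).
by rewrite [LHS]Se /u /unit_rep scalerA.
Qed.

End projective_functions.

Lemma rint_indic d (T : measurableType d) (R : realType) (m : {measure set T -> \bar R})
    (A : set T) : measurable A -> \int[m]_x \1_A x = fine (m A).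
Proof. by move=> mA; rewrite /Rintegral integral_indic// setIT. Qed.

Lemma probability_of_measure d (T : measurableType d) (R : realType)
    (m : {measure set T -> \bar R}) : m setT = 1%E ->
  {P : probability T R | forall A, P A = m A}.
Proof.
move=> m1; pose P : probability T R := mnormalize m (\d_point : probability T R).
exists P => A; rewrite /P /= /mnormalize m1 /=.
by rewrite (_ : (1%E == 0%E :> \bar R) = false) ?onee_eq0//= invr1 mule1.
Qed.

(** * Layers of a function, and Daniell's construction of measures *)

Section layers.
Context {R : realType} {T : Type}.

(** Truncation of [N f - i] to [[0, 1]], written with positive parts so that it stays in the
    lattice. *)
Definition layer (N i : nat) (f : T -> R) (x : T) : R :=
  Num.max (N%:R * f x - i%:R) 0 - Num.max (N%:R * f x - i.+1%:R) 0.

Lemma layer_ge0 N i f x : 0 <= layer N i f x.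
Proof.
rewrite /layer -natr1; case: (leP (N%:R * f x - i%:R) 0) => ?;
  case: (leP (N%:R * f x - (i%:R + 1)) 0) => ?; lra.
Qed.

Lemma sum_layer N f x : 0 <= f x <= 1 -> \sum_(i < N) layer N i f x = N%:R * f x.
Proof.
move=> /andP[f0 f1]; rewrite -(big_mkord xpredT (fun i => layer N i f x)).
have E m : \sum_(0 <= i < m) layer N i f x =
    Num.max (N%:R * f x - 0%:R) 0 - Num.max (N%:R * f x - m%:R) 0.
  elim: m => [|m ih]; first by rewrite big_nil subrr.
  by rewrite big_nat_recr//= ih /layer; ring.
rewrite E subr0 max_l ?mulr_ge0// max_r ?subr0// subr_le0 ler_piMr//.
Qed.

Lemma layer_le1 N i f x : layer N i f x <= 1.
Proof.
rewrite /layer -natr1; case: (leP (N%:R * f x - i%:R) 0) => ?;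
  case: (leP (N%:R * f x - (i%:R + 1)) 0) => ?; lra.
Qed.

Lemma layer_le0 N i f x : N%:R * f x < i%:R -> layer N i f x <= 0.
Proof.
rewrite /layer -natr1 => h; case: (leP (N%:R * f x - i%:R) 0) => ?;
  case: (leP (N%:R * f x - (i%:R + 1)) 0) => ?; lra.
Qed.

Lemma indic_le_layer N i f x :
  \1_[set y | i.+1%:R <= N%:R * f y] x <= layer N i f x.
Proof.
rewrite indicE; case: (boolP (x \in _)) => [|_]; last exact: layer_ge0.
rewrite inE /= /layer -natr1 => h.
case: (leP (N%:R * f x - i%:R) 0) => ?;
  case: (leP (N%:R * f x - (i%:R + 1)) 0) => ?; lra.
Qed.

Lemma layer_le_indic N i f x :
  layer N i f x <= \1_[set y | i%:R <= N%:R * f y] x.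
Proof.
rewrite indicE; case: (boolP (x \in _)) => [_|]; first exact: layer_le1.
by rewrite notin_setE /= => /negP; rewrite -ltNge; exact: layer_le0.
Qed.

Lemma indic01 (A : set T) (x : T) : 0 <= (\1_A x : R) <= 1.
Proof. by rewrite indicE; case: (_ \in _); rewrite ?lexx ler01. Qed.

Definition staircase N (f : T -> R) (x : T) : R :=
  N%:R^-1 * \sum_(i < N) \1_[set y | i.+1%:R <= N%:R * f y] x.

Lemma staircase_le N f x : (0 < N)%N -> 0 <= f x <= 1 -> staircase N f x <= f x.
Proof.
move=> N0 f01; rewrite /staircase mulrC ler_pdivrMr ?ltr0n// mulrC -sum_layer//.
by apply: ler_sum => i _; exact: indic_le_layer.
Qed.

Lemma le_staircase N f x : (0 < N)%N -> 0 <= f x <= 1 -> f x <= staircase N f x + N%:R^-1.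
Proof.
move=> N0 f01; rewrite /staircase -[X in _ + X]mulr1 -mulrDr mulrC ler_pdivlMr ?ltr0n//.
rewrite mulrC -sum_layer//; case: N N0 f01 => // N _ f01.
apply: (@le_trans _ _ (\sum_(i < N.+1) \1_[set y | i%:R <= N.+1%:R * f y] x)).
  by apply: ler_sum => i _; exact: layer_le_indic.
(* Shifting the index by one exchanges the top indicator for the bottom one, which is at most [1]:
   this is the error [N^-1]. *)
rewrite big_ord_recl [X in _ <= X + _]big_ord_recr /=.
rewrite (eq_bigr (fun i : 'I_N => \1_[set y | i.+1%:R <= N.+1%:R * f y] x)) => [|i _ //].
set S := \sum_(_ < N) _.
have /andP[_ h1] := indic01 [set y | 0%:R <= N.+1%:R * f y] x.
have /andP[h2 _] := indic01 [set y | N.+1%:R <= N.+1%:R * f y] x.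
by move: (\1_ _ x) (\1_ _ x) S h1 h2 => u v S h1 h2; lra.
Qed.

End layers.

(* Daniell's construction, with Dini's theorem [Hdini] in place of compactness: the outer
   measure of [A] is the infimum of [lim L g_n] over nondecreasing sequences [g_n] of
   nonnegative functions of the lattice with [sup g_n >= 1] on [A]. *)
Section daniell.
Context {R : realType} {X : ptopologicalType}.
Variables (H : set (X -> R)) (L : (X -> R) -> R).
Hypothesis Hcst : forall r, H (fun=> r).
Hypothesis HD : forall f g, H f -> H g -> H (fun x => f x + g x).
Hypothesis HZ : forall r f, H f -> H (fun x => r * f x).
Hypothesis Hpos : forall f, H f -> H (fun x => Num.max (f x) 0).
Hypothesis Hmeas : forall f, H f -> measurable_fun (setT : set (borel X)) f.
Hypothesis Hbounded : forall f, H f -> exists M : R, forall x, `|f x| <= M.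
Hypothesis Hdini : forall f_ : nat -> X -> R, (forall n, H (f_ n)) ->
  (forall x, nonincreasing_seq (f_ ^~ x)) -> (forall x, f_ n x @[n --> \oo] --> (0 : R)) ->
  forall e, 0 < e -> exists n, forall x, f_ n x <= e.
Hypothesis Hclosed : forall F : set X, closed F -> exists d : X -> R,
  [/\ H d, forall x, 0 <= d x & forall x, d x = 0 <-> F x].
Hypothesis LD : forall f g, H f -> H g -> L (fun x => f x + g x) = L f + L g.
Hypothesis LZ : forall r f, H f -> L (fun x => r * f x) = r * L f.
Hypothesis Lpos : forall f, H f -> (forall x, 0 <= f x) -> 0 <= L f.
Hypothesis L1 : L (fun=> 1) = 1.

Let HB f g : H f -> H g -> H (fun x => f x - g x).
Proof.
move=> Hf Hg; have := HD Hf (HZ (-1) Hg); congr H.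
by apply/funext => x; rewrite mulN1r.
Qed.

Let LB f g : H f -> H g -> L (fun x => f x - g x) = L f - L g.
Proof.
move=> Hf Hg; rewrite -[- L g]mulN1r -LZ// -LD//; last exact: HZ.
by congr L; apply/funext => x; rewrite mulN1r.
Qed.

Let Lle f g : H f -> H g -> (forall x, f x <= g x) -> L f <= L g.
Proof.
move=> Hf Hg fg; rewrite -subr_ge0 -LB//; apply: Lpos; first exact: HB.
by move=> x; rewrite subr_ge0.
Qed.

Let Lcst r : L (fun=> r) = r.
Proof.
transitivity (L (fun x => r * (fun=> 1) x)); last by rewrite LZ// L1 mulr1.
by congr L; apply/funext => x; rewrite mulr1.
Qed.

Let Hsum (I : Type) (s : seq I) (f : I -> X -> R) :
  (forall i, H (f i)) -> H (fun x => \sum_(i <- s) f i x).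
Proof.
move=> Hf; elim: s => [|i s ih].
  by have := Hcst 0; congr H; apply/funext => x; rewrite big_nil.
by have := HD (Hf i) ih; congr H; apply/funext => x; rewrite big_cons.
Qed.

Let Lsum (I : Type) (s : seq I) (f : I -> X -> R) :
  (forall i, H (f i)) -> L (fun x => \sum_(i <- s) f i x) = \sum_(i <- s) L (f i).
Proof.
move=> Hf; elim: s => [|i s ih].
  by rewrite big_nil -[RHS](Lcst 0); congr L; apply/funext => x; rewrite big_nil.
rewrite big_cons -ih -LD//; last exact: Hsum.
by congr L; apply/funext => x; rewrite big_cons.
Qed.

Definition daniell_cover (A : set X) (c : R) := exists g : nat -> X -> R,
  [/\ forall n, H (g n), forall n x, 0 <= g n x, forall x, nondecreasing_seq (g ^~ x),
      forall n, L (g n) <= c & forall x, A x -> forall e, 0 < e -> exists n, 1 - e <= g n x].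

Definition daniell_outer (A : set X) : R := inf [set c | daniell_cover A c].

Let cover_ge0 A c : daniell_cover A c -> 0 <= c.
Proof. by move=> [g [Hg g0 _ gc _]]; apply: le_trans (gc 0%N); exact: Lpos. Qed.

Let cover1 A : daniell_cover A 1.
Proof.
exists (fun _ _ => 1); split=> [//|n x|x i j _|n|x _ e e0]; rewrite ?L1 ?ler01//.
by exists 0%N; rewrite gerBl ltW.
Qed.

Let cover_inf A : has_inf [set c | daniell_cover A c].
Proof. by split; [exists 1; exact: cover1|exists 0 => c; exact: cover_ge0]. Qed.

Let outer_le A c : daniell_cover A c -> daniell_outer A <= c.
Proof. by move=> Ac; apply: ge_inf => //; exact: (cover_inf A).2. Qed.

Let outer_ge0 A : 0 <= daniell_outer A.
Proof. by apply: lb_le_inf; [exact: (cover_inf A).1|move=> c; exact: cover_ge0]. Qed.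

Let outer_adh A e : 0 < e -> exists2 c, daniell_cover A c & c < daniell_outer A + e.
Proof. by move=> e0; exact: inf_adherent e0 (cover_inf A). Qed.

Let outer_mono A B : A `<=` B -> daniell_outer A <= daniell_outer B.
Proof.
move=> AB; apply/ler_addgt0Pr => e e0; have [c [g [? ? ? ? gB]] cB] := outer_adh B e0.
apply: le_trans (ltW cB); apply: outer_le; exists g; split => // x Ax.
exact/gB/AB.
Qed.

Let outer0 : daniell_outer set0 = 0.
Proof.
apply/eqP; rewrite eq_le outer_ge0 andbT; apply: outer_le.
by exists (fun _ _ => 0); split=> [//|n x|x i j _|n|x []]; rewrite ?Lcst ?lexx.
Qed.

Let geometric_le (e : R) N : 0 < e -> \sum_(i < N) (e / 2 ^+ i.+1) <= e.
Proof.
move=> e0; have -> : \sum_(i < N) (e / 2 ^+ i.+1) = e - e / 2 ^+ N.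
  elim: N => [|N ih]; first by rewrite big_ord0 expr0 divr1 subrr.
  rewrite big_ord_recr /= ih exprS; field.
  by rewrite expf_neq0.
by rewrite gerBl divr_ge0 ?exprn_ge0// ltW.
Qed.

Let outer_sub : sigma_subadditive (fun A => (daniell_outer A)%:E).
Proof.
move=> F; set S := (\sum_(i <oo) _)%E.
have S0 : (0 <= S)%E by apply: nneseries_ge0 => n _ _; rewrite lee_fin.
have Sn N : ((\sum_(i < N) daniell_outer (F i))%:E <= S)%E.
  rewrite -sumEFin -(big_mkord xpredT (fun i => (daniell_outer (F i))%:E)).
  by apply: nneseries_lim_ge => n _ _; rewrite lee_fin.
case: S S0 Sn => [s| |] // _ Sn; last by rewrite leey.
rewrite lee_fin; apply/ler_addgt0Pr => e e0.
have /choice[c Hc] n : exists c, daniell_cover (F n) c /\ c < daniell_outer (F n) + e / 2 ^+ n.+1.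
  have [|c ? ?] := @outer_adh (F n) (e / 2 ^+ n.+1); last by exists c.
  by rewrite divr_gt0// exprn_gt0.
have /choice[g Hg] n := (Hc n).1.
(* Diagonal choice: the [N]-th function adds the [N]-th terms of the first [N] covers. *)
apply: outer_le; exists (fun N x => \sum_(i < N) g i N x); split.
- by move=> N; apply: Hsum => i; have [] := Hg i.
- by move=> N x; apply: sumr_ge0 => i _; have [_ ->] := Hg i.
- move=> x; apply/nondecreasing_seqP => N; rewrite big_ord_recr /= -[leLHS]addr0 lerD//.
    by apply: ler_sum => i _; have [_ _ h _ _] := Hg i; apply: h.
  by have [_ h _ _ _] := Hg N; exact: h.
- move=> N; rewrite Lsum; last by move=> i; have [] := Hg i.
  apply: (@le_trans _ _ (\sum_(i < N) (daniell_outer (F i) + e / 2 ^+ i.+1))).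
    apply: ler_sum => i _; have [_ _ _ h _] := Hg i; apply: le_trans (h N) _.
    exact/ltW/(Hc i).2.
  by rewrite big_split /= lerD ?geometric_le//; have := Sn N; rewrite lee_fin.
- move=> x [n _ Fx] d d0; have [_ g0 gm _ /(_ x Fx d d0)[m hm]] := Hg n.
  exists (maxn m n.+1).
  have nM : (n < maxn m n.+1)%N by rewrite leq_max leqnn orbT.
  rewrite (bigD1 (Ordinal nM))//= -[leLHS]addr0 lerD//.
    by apply: le_trans hm _; apply: gm; exact: leq_maxl.
  by apply: sumr_ge0 => i _; have [_ h _ _ _] := Hg i; exact: h.
Qed.

(** [cut m n] is the minimum of [g n] and [m d], and [exc m n] is the rest of [g n]. On [F], where
    [d = 0], the rest is all of [g n]; off [F], [m d] exceeds [1] for large [m]. So the rests cover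
    [A] inside [F], the diagonal cuts cover it outside, and the functionals add up to [L (g n)]. *)
Let outer_split (F : set X) : closed F -> forall A,
  daniell_outer (A `&` F) + daniell_outer (A `&` ~` F) <= daniell_outer A.
Proof.
move=> /Hclosed[d [Hd d0 dF]] A.
apply/ler_addgt0Pr => e e0; have e20 : 0 < e / 2 by rewrite divr_gt0.
have [c [g [Hg g0 gm gc gA]] cA] := outer_adh A e20.
pose exc m n x := Num.max (g n x - m%:R * d x) 0.
pose cut m n x := g n x - exc m n x.
have Hexc m n : H (exc m n) by apply: Hpos; apply: HB => //; exact: HZ.
have Hcut m n : H (cut m n) by exact: HB.
have exc_ge0 m n x : 0 <= exc m n x by rewrite le_max lexx orbT.
have cut_ge0 m n x : 0 <= cut m n x.
  rewrite /cut /exc; have := g0 n x; have := mulr_ge0 (ler0n R m) (d0 x).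
  by case: (leP (g n x - m%:R * d x) 0) => ?; lra.
have exc_mono m x : nondecreasing_seq ((exc m) ^~ x).
  move=> i j ij; rewrite /exc; have := gm x _ _ ij.
  by case: (leP (g i x - m%:R * d x) 0) => ?; case: (leP (g j x - m%:R * d x) 0) => ?; lra.
have cut_mono i j m m' x : (i <= j)%N -> (m <= m')%N -> cut m i x <= cut m' j x.
  move=> ij mm; rewrite /cut /exc; have := gm x _ _ ij.
  have := ler_wpM2r (d0 x) (_ : m%:R <= m'%:R :> R); rewrite ler_nat => /(_ mm).
  by case: (leP (g i x - m%:R * d x) 0) => ?; case: (leP (g j x - m'%:R * d x) 0) => ?; lra.
have Lcut_le m n : L (cut m n) <= c.
  by apply: le_trans (gc n); apply: Lle => // x; rewrite /cut gerBl.
pose B := [set L (cut n n) | n in [set: nat]].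
have supB : has_sup B.
  by split; [exists (L (cut 0 0)), 0%N|exists c => _ [n _ <-]].
have h1 : daniell_outer (A `&` ~` F) <= sup B.
  apply: outer_le; exists (fun n => cut n n); split => //.
  - by move=> x i j ij; exact: cut_mono.
  - by move=> n; apply: ub_le_sup; [exact: supB.2|exists n].
  - move=> x [Ax nFx] t t0; have [n hn] := gA x Ax t t0.
    have dx : 0 < d x.
      by rewrite lt_def d0 andbT; apply/eqP => /dF.
    pose p := maxn n (Num.truncn (d x)^-1).+1; exists p.
    have hp : 1 <= p%:R * d x.
      rewrite -ler_pdivrMr// div1r; apply: (@le_trans _ _ (Num.truncn (d x)^-1).+1%:R).
        by apply/ltW/truncnS_gt.
      by rewrite ler_nat leq_maxr.
    have := gm x _ _ (leq_maxl n (Num.truncn (d x)^-1).+1); rewrite -/p => hg.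
    rewrite /cut /exc; case: (leP (g p x - p%:R * d x) 0) => ?; lra.
(* Fix [m] so that the diagonal cut nearly reaches its supremum; what it leaves of [c] bounds
   [L (exc m n)] for all [n]. *)
have [_ [m _ <-] hm] := sup_adherent e20 supB.
have h2 : daniell_outer (A `&` F) <= c - sup B + e / 2.
  apply: outer_le; exists (exc m); split => //.
  - move=> n; apply: (@le_trans _ _ (L (exc m (maxn m n)))).
      by apply: Lle => // x; apply: exc_mono; exact: leq_maxr.
    have hc : L (cut m m) <= L (cut m (maxn m n)).
      by apply: Lle => // x; apply: cut_mono => //; exact: leq_maxl.
    have LC p : L (cut m p) = L (g p) - L (exc m p) by exact: LB.
    have := gc (maxn m n); move: hc; rewrite (LC (maxn m n)); lra.
  - move=> x [Ax Fx] t t0; have [n hn] := gA x Ax t t0; exists n.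
    by rewrite /exc ((dF x).2 Fx) mulr0 subr0 max_l.
lra.
Qed.

(** By Dini's theorem, a cover of the whole space uniformly exceeds [1 - e] at some stage. *)
Let outer_setT : daniell_outer setT = 1.
Proof.
apply/eqP; rewrite eq_le; apply/andP; split; first exact: outer_le (cover1 _).
apply: lb_le_inf; first exact: (cover_inf _).1.
move=> c [g [Hg g0 gm gc gA]]; apply/ler_addgt0Pr => e e0.
have [] := @Hdini (fun n x => Num.max (1 - g n x) 0) _ _ _ e e0.
- by move=> n; apply: Hpos; exact: HB.
- move=> x i j ij; have := gm x _ _ ij.
  by case: (leP (1 - g i x) 0) => ?; case: (leP (1 - g j x) 0) => ?; lra.
- move=> x; apply/cvgrPdist_le => t t0; have [n hn] := gA x I t t0.
  exists n => // m /= nm; have := gm x _ _ nm; rewrite sub0r normrN ger0_norm; last first.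
    by rewrite le_max lexx orbT.
  by case: (leP (1 - g m x) 0) => ?; lra.
move=> n hn; have : L (fun=> 1 - e) <= L (g n).
  apply: Lle => // x; have := hn x.
  by case: (leP (1 - g n x) 0) => ?; lra.
by rewrite Lcst => h; have := gc n; lra.
Qed.

Let outer_closed_le (F : set X) g : H g -> (forall x, 0 <= g x) ->
  (forall x, F x -> 1 <= g x) -> daniell_outer F <= L g.
Proof.
move=> Hg g0 gF; apply: outer_le; exists (fun=> g).
split=> [//|//|x i j _|//|x Fx e e0]; first exact: lexx.
by exists 0%N; have := gF x Fx; lra.
Qed.

Theorem daniell : exists nu : probability (borel X) R,
  forall f, H f -> \int[nu]_x f x = L f.
Proof.
pose om : {outer_measure set X -> \bar R} := HB.pack (fun A : set X => (daniell_outer A)%:E)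
  (isOuterMeasure.Build R X (fun A : set X => (daniell_outer A)%:E)
    (congr1 EFin outer0) (fun A => outer_ge0 A) (fun A B AB => outer_mono AB) outer_sub).
have om_closed F : closed F -> om.-caratheodory F.
  by move=> cF; apply: le_caratheodory_measurable => A; rewrite lee_fin; exact: outer_split.
have om_borel (B : set (borel X)) : measurable B -> om.-caratheodory B.
  move: B; apply: smallest_sub.
    have := @sigma_algebra_measurable _ (caratheodory_type om).
    by [].
  move=> B oB; rewrite -(setCK B); apply: caratheodory_measurable_setC.
  by apply: om_closed; exact: open_closedC.
pose nu (B : set (borel X)) := om B.
have nu_sa : semi_sigma_additive nu.
  move=> F mF tF mU; apply: (@caratheodory_measure_sigma_additive R X om F) => //.
    by move=> n; exact/om_borel.
  exact/om_borel.
have [num numE] : {m : {measure set (borel X) -> \bar R} | forall A, m A = nu A}.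
  pose m : {measure set (borel X) -> \bar R} := HB.pack nu
    (isMeasure.Build _ _ _ nu (outer_measure0 om) (outer_measure_ge0 om) nu_sa).
  by exists m.
have num1 : num setT = 1%E by rewrite numE /nu /= outer_setT.
have [nup nupE] := probability_of_measure num1.
exists nup.
have fi f : H f -> rintegrable nup f.
  move=> Hf; have [M fM] := Hbounded Hf; apply: (@rintegrable_le _ _ _ _ _ (fun=> M)) => //.
    exact: Hmeas.
  exact: finite_measure_integrable_cst.
(* Only this inequality is proved from the level sets, the measure of [F i] being at most
   [L (layer N i f)]. Equality follows from the same inequality for [1 - u], where [u] rescales [f]
   to [[0, 1]]. *)
have le1 f : H f -> (forall x, 0 <= f x <= 1) -> \int[nup]_x f x <= L f.
  move=> Hf f01; apply/ler_addgt0Pr => e e0.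
  pose N := (Num.truncn e^-1).+1.
  have Ne : N%:R^-1 <= e.
    by rewrite -[leRHS]invrK lef_pV2 ?posrE ?ltr0n ?invr_gt0//; apply/ltW/truncnS_gt.
  pose F i := [set y | i.+1%:R <= N%:R * f y].
  have mF i : measurable (F i : set (borel X)).
    have := Hmeas Hf measurableT (measurable_itv `[i.+1%:R / N%:R, +oo[).
    rewrite setTI; congr measurable; apply/seteqP; split => x /=;
      by rewrite in_itv /= andbT ler_pdivrMr ?ltr0n// mulrC.
  have iF i : rintegrable nup (\1_(F i)).
    apply: (@rintegrable_le _ _ _ _ _ (fun=> 1)).
    - exact: measurable_indic.
    - exact: finite_measure_integrable_cst.
    - by move=> x; rewrite indicE; case: (_ \in _); rewrite ?normr1 ?normr0.
  have iS : rintegrable nup (fun x => \sum_(i < N) \1_(F i) x).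
    exact: rintegrable_sum.
  apply: (@le_trans _ _ (\int[nup]_x (staircase N f x + N%:R^-1))).
    apply: rint_le; first exact: fi.
      apply: rintegrableD; first exact: rintegrableZ.
      exact: finite_measure_integrable_cst.
    by move=> x; exact: le_staircase.
  rewrite RintegralD//; first last.
  - exact: finite_measure_integrable_cst.
  - exact: rintegrableZ.
  rewrite RintegralZl// Rintegral_cst// (_ : fine _ = 1); last first.
    by rewrite [X in fine X]probability_setT.
  rewrite mulr1; apply: lerD => //.
  rewrite mulrC ler_pdivrMr ?ltr0n// rint_sum; last by move=> i; exact: iF.
  have -> : L f * N%:R = L (fun x => \sum_(i < N) layer N i f x).
    rewrite mulrC -LZ//; congr L; apply/funext => x; by rewrite sum_layer.
  have Hl i : H (layer N i f).
    by apply: HB; apply: Hpos; apply: HB => //; exact: HZ.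
  rewrite Lsum//; apply: ler_sum => i _.
  have -> : \int[nup]_x \1_(F i) x = daniell_outer (F i).
    by rewrite rint_indic// -[daniell_outer _]/(fine (nu (F i))) -numE -nupE.
  apply: (@outer_closed_le (F i) (layer N i f)) => //; first exact: layer_ge0.
  by move=> x Fx; have := indic_le_layer N i f x; rewrite indicE mem_set.
move=> f Hf; have [M fM] := Hbounded Hf.
pose a := `|M| + 1; have a0 : 0 < a by rewrite ltr_wpDl.
have fa x : - a <= f x <= a.
  by rewrite -ler_norml; apply: le_trans (fM x) _; have := ler_norm M; rewrite /a; lra.
pose u x := (2 * a)^-1 * (f x + a).
have Hu : H u by apply: HZ; exact: HD.
have u01 x : 0 <= u x <= 1.
  have /andP[h1 h2] := fa x; have b0 : 0 < 2 * a by rewrite mulr_gt0.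
  rewrite /u mulrC divr_ge0 ?ler_pdivrMr//; lra.
have fE : f = fun x => 2 * a * u x - a.
  by apply/funext => x; rewrite /u mulrA divff ?mul1r ?addrK// gt_eqF// mulr_gt0.
have Iu : \int[nup]_x u x = L u.
  apply/eqP; rewrite eq_le le1//=.
  have H1u : H (fun x => 1 - u x) by exact: HB.
  have := le1 _ H1u; rewrite LB// Lcst RintegralB//; first last.
  - exact: fi.
  - exact: finite_measure_integrable_cst.
  rewrite Rintegral_cst// (_ : fine _ = 1); last by rewrite [X in fine X]probability_setT.
  rewrite mulr1 lerD2l lerN2; apply => x; have := u01 x; lra.
rewrite fE LB//; last exact: HZ.
rewrite LZ// Lcst RintegralB//; first last.
- exact: finite_measure_integrable_cst.
- by apply: rintegrableZ; exact: fi.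
rewrite RintegralZl//; last exact: fi.
rewrite Iu Rintegral_cst// (_ : fine _ = 1); last by rewrite [X in fine X]probability_setT.
by rewrite mulr1.
Qed.

End daniell.

(** Stated without measurability: [g] will be the squared operator norm, a supremum over an
    uncountable sphere. *)
Lemma ge0_le_integralT d (T : measurableType d) (R : realType) (m : {measure set T -> \bar R})
    (f g : T -> \bar R) : (forall x, 0 <= f x)%E -> (forall x, f x <= g x)%E ->
  (\int[m]_x f x <= \int[m]_x g x)%E.
Proof.
move=> f0 fg; rewrite !ge0_integralTE//; last by move=> x; exact: le_trans (fg x).
apply: le_ereal_sup => _ [h hf <-]; exists h => // x.
by apply: le_trans (fg x); exact: hf.
Qed.

Section matrix_integral.
Context d (T : measurableType d) {R : realType} (m : {measure set T -> \bar R}) (n : nat).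
Local Notation C := R[i].

Definition mxint (F : T -> 'M[C]_n) : 'M[C]_n :=
  \matrix_(i, j) ((\int[m]_v Re (F v i j)) +i* (\int[m]_v Im (F v i j))).

Lemma rtr_mxint (F : T -> 'M[C]_n) :
  (forall Z : 'M[C]_n, rintegrable m (fun v => rtr (F v ** Z))) ->
  forall X : 'M[C]_n, \int[m]_v rtr (F v ** X) = rtr (mxint F ** X).
Proof.
move=> iw X.
(* Test matrices with coefficients [1] and [- 'i] return the two parts of an entry, so integrability
   of all pairings yields that of the entries. *)
have rE v i j : Re (F v i j) = rtr (F v ** (1 *: delta_mx j i)) by rewrite rtr_delta mul1r.
have iE v i j : Im (F v i j) = rtr (F v ** (- 'i *: delta_mx j i)).
  by rewrite rtr_delta ReM /=; ring.
have ri i j : rintegrable m (fun v => Re (F v i j)).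
  by under eq_fun do rewrite rE; exact: iw.
have ii i j : rintegrable m (fun v => Im (F v i j)).
  by under eq_fun do rewrite iE; exact: iw.
have XE (Y : 'M[C]_n) : rtr (Y ** X) =
    \sum_i \sum_j (Re (X i j) * Re (Y j i) - Im (X i j) * Im (Y j i)).
  rewrite rtrC rtrE /mxtrace Re_sum; apply: eq_bigr => i _.
  by rewrite cmul_mx Re_sum; apply: eq_bigr => j _; rewrite ReM.
rewrite XE; under eq_Rintegral do rewrite XE.
have i1 i j : rintegrable m (fun v => Re (X i j) * Re (F v j i) - Im (X i j) * Im (F v j i)).
  by apply: rintegrableB; exact: rintegrableZ.
rewrite rint_sum => [|i]; last exact: rintegrable_sum.
apply: eq_bigr => i _; rewrite rint_sum//; apply: eq_bigr => j _.
rewrite RintegralB//; [|exact: rintegrableZ..].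
by rewrite mxE /=; congr (_ - _); apply: RintegralZl => //; [exact: ri|exact: ii].
Qed.

End matrix_integral.

(** * Second moments of [mu] *)

Section hypotheses.
Context {R : realType} {k : nat}.
Local Notation C := R[i].
Local Notation Mk := 'M[C]_k.+1.
Variable mu : {measure set (borel Mk) -> \bar R}.
Hypothesis mu_fin : (\int[mu]_v ((opnorm (v : Mk)) ^+ 2)%:E < +oo)%E.
Hypothesis mu_id : mx_integral mu (fun v => v ^t* *m v) = 1%:M.

Lemma nsq_col_opnorm (v : Mk) (j : 'I_k.+1) : nsq (col j v) <= opnorm v ^+ 2.
Proof.
pose S := [set hnorm (v *m x) | x in [set x : 'cV[C]_k.+1 | hnorm x = 1]].
have ub : has_ubound S.
  exists (Num.sqrt (nsq v)) => _ [x /= x1 <-].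
  rewrite -(@ler_pXn2r _ 2)// ?nnegrE ?sqrtr_ge0// hnorm_sq sqr_sqrtr ?nsq_ge0//.
  by rewrite -cmulE (le_trans (nsq_cmul_le _ _))// -hnorm_sq x1 expr1n mulr1.
pose u : 'cV[C]_k.+1 := delta_mx j 0.
have u1 : hnorm u = 1.
  apply/eqP; rewrite -(@eqrXn2 _ 2)// ?sqrtr_ge0// hnorm_sq expr1n nsq_sum (bigD1 j)//=.
  rewrite big_ord1 mxE !eqxx csqR expr1n big1 ?addr0// => i /negPf ij.
  by rewrite big_ord1 mxE ij csq0.
have le : hnorm (v *m u) <= opnorm v by apply: (ub_le_sup ub); exists u.
rewrite colE -/u -hnorm_sq ler_pXn2r// nnegrE ?sqrtr_ge0//.
by apply: le_trans le; exact: sqrtr_ge0.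
Qed.

Lemma nsq_rintegrable : rintegrable mu (fun v : borel Mk => nsq (v : Mk)).
Proof.
have h j : rintegrable mu (fun v : borel Mk => nsq (col j (v : Mk))).
  apply/integrableP; split.
    apply/measurable_EFinP; under eq_fun do rewrite colE -cmulE.
    by apply: measurable_nsq; apply: mxmeas_mul; [exact: mxmeas_id|exact: mxmeas_cst].
  apply: le_lt_trans mu_fin; apply: ge0_le_integralT => [v|v]; first exact: abse_ge0.
  by rewrite /= lee_fin ger0_norm ?nsq_ge0// nsq_col_opnorm.
have := rintegrable_sum (index_enum 'I_k.+1) h.
by congr rintegrable; apply/funext => v; rewrite nsq_col.
Qed.

Lemma gram_integral (Y : Mk) :
  \int[mu]_v rtr (adj (v : Mk) ** (v : Mk) ** Y) = rtr Y.
Proof.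
have iw (Z : Mk) : rintegrable mu (fun v : borel Mk => rtr (adj (v : Mk) ** (v : Mk) ** Z)).
  have := @orbit_integrable R k mu nsq_rintegrable _ _ 1%:M (@qfun_form R _ _ 1%:M Z).
  by congr rintegrable; apply/funext => v; rewrite cmul1r cmul1l cmulA.
rewrite (rtr_mxint iw) (_ : mxint _ _ = 1%:M) ?cmul1l//.
by rewrite -mu_id; congr mxint; apply/funext => v; rewrite cmulE adjE.
Qed.

End hypotheses.

(** * The transition kernel, and invariance tested on Lipschitz functions *)

Section kernel_invariance.
Context {R : realType} {k : nat}.
Local Notation C := R[i].
Local Notation Mk := 'M[C]_k.+1.
Local Notation PC := (borel (proj_space R k)).

(** Hypotheses of a functional monotone class argument. The fixed bound [1] on the sequences is
    enough because the approximations used have values in [[0, 1]]. *)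
Definition bounded_closed (Q : set (PC -> R)) :=
  [/\ forall f g, Q f -> Q g -> Q (fun p => f p + g p),
      forall r f, Q f -> Q (fun p => r * f p) &
      forall f_ f, (forall n : nat, Q (f_ n)) -> (forall n p, `|f_ n p| <= 1) ->
        (forall p, f_ n p @[n --> \oo] --> (f p : R)) -> Q f].

Lemma bounded_closedB Q f g : bounded_closed Q -> Q f -> Q g -> Q (fun p => f p - g p).
Proof.
move=> [QD QZ _] Qf Qg; have := QD _ _ Qf (QZ (-1) _ Qg).
by congr Q; apply/funext => p; rewrite mulN1r.
Qed.

Lemma bounded_closed_sum Q I (s : seq I) (f : I -> PC -> R) : bounded_closed Q ->
  (forall i, Q (f i)) -> Q (fun=> 0) -> Q (fun p => \sum_(i <- s) f i p).
Proof.
move=> [QD _ _] Qf Q0; elim: s => [|i s ih].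
  by move: Q0; congr Q; apply/funext => p; rewrite big_nil.
by have := QD _ _ (Qf i) ih; congr Q; apply/funext => p; rewrite big_cons.
Qed.

(** The sets with indicator in [Q] form a lambda-system. It contains the open sets, since the
    indicator of a closed set is the limit of the positive parts of [1 - n d] with [d] from
    [lipP_closed]; open sets being stable under intersection, it contains all Borel sets. *)
Lemma bounded_closed_indic Q : bounded_closed Q -> lipP `<=` Q ->
  forall S, measurable S -> Q (\1_S).
Proof.
move=> QC lipQ; have [QD QZ Qlim] := QC.
have Q1 : Q (fun=> 1) by apply: lipQ; exact: lipP_cst.
have LS : lambda_system setT [set S | Q (\1_S)].
  split=> //=.
  - by move: Q1; congr Q; apply/funext => p; rewrite indicT.
  - move=> A B BA QA QB; have := bounded_closedB QC QA QB; congr Q.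
    apply/funext => p; rewrite !indicE in_setD.
    case: (boolP (p \in B)) => [pB|_]; last by rewrite andbT subr0.
    by rewrite (mem_set (BA _ (set_mem pB))) subrr.
  - move=> F ndF QF; apply: (Qlim (fun n => \1_(F n))) => //.
      by move=> n p; rewrite indicE; case: (_ \in _); rewrite ?normr1 ?normr0.
    move=> p; apply: cvg_near_cst.
    have [[n _ Fnp]|nF] := pselect ((\bigcup_n F n) p).
      exists n => // m /= nm; rewrite !indicE.
      rewrite (mem_set (_ : (\bigcup_n F n) p)); last by exists n.
      by rewrite mem_set//; have /subsetPset := ndF _ _ nm; exact.
    apply: nearW => m; rewrite !indicE (memNset nF) memNset//.
    by move=> Fm; apply: nF; exists m.
apply: (lambda_system_subset _ LS) => //.
  exact: openI.
move=> U oU /=.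
have [d [dl d0 dU]] := lipP_closed (open_closedC oU).
pose f_ n p := Num.max (1 - n%:R * d p) 0.
have fl n : lipP (f_ n) by apply: lipP_pos; apply: lipPB; [exact: lipP_cst|exact: lipPZ].
have f01 n p : 0 <= f_ n p <= 1.
  have h : 0 <= n%:R * d p by rewrite mulr_ge0.
  by rewrite /f_; case: (leP (1 - n%:R * d p) 0) => ?; lra.
have Qc : Q (\1_(~` U)).
  apply: (Qlim f_); first by move=> n; exact/lipQ/fl.
    by move=> n p; have /andP[h1 h2] := f01 n p; rewrite ger0_norm.
  move=> p; apply: cvg_near_cst.
  have [Up|nUp] := pselect ((~` U) p).
    apply: nearW => n; rewrite indicE (mem_set Up) /f_ ((dU p).2 Up) mulr0 subr0 max_l//.
  have dp : 0 < d p by rewrite lt_def d0 andbT; apply/eqP => /dU.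
  exists (Num.truncn (d p)^-1).+1 => // m /= nm; rewrite indicE (memNset nUp) /f_ max_r//.
  rewrite subr_le0 -ler_pdivrMr// div1r; apply: (@le_trans _ _ (Num.truncn (d p)^-1).+1%:R).
    by apply/ltW/truncnS_gt.
  by rewrite ler_nat.
have := bounded_closedB QC Q1 Qc; congr Q; apply/funext => p; rewrite !indicE in_setC.
by case: (_ \in _) => /=; rewrite ?subr0 ?subrr.
Qed.

Lemma bounded_closed_measurable Q : bounded_closed Q ->
  (forall S, measurable S -> Q (\1_S)) ->
  forall f : PC -> R, measurable_fun setT f -> (exists M : R, forall p, `|f p| <= M) -> Q f.
Proof.
move=> QC Qi f mf [M fM]; have [QD QZ Qlim] := QC.
have Q1 : Q (fun=> 1).
  by have := Qi setT measurableT; congr Q; apply/funext => p; rewrite indicT.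
have Q0 : Q (fun=> 0) by have := QZ 0 _ Q1; congr Q; apply/funext => p; rewrite mul0r.
have Q01 (g : PC -> R) : measurable_fun setT g -> (forall p, 0 <= g p <= 1) -> Q g.
  move=> mg g01; apply: (Qlim (fun n => staircase n.+1 g)).
  - move=> n; apply: (QZ _ (fun p => _)); apply: bounded_closed_sum => // i.
    apply: Qi.
    have := mg measurableT _ (measurable_itv `[i.+1%:R / n.+1%:R, +oo[).
    rewrite setTI; congr measurable; apply/seteqP; split => x /=;
      by rewrite in_itv /= andbT ler_pdivrMr ?ltr0n// mulrC.
  - move=> n p; have /andP[h1 h2] := g01 p.
    have h3 := staircase_le (ltn0Sn n) (g01 p).
    rewrite ger0_norm ?(le_trans h3)//.
    apply: mulr_ge0; first by rewrite invr_ge0.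
    by apply: sumr_ge0 => i _; have /andP[] := @indic01 R PC [set y | i.+1%:R <= n.+1%:R * g y] p.
  - move=> p; apply/cvgrPdist_le => e e0.
    exists (Num.truncn e^-1) => // n /= nm.
    have h3 := staircase_le (ltn0Sn n) (g01 p).
    have h4 := le_staircase (ltn0Sn n) (g01 p).
    have ne : n.+1%:R^-1 <= e.
      rewrite -[leRHS]invrK lef_pV2 ?posrE ?ltr0n ?invr_gt0//.
      by apply: le_trans (ltW (truncnS_gt _)) _; rewrite ler_nat.
    by rewrite ger0_norm ?subr_ge0// lerBlDl (le_trans h4)// lerD2l.
pose a := `|M| + 1; have a0 : 0 < a by rewrite ltr_wpDl.
have fa p : - a <= f p <= a.
  by rewrite -ler_norml; apply: le_trans (fM p) _; rewrite /a (le_trans (ler_norm M))// lerDl.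
have b0 : 0 < 2 * a by rewrite mulr_gt0.
pose u p := (2 * a)^-1 * (f p + a).
have Qu : Q u.
  apply: Q01; first by apply: measurable_funM => //; exact: measurable_funD.
  move=> p; have /andP[h1 h2] := fa p.
  rewrite /u mulrC divr_ge0 ?(ltW b0)//=; last by rewrite -lerBlDr sub0r.
  by rewrite ler_pdivrMr// mul1r mulr2n mulrDl !mul1r lerD2r.
have := bounded_closedB QC (QZ (2 * a) _ Qu) (QZ a _ Q1); congr Q; apply/funext => p.
by rewrite /u mulrA divff ?mul1r ?mulr1 ?addrK// gt_eqF.
Qed.

Lemma lift_bounded (f : PC -> R) (M : R) (x : 'cV[C]_k.+1) : (forall p, `|f p| <= M) ->
  `|lift f x| <= M * nsq x.
Proof.
move=> fM; have [->|/liftE[p E]] := eqVneq x 0; first by rewrite lift0 nsq0 mulr0 normr0.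
by rewrite E normrM (ger0_norm (nsq_ge0 x)) ler_wpM2r ?nsq_ge0.
Qed.

Lemma lift_cvg (f_ : nat -> PC -> R) (f : PC -> R) (x : 'cV[C]_k.+1) :
  (forall p, f_ n p @[n --> \oo] --> f p) -> lift (f_ n) x @[n --> \oo] --> lift f x.
Proof.
move=> ff; have [->|/liftE[p E]] := eqVneq x 0.
  by rewrite lift0; under eq_fun do rewrite lift0; exact: cvg_cst.
by rewrite E; under eq_fun do rewrite E; apply: cvgMl; exact: ff.
Qed.

Lemma prob_rintegrable (nu : probability PC R) (f : PC -> R) : measurable_fun setT f ->
  (exists M : R, forall p, `|f p| <= M) -> rintegrable nu f.
Proof.
move=> mf [M fM]; apply: (@rintegrable_le _ _ _ nu _ (fun=> M)) => //.
exact: finite_measure_integrable_cst.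
Qed.

Lemma lipP_rintegrable (nu : probability PC R) (f : PC -> R) : lipP f -> rintegrable nu f.
Proof. by move=> fl; apply: prob_rintegrable; [exact: lipP_measurable|exact: lipP_bounded]. Qed.

Lemma rint_cst (nu : probability PC R) (r : R) : \int[nu]_p r = r.
Proof. by rewrite Rintegral_cst// [X in fine X]probability_setT mulr1. Qed.

(** Linear relations between measures are handled as finite families with real coefficients, so that
    no signed measure is formed. *)
Definition signed_null (I : finType) (c : I -> R) (nu : I -> probability PC R) (f : PC -> R) :=
  [/\ measurable_fun setT f, exists M : R, forall p, `|f p| <= M &
  \sum_i c i * \int[nu i]_p f p = 0].

Lemma bounded_closed_signed (I : finType) (c : I -> R) (nu : I -> probability PC R) :
  bounded_closed (signed_null c nu).
Proof.
split.
- move=> f g [mf bf hf] [mg bg hg]; split.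
  + exact: measurable_funD.
  + have [M fM] := bf; have [N gN] := bg; exists (M + N) => p.
    by apply: le_trans (ler_normD _ _) _; exact: lerD.
  + have {}hf : \sum_i c i * \int[nu i]_p f p + \sum_i c i * \int[nu i]_p g p = 0.
      by rewrite hf hg addr0.
    rewrite -[RHS]hf -big_split; apply: eq_bigr => i _ /=.
    by rewrite RintegralD ?mulrDr//; exact: prob_rintegrable.
- move=> r f [mf bf hf]; split.
  + exact: measurable_funM.
  + have [M fM] := bf; exists (`|r| * M) => p; by rewrite normrM ler_wpM2l.
  + rewrite -[RHS](mulr0 r) -[in RHS]hf mulr_sumr; apply: eq_bigr => i _ /=.
    by rewrite RintegralZl 1?mulrCA//; exact: prob_rintegrable.
- move=> f_ f Qf b ff; have mf : measurable_fun setT f.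
    by apply: (measurable_fun_cvg (h := f_)) => // n; have [] := Qf n.
  have cv i : \int[nu i]_p f_ n p @[n --> \oo] --> \int[nu i]_p f p.
    have [] := @rint_cvg _ _ _ (nu i) f_ f (fun=> 1) => //.
      by move=> n; have [] := Qf n.
    exact: finite_measure_integrable_cst.
  split=> //.
    exists 1 => p; have /(@cvg_norm _ R^o) h1 := ff p.
    by apply: (ler_cvg_to h1 (cvg_cst _)); apply: nearW => n; exact: b.
  have c1 : (\sum_i c i * \int[nu i]_p f_ n p) @[n --> \oo] --> \sum_i c i * \int[nu i]_p f p.
    by apply: cvg_big => [|i _]; [exact: add_continuous|apply: cvgMr; exact: cv].
  have c2 : (\sum_i c i * \int[nu i]_p f_ n p) @[n --> \oo] --> (0 : R).
    rewrite (_ : (fun n => _) = fun=> 0); first exact: cvg_cst.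
    by apply/funext => n; have [] := Qf n.
  by apply: (cvg_unique _ c1 c2); exact: Rhausdorff.
Qed.

Lemma signed_indic (I : finType) (c : I -> R) (nu : I -> probability PC R) :
  (forall f, lipP f -> \sum_i c i * \int[nu i]_p f p = 0) ->
  forall S, measurable S -> \sum_i c i * fine (nu i S) = 0.
Proof.
move=> h S mS.
have [|_ _ hS] := bounded_closed_indic (bounded_closed_signed c nu) _ mS.
  by move=> f fl; split; [exact: lipP_measurable|exact: lipP_bounded|exact: h].
by rewrite -[RHS]hS; apply: eq_bigr => i _; rewrite rint_indic.
Qed.

Lemma indic_signed (I : finType) (c : I -> R) (nu : I -> probability PC R) :
  (forall S, measurable S -> \sum_i c i * fine (nu i S) = 0) ->
  forall f, lipP f -> \sum_i c i * \int[nu i]_p f p = 0.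
Proof.
move=> h f fl.
suff [] : signed_null c nu f by [].
apply: (bounded_closed_measurable (bounded_closed_signed c nu)).
- move=> S mS; split; first exact: measurable_indic.
    by exists 1 => p; rewrite indicE; case: (_ \in _); rewrite ?normr1 ?normr0.
  by rewrite -[RHS](h S mS); apply: eq_bigr => i _; rewrite rint_indic.
- exact: lipP_measurable.
- exact: lipP_bounded.
Qed.

Variable mu : {measure set (borel Mk) -> \bar R}.
Hypothesis mu_nsq : rintegrable mu (fun v : borel Mk => nsq (v : Mk)).
Hypothesis mu_form : forall Y : Mk,
  \int[mu]_v rtr (adj (v : Mk) ** (v : Mk) ** Y) = rtr Y.

Definition step (f : PC -> R) (p : PC) : R := markov mu (lift f) (unit_rep p).

(** The last two clauses are obtained for indicators of Borel sets by the monotone class argument,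
    not from joint measurability in [v] and [p]. *)
Definition step_good (f : PC -> R) := [/\ measurable_fun setT f,
  exists M : R, forall p, `|f p| <= M,
  forall p, measurable_fun setT (fun v : borel Mk => lift f ((v : Mk) ** unit_rep p)) &
  measurable_fun setT (step f)].

Lemma step_good_rintegrable f p : step_good f ->
  rintegrable mu (fun v : borel Mk => lift f ((v : Mk) ** unit_rep p)).
Proof.
move=> [_ [M fM] mf _].
apply: (@rintegrable_le _ _ _ mu _ (fun v : borel Mk => M * nsq ((v : Mk) ** unit_rep p))) => //.
  exact/rintegrableZ/orbit_nsq_integrable.
by move=> v; exact: lift_bounded.
Qed.

Lemma stepD f g p : step_good f -> step_good g ->
  step (fun q => f q + g q) p = step f p + step g p.
Proof.
move=> fg gg; rewrite /step /markov -RintegralD//; [|exact: step_good_rintegrable..].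
by apply: eq_Rintegral => v _; rewrite liftD.
Qed.

Lemma stepZ r f p : step_good f -> step (fun q => r * f q) p = r * step f p.
Proof.
move=> fg; rewrite /step /markov -RintegralZl//; last exact: step_good_rintegrable.
by apply: eq_Rintegral => v _; rewrite liftZ.
Qed.

Lemma step_cvg (f_ : nat -> PC -> R) f p : (forall n, step_good (f_ n)) ->
  (forall n p, `|f_ n p| <= 1) -> (forall p, f_ n p @[n --> \oo] --> f p) ->
  step (f_ n) p @[n --> \oo] --> step f p.
Proof.
move=> fg b ff.
have [] := @rint_cvg _ _ _ mu (fun n (v : borel Mk) => lift (f_ n) ((v : Mk) ** unit_rep p))
  (fun v : borel Mk => lift f ((v : Mk) ** unit_rep p))
  (fun v : borel Mk => 1 * nsq ((v : Mk) ** unit_rep p)) => //.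
- by move=> n; have [_ _] := fg n.
- by move=> v; exact: lift_cvg.
- exact/rintegrableZ/orbit_nsq_integrable.
- by move=> n v; exact: lift_bounded.
Qed.

Lemma step_bounded f M p : step_good f -> (forall p, `|f p| <= M) -> `|step f p| <= M.
Proof.
move=> fg fM; have fi := step_good_rintegrable p fg.
have -> : M = \int[mu]_v (M * nsq ((v : Mk) ** unit_rep p)).
  rewrite RintegralZl//; last exact: orbit_nsq_integrable.
  by have := markov_nsq mu_form (unit_rep p); rewrite /markov => ->; rewrite nsq_unit_rep mulr1.
have i0 : rintegrable mu (fun v : borel Mk => M * nsq ((v : Mk) ** unit_rep p)).
  exact/rintegrableZ/orbit_nsq_integrable.
apply: le_trans (le_normr_Rintegral measurableT fi) _.
apply: rint_le => //.
  exact: (integrable_norm fi).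
by move=> v; exact: lift_bounded.
Qed.

Lemma bounded_closed_step : bounded_closed step_good.
Proof.
split.
- move=> f g fg gg; have [mf [M fM] lf kf] := fg; have [mg [N gN] lg kg] := gg; split.
  + exact: measurable_funD.
  + by exists (M + N) => p; apply: le_trans (ler_normD _ _) _; exact: lerD.
  + move=> p; under eq_fun do rewrite liftD; exact: measurable_funD.
  + rewrite (_ : step _ = fun p => step f p + step g p); first exact: measurable_funD.
    by apply/funext => p; exact: stepD.
- move=> r f fg; have [mf [M fM] lf kf] := fg; split.
  + exact: measurable_funM.
  + by exists (`|r| * M) => p; by rewrite normrM ler_wpM2l.
  + move=> p; under eq_fun do rewrite liftZ; exact: measurable_funM.
  + rewrite (_ : step _ = fun p => r * step f p); first exact: measurable_funM.
    by apply/funext => p; exact: stepZ.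
- move=> f_ f fg b ff; split.
  + by apply: (measurable_fun_cvg (h := f_)) => // n; have [] := fg n.
  + exists 1 => p; have /(@cvg_norm _ R^o) h1 := ff p.
    by apply: (ler_cvg_to h1 (cvg_cst _)); apply: nearW => n; exact: b.
  + move=> p; apply: (measurable_fun_cvg
        (h := fun n (v : borel Mk) => lift (f_ n) ((v : Mk) ** unit_rep p))).
      by move=> n; have [_ _] := fg n.
    by move=> v _; exact: lift_cvg.
  + apply: (measurable_fun_cvg (h := fun n => step (f_ n))).
      by move=> n; have [_ _ _] := fg n.
    by move=> p _; exact: step_cvg.
Qed.

Lemma lipP_step f : lipP f -> lipP (step f).
Proof. by move=> fl; apply: lipP_of; exact: markov_qfun. Qed.

Lemma lipP_step_good f : lipP f -> step_good f.
Proof.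
move=> fl; split; [exact: lipP_measurable|exact: lipP_bounded| |].
  by move=> p; exact: orbit_measurable.
by apply: lipP_measurable; exact: lipP_step.
Qed.

Lemma indic_step_good S : measurable S -> step_good (\1_S).
Proof.
by move=> mS; apply: bounded_closed_indic mS; [exact: bounded_closed_step|exact: lipP_step_good].
Qed.

Lemma trans_kernelE (p : PC) (S : set PC) : measurable S ->
  trans_kernel mu p S = (step (\1_S) p)%:E.
Proof.
move=> mS; rewrite /step /markov /Rintegral fineK; last first.
  exact: (integrable_fin_num measurableT (step_good_rintegrable p (indic_step_good mS))).
apply: eq_integral => v _; congr EFin.
rewrite /proj_act /lift cmulE; case: insubP => //= z _ zE.
by rewrite hnorm_sq.
Qed.

(** Two monotone class arguments for the same class [Q]: from indicators to Lipschitz functions, and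
    from Lipschitz functions to indicators. *)
Lemma invariantP (nu : probability PC R) : invariant_measure mu nu <->
  forall f, lipP f -> \int[nu]_p step f p = \int[nu]_p f p.
Proof.
have si f : step_good f -> rintegrable nu (step f).
  move=> fg; have [_ [M fM] _ mf] := fg; apply: prob_rintegrable => //.
  by exists M => p; exact: step_bounded.
have fi f : step_good f -> rintegrable nu f.
  by move=> [mf bf _ _]; exact: prob_rintegrable.
pose Q (f : PC -> R) := step_good f /\ \int[nu]_p step f p = \int[nu]_p f p.
have QC : bounded_closed Q.
  have [SD SZ Slim] := bounded_closed_step.
  split.
  - move=> f g [fg hf] [gg hg]; split; first exact: SD.
    rewrite RintegralD//; [|exact: fi..]; rewrite -hf -hg -RintegralD//; [|exact: si..].
    by apply: eq_Rintegral => p _; exact: stepD.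
  - move=> r f [fg hf]; split; first exact: SZ.
    rewrite RintegralZl//; [|exact: fi]; rewrite -hf -RintegralZl//; [|exact: si].
    by apply: eq_Rintegral => p _; exact: stepZ.
  - move=> f_ f Qf b ff.
    have gf n : step_good (f_ n) by have [] := Qf n.
    split; first exact: (Slim f_).
    have i1 : rintegrable nu (fun=> 1 : R) by exact: finite_measure_integrable_cst.
    have mf n : measurable_fun setT (f_ n) by have [] := gf n.
    have mk n : measurable_fun setT (step (f_ n)) by have [_ _ _] := gf n.
    have bk n p : `|step (f_ n) p| <= 1 by exact: (step_bounded _ (gf n) (b n)).
    have ck p : step (f_ n) p @[n --> \oo] --> step f p by exact: step_cvg.
    have [_ c1] := rint_cvg mf ff i1 b.
    have [_ c2] := rint_cvg mk ck i1 bk.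
    have e : (fun n => \int[nu]_p step (f_ n) p) = fun n => \int[nu]_p f_ n p.
      by apply/funext => n; have [_] := Qf n.
    by rewrite e in c2; apply: (cvg_unique _ c2 c1); exact: Rhausdorff.
have tE S : measurable S ->
    (\int[nu]_p trans_kernel mu p S)%E = (\int[nu]_p step (\1_S) p)%:E.
  move=> mS; rewrite /Rintegral fineK; last first.
    exact: (integrable_fin_num measurableT (si _ (indic_step_good mS))).
  by apply: eq_integral => p _; exact: trans_kernelE.
have nuE S : measurable S -> nu S = (\int[nu]_p \1_S p)%:E.
  by move=> mS; rewrite rint_indic// fineK// fin_num_measure.
split.
  move=> inv f fl.
  suff : Q f by case.
  apply: (bounded_closed_measurable QC); [|exact: lipP_measurable|exact: lipP_bounded].
  move=> S mS; split; first exact: indic_step_good.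
  by have := inv S mS; rewrite tE// nuE// => -[].
move=> h S mS; rewrite tE// nuE//; congr EFin.
suff : Q (\1_S) by case.
apply: bounded_closed_indic mS => // f fl; split; [exact: lipP_step_good|exact: h].
Qed.

End kernel_invariance.

(** * Existence of invariant measures with a prescribed barycenter *)

Section invariant_measures.
Context {R : realType} {k : nat}.
Local Notation C := R[i].
Local Notation Mk := 'M[C]_k.+1.
Local Notation PC := (borel (proj_space R k)).
Variable mu : {measure set (borel Mk) -> \bar R}.
Hypothesis mu_nsq : rintegrable mu (fun v : borel Mk => nsq (v : Mk)).
Hypothesis mu_form : forall Y : Mk,
  \int[mu]_v rtr (adj (v : Mk) ** (v : Mk) ** Y) = rtr Y.

(** Pairs [Y] with [A A^*], hence is additive over the columns of [A]; [markov] moves it to another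
    form of the same kind, whereas the pairing with [A^* A] is invariant. *)
Definition gform m n (Y : 'M[C]_m) (A : 'M[C]_(m, n)) : R := rtr (Y ** (A ** adj A)).

Lemma gformE m n (Y : 'M[C]_m) (A : 'M[C]_(m, n)) :
  gform Y A = rtr (adj A ** (Y ** A ** 1%:M)).
Proof. by rewrite /gform cmul1r rtrC -[LHS]rtrC cmulA -rtrC. Qed.

Lemma qfun_gform m n (Y : 'M[C]_m) : qfun (@gform m n Y).
Proof.
have := @qfun_form R m n Y 1%:M; congr qfun.
by apply/funext => A; rewrite gformE.
Qed.

Lemma gform_col m n (Y : 'M[C]_m) (A : 'M[C]_(m, n)) :
  gform Y A = \sum_j gform Y (col j A).
Proof.
rewrite gformE rtrE /mxtrace Re_sum; apply: eq_bigr => j _.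
rewrite gformE !cmul1r rtrE /mxtrace big_ord1 !cmul_mx; congr Re; apply: eq_bigr => i _.
by rewrite !adj_mx -cmul_col !mxE.
Qed.

Lemma qfun_col m n (q : 'cV[C]_m -> R) (j : 'I_n) :
  qfun q -> qfun (fun A : 'M[C]_(m, n) => q (col j A)).
Proof.
move=> [qh [c c0 ql]]; split; first by move=> a A; rewrite linearZ qh.
have cl (A : 'M[C]_(m, n)) : nsq (col j A) <= nsq A.
  rewrite [leRHS]nsq_col (bigD1 j)//= lerDl.
  by apply: sumr_ge0 => i _; exact: nsq_ge0.
exists c => // s A B s0; apply: le_trans (ql _ _ _ s0) _; rewrite ler_wpM2l//.
rewrite lerD// ler_wpM2l ?invr_ge0 ?(ltW s0)//; first exact: lerD.
by rewrite -linearB; exact: cl.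
Qed.

Lemma iter_markov_col m n (q : 'cV[C]_k.+1 -> R) (B : 'M[C]_(k.+1, m)) : qfun q ->
  \sum_j iter_markov mu n q (col j B) = iter_markov mu n (fun A => \sum_j q (col j A)) B.
Proof.
move=> qq; elim: n B => //= n ih B.
rewrite -rint_sum; last by move=> j; apply: orbit_integrable => //; exact: iter_markov_qfun.
by apply: eq_Rintegral => v _; rewrite -ih; apply: eq_bigr => j _; rewrite cmul_col.
Qed.

(** [Y'] is the dual channel applied to [Y], the integral of [v^* Y v]. The same [Y'] serves every
    number of columns, thus vectors as well as matrix factors of a state. *)
Lemma markov_gform (Y : Mk) : exists Y' : Mk, forall m (A : 'M[C]_(k.+1, m)),
  markov mu (gform Y) A = gform Y' A.
Proof.
have iw (Z : Mk) : rintegrable mu (fun v : borel Mk => rtr (adj (v : Mk) ** Y ** (v : Mk) ** Z)).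
  have := @orbit_integrable R k mu mu_nsq _ _ 1%:M (@qfun_form R _ _ Y Z).
  by congr rintegrable; apply/funext => v; rewrite cmul1r !cmulA.
exists (mxint mu (fun v : borel Mk => adj (v : Mk) ** Y ** (v : Mk))) => m A.
rewrite /gform -(rtr_mxint iw); apply: eq_Rintegral => v _.
by rewrite adjM -!cmulA [RHS]rtrC -!cmulA.
Qed.

Definition fixed (rho : Mk) := forall Y : Mk,
  \int[mu]_v rtr (Y ** ((v : Mk) ** rho ** adj (v : Mk))) = rtr (Y ** rho).

Lemma iter_markov_fixed m n (Y : Mk) (B : 'M[C]_(k.+1, m)) : fixed (B ** adj B) ->
  iter_markov mu n (gform Y) B = gform Y B.
Proof.
move=> fB; elim: n Y => // n ih Y; rewrite iter_markovSr.
have [Y' E] := markov_gform Y.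
rewrite (_ : markov mu (gform Y) = gform Y'); last by apply/funext => A; exact: E.
rewrite ih -E -[RHS]fB; apply: eq_Rintegral => v _.
by rewrite /gform adjM !cmulA.
Qed.

Definition bary (nu : probability PC R) : Mk :=
  mxint nu (fun p => unit_rep p ** adj (unit_rep p)).

Lemma gform_lip (Y : Mk) : lipP (fun p : PC => gform Y (unit_rep p)).
Proof. exact/lipP_of/qfun_gform. Qed.

Lemma baryE (nu : probability PC R) (Y : Mk) :
  rtr (Y ** bary nu) = \int[nu]_p gform Y (unit_rep p).
Proof.
rewrite rtrC -rtr_mxint; last first.
  move=> Z; have := lipP_rintegrable nu (gform_lip Z).
  by congr rintegrable; apply/funext => p; rewrite /gform rtrC.
by apply: eq_Rintegral => p _; rewrite /gform rtrC.
Qed.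

Theorem invariant_exists m (B : 'M[C]_(k.+1, m)) : nsq B = 1 ->
  exists nu : probability PC R, invariant_measure mu nu /\
    (fixed (B ** adj B) -> bary nu = B ** adj B).
Proof.
move=> B1.
(* [a n f] is the mean of [f] after [n] steps started from the columns of [B], weighted by their
   squared norms; [s N f] is the Cesaro mean. *)
pose a n (f : PC -> R) := \sum_j iter_markov mu n (lift f) (col j B).
pose s N (f : PC -> R) := N.+1%:R^-1 * \sum_(n < N.+1) a n f.
have aD n f g : lipP f -> lipP g -> a n (fun p => f p + g p) = a n f + a n g.
  move=> fl gl; rewrite /a -big_split; apply: eq_bigr => j _ /=.
  rewrite -iter_markovD//; congr iter_markov; apply/funext => x; exact: liftD.
have aZ n r f : lipP f -> a n (fun p => r * f p) = r * a n f.
  move=> fl; rewrite /a mulr_sumr; apply: eq_bigr => j _ /=.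
  rewrite -iter_markovZ//; congr iter_markov; apply/funext => x; exact: liftZ.
have a1 n : a n (fun=> 1) = 1.
  rewrite -[RHS]B1 nsq_col; apply: eq_bigr => j _.
  rewrite -[RHS](iter_markov_nsq mu_form n); congr iter_markov; apply/funext => x.
  by rewrite lift_cst mul1r.
have a_ge0 n f : lipP f -> (forall p, 0 <= f p) -> 0 <= a n f.
  move=> fl f0; apply: sumr_ge0 => j _.
  rewrite -[leLHS](_ : iter_markov mu n (fun=> 0) (col j B) = 0); last first.
    by rewrite iter_markov_fix// => A; rewrite /markov Rintegral_cst// mul0r.
  apply: iter_markov_le => // [|x]; first exact: qfun_cst0.
  have -> : 0 = lift (fun=> 0) x :> R by rewrite lift_cst mul0r.
  exact: lift_le.
have sD N f g : lipP f -> lipP g -> s N (fun p => f p + g p) = s N f + s N g.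
  move=> fl gl; rewrite /s -mulrDr -big_split; congr (_ * _).
  by apply: eq_bigr => n _; exact: aD.
have sZ N r f : lipP f -> s N (fun p => r * f p) = r * s N f.
  move=> fl; rewrite /s mulrCA; congr (_ * _); rewrite mulr_sumr.
  by apply: eq_bigr => n _; exact: aZ.
have s1 N : s N (fun=> 1) = 1.
  rewrite /s (eq_bigr (fun=> 1)) => [|n _]; last exact: a1.
  by rewrite sumr_const card_ord mulVf// pnatr_eq0.
have s_ge0 N f : lipP f -> (forall p, 0 <= f p) -> 0 <= s N f.
  by move=> fl f0; rewrite mulr_ge0 ?invr_ge0// sumr_ge0// => n _; exact: a_ge0.
have aM n (M : R) : a n (fun=> M) = M.
  rewrite -[RHS]mulr1 -(a1 n) -aZ; last exact: lipP_cst.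
  by congr a; apply/funext => p; rewrite mulr1.
have aB n f (M : R) : lipP f -> (forall p, `|f p| <= M) -> `|a n f| <= M.
  move=> fl fM; have ML : lipP (fun _ : PC => M) by exact: lipP_cst.
  have h1 : 0 <= a n (fun p => f p + M).
    apply: a_ge0 => [|p]; first exact: lipPD.
    by rewrite -lerBlDr sub0r; have := fM p; rewrite ler_norml => /andP[].
  have h2 : 0 <= a n (fun p => M + -1 * f p).
    apply: a_ge0 => [|p]; first by apply: lipPD => //; exact: lipPZ.
    by rewrite mulN1r subr_ge0 (le_trans (ler_norm _)).
  move: h1 h2; rewrite aD// aD//; last exact: lipPZ.
  rewrite aZ// aM mulN1r subr_ge0 -lerBlDr sub0r => h1 h2.
  by rewrite ler_norml h1.
have sB N f (M : R) : lipP f -> (forall p, `|f p| <= M) -> `|s N f| <= M.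
  move=> fl fM; rewrite normrM ger0_norm ?invr_ge0// mulrC ler_pdivrMr ?ltr0n//.
  apply: le_trans (ler_norm_sum _ _ _) _.
  apply: (@le_trans _ _ (\sum_(n < N.+1) M)); first by apply: ler_sum => n _; exact: aB.
  by rewrite sumr_const card_ord mulr_natr.
(* One ultrafilter gives limits for all test functions simultaneously, so that [L] is linear and
   positive. *)
have [U [UU UF]] := @ultraFilterLemma nat \oo _.
have UP : ProperFilter U by case: UU.
have Ucv f : lipP f -> exists l : R, s N f @[N --> U] --> l.
  move=> fl; have [M fM] := lipP_bounded fl.
  by apply: (@ultra_bounded_cvg R nat U (s ^~ f) M UU); apply: filterE => N; exact: sB.
pose L f : R := lim (s N f @[N --> U]).
have Luniq f (l : R) : s N f @[N --> U] --> l -> L f = l.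
  by move=> h; apply: (cvg_lim _ h); exact: Rhausdorff.
have Lcv f : lipP f -> s N f @[N --> U] --> L f.
  by move=> fl; have [l hl] := Ucv f fl; rewrite (Luniq _ _ hl).
have [|||| nu nuL] := @daniell R (proj_space R k) lipP L lipP_cst lipPD lipPZ lipP_pos
  lipP_measurable lipP_bounded lipP_dini lipP_closed.
- move=> f g fl gl; apply: Luniq; under eq_fun do rewrite sD//.
  by apply: cvgD; exact: Lcv.
- move=> r f fl; apply: Luniq; under eq_fun do rewrite sZ//.
  by apply: cvgMr; exact: Lcv.
- move=> f fl f0; apply: (ler_cvg_to (cvg_cst _) (Lcv f fl)).
  by apply: nearW => N; exact: s_ge0.
- by apply: Luniq; under eq_fun do rewrite s1; exact: cvg_cst.
exists nu; split.
  apply/(invariantP mu_nsq mu_form) => f fl.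
  have fl' : lipP (step mu f) by exact: lipP_step.
  rewrite nuL// nuL//.
  have liftS : lift (step mu f) = markov mu (lift f).
    by apply: lift_of; exact: (markov_qfun mu_nsq mu_form fl).1.
  have aS n : a n (step mu f) = a n.+1 f.
    by rewrite /a liftS; apply: eq_bigr => j _; rewrite iter_markovSr.
  have [M fM] := lipP_bounded fl.
  (* The difference telescopes: one more step changes the mean by at most [2 * M / N.+1]. *)
  have sE N : s N (step mu f) - s N f = N.+1%:R^-1 * (a N.+1 f - a 0%N f).
    rewrite /s -mulrBr; congr (_ * _).
    under eq_bigr do rewrite aS.
    by rewrite -sumrB -(big_mkord xpredT (fun n => a n.+1 f - a n f)) telescope_sumr.
  have h0 : (s N (step mu f) - s N f) @[N --> \oo] --> (0 : R).
    have hM : (N.+1%:R^-1 * (2 * M)) @[N --> \oo] --> (0 : R).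
      by rewrite -(mul0r (2 * M)); apply: cvgMl; exact: (@cvg_harmonic R).
    apply/norm_cvg0P; apply: (squeeze_cvgr _ (cvg_cst 0) hM); apply: nearW => N.
    rewrite normr_ge0 sE normrM ger0_norm ?invr_ge0// ler_wpM2l ?invr_ge0//.
    apply: le_trans (ler_normB _ _) _.
    by rewrite mulr2n mulrDl mul1r lerD// aB.
  have h1 : (s N (step mu f) - s N f) @[N --> U] --> (0 : R) by apply: cvg_trans h0; exact: cvg_app.
  have h2 : (s N (step mu f) - s N f) @[N --> U] --> L (step mu f) - L f.
    by apply: cvgB; exact: Lcv.
  by apply: subr0_eq; apply: (cvg_unique _ h2 h1); exact: Rhausdorff.
move=> fB; apply: rtr_inj => Y; rewrite baryE nuL//; last exact: gform_lip.
apply: Luniq.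
(* When [B B^*] is fixed, a quadratic form has the same mean at every time. *)
have aE n : a n (fun p => gform Y (unit_rep p)) = gform Y B.
  rewrite /a (@lift_of R k (gform Y)); last by have [] := @qfun_gform k.+1 1 Y.
  rewrite iter_markov_col//; last exact: qfun_gform.
  rewrite -(iter_markov_fixed n Y fB); congr iter_markov.
  by apply/funext => A; rewrite gform_col.
rewrite (_ : (fun N => _) = fun=> gform Y B); first exact: cvg_cst.
apply/funext => N; rewrite /s (eq_bigr (fun=> gform Y B)) => [|n _]; last exact: aE.
by rewrite sumr_const card_ord -[X in _ * X]mulr_natl mulrA mulVf ?mul1r// pnatr_eq0.
Qed.

End invariant_measures.

(** * Invariant measures are determined by their barycenter *)

Section rank_one_estimate.
Context {R : realType}.
Local Notation C := R[i].

Lemma nsq_cV1 (w : 'M[C]_1) : nsq w = csq (w 0 0).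
Proof. by rewrite nsq_sum !big_ord1. Qed.

(* Both sides compare [q] at [y] and at the orthogonal projection of [y] on [z]. *)
Lemma qlip_proj_le n (c s : R) (q : 'cV[C]_n -> R) (y z : 'cV[C]_n) :
  0 <= c -> qhom q -> qlip c q -> 0 < s ->
  `|nsq z * q y - nsq y * q z| <=
    c * (2 * s * (nsq z * nsq y) + (nsq y * nsq z - nsq (adj z ** y)) * (s^-1 + 2)).
Proof.
move=> c0 qh ql s0; have [->|z0] := eqVneq z 0.
  have -> : adj (0 : 'cV[C]_n) ** y = 0 by apply: nsq_eq0; rewrite -nsqJ adjM adjK cmul0r nsq0.
  by rewrite (qhom0 qh) !nsq0 !(mul0r, mulr0) !subrr normr0 mul0r addr0 mulr0.
pose N := nsq z; have N0 : 0 < N by exact: nsq_gt0.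
pose a : C := (adj z ** y) 0 0; pose b : C := (N^-1)%:C * a.
have dE : nsq (adj z ** y) = csq a by rewrite nsq_cV1.
have cb : csq b = csq a / N ^+ 2 by rewrite csqM csqR exprVn mulrC.
have yz : nsq (y - b *: z) = nsq y - csq a / N.
  rewrite nsqB nsqZ cb cmulZr rtrE mxtraceZ /mxtrace big_ord1.
  have -> : (adj y ** z) 0 0 = a^*.
    by rewrite /a -[adj y ** z]adjK adjM adjK adj_mx.
  have -> : b * a^* = (csq a / N)%:C.
    by rewrite /b -mulrA (mulrC a) conjMcsq -rmorphM mulrC.
  by rewrite /= -/N; field; rewrite gt_eqF.
have h1 := ql s y (b *: z) s0; rewrite qh cb nsqZ cb yz in h1.
have h2 := qlip_bound z ql (qhom0 qh).
rewrite dE.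
set D := nsq y * N - csq a.
have D0 : 0 <= D.
  by have := nsq_ge0 (y - b *: z); rewrite yz subr_ge0 ler_pdivrMr// subr_ge0.
have E : N * q y - nsq y * q z = N * (q y - csq a / N ^+ 2 * q z) - D / N * q z.
  by rewrite /D; field; rewrite gt_eqF.
rewrite E; apply: le_trans (ler_normB _ _) _.
have t1 : `|N * (q y - csq a / N ^+ 2 * q z)| <= c * (s * (N * nsq y + csq a) + s^-1 * D).
  rewrite normrM (gtr0_norm N0); apply: le_trans (ler_wpM2l (ltW N0) h1) _.
  rewrite le_eqVlt; apply/orP; left; apply/eqP; rewrite /D -/N.
  by field; rewrite !gt_eqF.
have t2 : `|D / N * q z| <= c * (2 * D).
  rewrite normrM ger0_norm ?divr_ge0 ?(ltW N0)//.
  have DN : 0 <= D / N by rewrite divr_ge0// ltW.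
  apply: le_trans (ler_wpM2l DN h2) _; rewrite -/N.
  by rewrite le_eqVlt; apply/orP; left; apply/eqP; field; rewrite gt_eqF.
have t3 : s * (N * nsq y + csq a) <= 2 * s * (N * nsq y).
  rewrite (mulrC 2) -mulrA ler_wpM2l ?(ltW s0)//.
  by rewrite mulr2n mulrDl mul1r lerD2l mulrC -subr_ge0.
apply: le_trans (lerD t1 t2) _; rewrite -mulrDr ler_wpM2l//.
have -> : D * (s^-1 + 2) = s^-1 * D + 2 * D by ring.
by rewrite -addrA lerD2r; exact: t3.
Qed.

(** Sum over the columns [z] of [B], with [y = B x]. The Gram defects add up to the form at [x] of
    [T = nsq B *: G - G ** G], where [G = B^* B]; since [T] is positive, this is at most [nsq x]
    times its trace, the purity defect multiplied by [nsq B]. *)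
Lemma sum_qlip_proj_le m n (c s : R) (q : 'cV[C]_m -> R) (B : 'M[C]_(m, n)) (x : 'cV[C]_n) :
  0 <= c -> qhom q -> qlip c q -> 0 < s ->
  `|nsq B * q (B ** x) - nsq (B ** x) * \sum_l q (col l B)| <=
    c * (2 * s * (nsq B * nsq (B ** x)) +
         nsq x * (nsq B ^+ 2 - nsq (adj B ** B)) * (s^-1 + 2)).
Proof.
move=> c0 qh ql s0.
have h l := qlip_proj_le (B ** x) (col l B) c0 qh ql s0.
rewrite mulr_sumr [in X in X * q _]nsq_col mulr_suml -sumrB.
apply: le_trans (ler_norm_sum _ _ _) _.
apply: le_trans (ler_sum _ (fun l _ => h l)) _.
rewrite -mulr_sumr ler_wpM2l// big_split /= -mulr_sumr -!mulr_suml -nsq_col.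
rewrite lerD2l ler_wpM2r//; first by rewrite addr_ge0// invr_ge0 ltW.
rewrite sumrB -mulr_sumr -nsq_col.
have -> : \sum_l nsq (adj (col l B) ** (B ** x)) = nsq (adj B ** (B ** x)).
  rewrite [RHS]nsq_sum; apply: eq_bigr => l _; rewrite nsq_cV1 big_ord1 !cmul_mx.
  by congr csq; apply: eq_bigr => i _; rewrite !adj_mx mxE.
pose G := adj B ** B.
have GJ : adj G = G by rewrite /G adjM adjK.
pose T := (nsq B)%:C *: G - G ** G.
have TE y : rtr (adj y ** (T ** y)) = nsq (B ** y) * nsq B - nsq (adj B ** (B ** y)).
  rewrite /T cmulBl cmulBr rtrB cmulZl cmulZr rtrZ mulrC; congr (_ * _ - _).
    by rewrite nsqE adjM /G !cmulA.
  by rewrite nsqE !adjM adjK /G !cmulA.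
have pT : psd T.
  split; first by rewrite /herm /T adjB adjZR adjM GJ.
  move=> y; rewrite TE subr_ge0 mulrC; apply: le_trans (nsq_cmul_le _ _) _.
  by rewrite nsqJ.
have rT : rtr T = nsq B ^+ 2 - nsq G.
  have -> : nsq G = rtr (G ** G) by rewrite nsqE GJ.
  by rewrite /T rtrB rtrZ -nsqE expr2.
rewrite -TE -rT; have [S E] := psd_factor pT.
rewrite E rtr_sq -cmulA cmulA (_ : adj x ** S = adj (adj S ** x)).
  by rewrite -nsqE mulrC; apply: le_trans (nsq_cmul_le _ _) _; rewrite nsqJ.
by rewrite adjM adjK.
Qed.

(** For [B] of rank one, [B x] is collinear to every column and the error vanishes as [s] tends to
    zero. The comparison value is [nsq (B x)] times a factor independent of [x], hence a quadratic
    form in [x]. *)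
Lemma qlip_purity_le m n (c s : R) (q : 'cV[C]_m -> R) (B : 'M[C]_(m, n)) (x : 'cV[C]_n) :
  0 <= c -> qhom q -> qlip c q -> 0 < s ->
  `|q (B ** x) - qprod (fun A => nsq (A ** x)) (fun A => \sum_l q (col l A)) B| <=
    c * (2 * s * nsq (B ** x) + nsq x * (nsq B - purity B) * (s^-1 + 2)).
Proof.
move=> c0 qh ql s0; have [->|B0] := eqVneq B 0.
  rewrite /qprod cmul0l (qhom0 qh) !nsq0 /purity nsq0 !(mul0r, mulr0, invr0) subrr normr0.
  by rewrite !(mul0r, mulr0, subr0, addr0).
have N0 := nsq_gt0 B0; have := sum_qlip_proj_le B x c0 qh ql s0.
rewrite -(ler_pM2l (_ : 0 < (nsq B)^-1)) ?invr_gt0//.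
have -> : q (B ** x) - qprod (fun A => nsq (A ** x)) (fun A => \sum_l q (col l A)) B =
    (nsq B)^-1 * (nsq B * q (B ** x) - nsq (B ** x) * \sum_l q (col l B)).
  by rewrite /qprod; field; rewrite gt_eqF.
rewrite normrM (@ger0_norm _ (nsq B)^-1) ?invr_ge0 ?nsq_ge0// => h; apply: le_trans h _.
by rewrite le_eqVlt; apply/orP; left; apply/eqP; rewrite /purity; field; rewrite !gt_eqF.
Qed.

Lemma qfun_mulr m n p (q : 'M[C]_(m, p) -> R) (x : 'M[C]_(n, p)) :
  qfun q -> qfun (fun B : 'M[C]_(m, n) => q (B ** x)).
Proof.
move=> [qh [c c0 ql]]; split; first by move=> a A; rewrite cmulZl qh.
exists (c * (1 + nsq x)); first by rewrite mulr_ge0// addr_ge0// nsq_ge0.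
move=> s A B s0; apply: le_trans (ql s _ _ s0) _; rewrite -mulrA ler_wpM2l//.
have si0 : 0 <= s^-1 by rewrite invr_ge0 ltW.
have le (D : 'M[C]_(m, n)) : nsq (D ** x) <= (1 + nsq x) * nsq D.
  apply: le_trans (nsq_cmul_le _ _) _; rewrite mulrC ler_wpM2r ?nsq_ge0//.
  by rewrite lerDr.
have h1 := ler_wpM2l (ltW s0) (lerD (le A) (le B)).
have h2 := ler_wpM2l si0 (le (A - B)).
rewrite -cmulBl; apply: le_trans (lerD h1 h2) _.
by rewrite le_eqVlt; apply/orP; left; apply/eqP; ring.
Qed.

(** Riesz representation for the real pairing: the values of [l] on [delta_mx i j] and on its
    multiple by ['i] give the two parts of an entry of [G]. *)
Lemma real_linear_rtr n (l : 'M[C]_n -> R) :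
  (forall Y Z, l (Y + Z) = l Y + l Z) -> (forall (r : R) Z, l (r%:C *: Z) = r * l Z) ->
  exists G : 'M[C]_n, forall Z, l Z = rtr (G ** Z).
Proof.
move=> lD lZ.
have l0 : l 0 = 0 by rewrite -(scale0r (0 : 'M[C]_n)) (lZ 0) mul0r.
have l_sum I (s : seq I) (F : I -> 'M[C]_n) : l (\sum_(i <- s) F i) = \sum_(i <- s) l (F i).
  by apply: (big_morph l) => //; exact: lD.
pose G : 'M[C]_n := \matrix_(j, i) (l (delta_mx i j) -i* l ('i *: delta_mx i j)).
exists G => Z.
have ZE : Z = \sum_i \sum_j
    ((Re (Z i j))%:C *: delta_mx i j + (Im (Z i j))%:C *: ('i *: delta_mx i j)).
  rewrite {1}[Z]matrix_sum_delta; apply: eq_bigr => i _; apply: eq_bigr => j _.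
  rewrite scalerA -scalerDl; congr (_ *: _); apply: complex_ext => /=; ring.
rewrite {1}ZE l_sum rtrC rtrE /mxtrace Re_sum; apply: eq_bigr => i _.
rewrite l_sum cmul_mx Re_sum; apply: eq_bigr => j _.
by rewrite lD !lZ ReM mxE /= mulrN opprK.
Qed.

End rank_one_estimate.

Section injectivity.
Context {R : realType} {k : nat}.
Local Notation C := R[i].
Local Notation Mk := 'M[C]_k.+1.
Local Notation PC := (borel (proj_space R k)).
Variable mu : {sigma_finite_measure set (borel Mk) -> \bar R}.
Hypothesis mu_nsq : rintegrable mu (fun v : borel Mk => nsq (v : Mk)).
Hypothesis mu_form : forall Y : Mk,
  \int[mu]_v rtr (adj (v : Mk) ** (v : Mk) ** Y) = rtr Y.
Hypothesis mu_pur : purification mu.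

(** Letters act on the left, so they commute with right multiplication by [x]: the evolution of any
    vector is read off from that of the identity matrix. *)
Lemma iter_markov_mulr m p n (q : 'M[C]_(k.+1, p) -> R) (A : 'M[C]_(k.+1, m)) (x : 'M[C]_(m, p)) :
  iter_markov mu n (fun B => q (B ** x)) A = iter_markov mu n q (A ** x).
Proof.
elim: n A => //= n ih A; apply: eq_Rintegral => v _.
by rewrite ih cmulA.
Qed.

Lemma iter_markov_absB_le m n (f g h : 'M[C]_(k.+1, m) -> R) (A : 'M[C]_(k.+1, m)) :
  qfun f -> qfun g -> qfun h -> (forall B, `|f B - g B| <= h B) ->
  `|iter_markov mu n f A - iter_markov mu n g A| <= iter_markov mu n h A.
Proof.
move=> fq gq hq fgh; elim: n A => //= n ih A.
by apply: rint_absB_le => [||| v]; [exact/orbit_integrable/iter_markov_qfun..|exact: ih].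
Qed.

(* The quadratic form approximating [f] after [n] steps; the error tends to zero because
   [K^n purity] tends to [nsq]. *)
Lemma iter_markov_approx (q : 'cV[C]_k.+1 -> R) (c s : R) n :
  0 <= c -> qfun q -> qlip c q -> 0 < s -> exists G : Mk, forall x : 'cV[C]_k.+1,
  `|iter_markov mu n q x - gform G x| <=
    c * (2 * s * nsq x + nsq x * (nsq (1%:M : Mk) -
       iter_markov mu n (@purity R _ _) (1%:M : Mk)) * (s^-1 + 2)).
Proof.
move=> c0 qq ql s0.
pose Q (B : Mk) := \sum_l q (col l B).
have Qq : qfun Q by apply: qfun_sum => l; exact: qfun_col.
(* [g Z] is linear in [Z], so its iterate at the identity is [rtr (G ** Z)] for some [G]; at
   [Z = x x^*] it is the comparison form of [qlip_purity_le]. *)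
pose g (Z B : Mk) := qprod (fun A : Mk => rtr (adj A ** A ** Z)) Q B.
have gq Z : qfun (g Z) by apply: qfun_prod => //; exact: qfun_gram.
have [G GE] : exists G : Mk, forall Z, iter_markov mu n (g Z) 1%:M = rtr (G ** Z).
  apply: real_linear_rtr => [Y Z|r Z].
    rewrite -iter_markovD//; congr iter_markov; apply/funext => B.
    by rewrite /g /qprod cmulDr rtrD !mulrDl.
  rewrite -iter_markovZ//; congr iter_markov; apply/funext => B.
  by rewrite /g /qprod cmulZr rtrZ !mulrA.
exists G => x; rewrite /gform -GE -[in X in `|X - _|](cmul1l x) -iter_markov_mulr.
have E : g (x ** adj x) = qprod (fun A : Mk => nsq (A ** x)) Q.
  apply/funext => B; rewrite /g /qprod; congr (_ * _ / _).
  by rewrite nsqE adjM rtrC -!cmulA rtrC -!cmulA.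
have qx : qfun (fun B : Mk => nsq (B ** x)) by apply: qfun_mulr; exact: qfun_nsq.
pose h (B : Mk) := c * 2 * s * nsq (B ** x) + c * nsq x * (s^-1 + 2) * (nsq B - purity B).
have hq : qfun h.
  by apply: qfunD; apply: qfunZ => //; apply: qfunB; [exact: qfun_nsq|exact: qfun_purity].
rewrite E; apply: le_trans (iter_markov_absB_le n 1%:M (qfun_mulr x qq) (qfun_prod qx Qq) hq _) _.
  move=> B; have := qlip_purity_le B x c0 qq.1 ql s0; congr (_ <= _); rewrite /h; ring.
have np : qfun (fun B : Mk => nsq B - purity B).
  by apply: qfunB; [exact: qfun_nsq|exact: qfun_purity].
rewrite /h iter_markovD//; [|exact: qfunZ..].
rewrite !iter_markovZ// iter_markovB//; [|exact: qfun_nsq|exact: qfun_purity].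
rewrite iter_markov_mulr !iter_markov_nsq// cmul1l le_eqVlt; apply/orP; left; apply/eqP.
ring.
Qed.

Lemma invariant_iter (nu : probability PC R) n f : invariant_measure mu nu -> lipP f ->
  \int[nu]_p iter_markov mu n (lift f) (unit_rep p) = \int[nu]_p f p.
Proof.
move=> /(invariantP mu_nsq mu_form) inv fl; elim: n => [|n ih].
  by apply: eq_Rintegral => p _; rewrite /= lift_unit.
have il : lipP (fun p : PC => iter_markov mu n (lift f) (unit_rep p)).
  by apply: lipP_of; exact: iter_markov_qfun.
rewrite -ih -[RHS](inv _ il); apply: eq_Rintegral => p _; rewrite /step lift_of//.
by have [] := iter_markov_qfun mu_nsq mu_form n fl.
Qed.

(** Invariance replaces [f] by its [n]-th iterate, which is close to a quadratic form; integrals of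
    quadratic forms depend only on barycenters, so they cancel. *)
Theorem bary_inj (I : finType) (c : I -> R) (nu : I -> probability PC R) :
  (forall i, invariant_measure mu (nu i)) -> \sum_i (c i)%:C *: bary (nu i) = 0 ->
  forall f, lipP f -> \sum_i c i * \int[nu i]_p f p = 0.
Proof.
move=> inv c0 f fl; have [fh [b b0 fb]] := fl.
pose W := \sum_i `|c i|.
have W0 : 0 <= W by exact: sumr_ge0.
pose e n : R := nsq (1%:M : Mk) - iter_markov mu n (@purity R _ _) (1%:M : Mk).
have e0 : e n @[n --> \oo] --> (0 : R).
  rewrite -(subrr (nsq (1%:M : Mk))); apply: cvgB; first exact: cvg_cst.
  exact: purification_cvg.
have main s n : 0 < s ->
    `|\sum_i c i * \int[nu i]_p f p| <= W * (b * (2 * s + e n * (s^-1 + 2))).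
  move=> s0; have [G hG] := iter_markov_approx n b0 fl fb s0.
  have G0 : \sum_i c i * \int[nu i]_p gform G (unit_rep p) = 0.
    transitivity (rtr (G ** (\sum_i (c i)%:C *: bary (nu i)))); last by rewrite c0 cmul0r rtr0.
    rewrite rtrC cmul_suml rtr_sum.
    by apply: eq_bigr => i _; rewrite cmulZl rtrZ rtrC baryE.
  rewrite -[X in `|X|]subr0 -[X in `|_ - X|]G0 -sumrB.
  apply: le_trans (ler_norm_sum _ _ _) _; rewrite /W mulr_suml; apply: ler_sum => i _.
  rewrite -mulrBr normrM ler_wpM2l// -(invariant_iter n (inv i) fl).
  have il : rintegrable (nu i) (fun p => iter_markov mu n (lift f) (unit_rep p)).
    by apply/lipP_rintegrable/lipP_of; exact: iter_markov_qfun.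
  have ig : rintegrable (nu i) (fun p => gform G (unit_rep p)).
    exact/lipP_rintegrable/gform_lip.
  rewrite -[leRHS](rint_cst (nu i)).
  apply: rint_absB_le => //; first exact: finite_measure_integrable_cst.
  by move=> p; have := hG (unit_rep p); rewrite nsq_unit_rep mulr1 mul1r.
apply/eqP; rewrite -normr_le0; apply/ler_addgt0Pr => r r0; rewrite add0r.
(* First [s] makes the part of the error free of [e n] at most [r], then [n] tends to infinity. The
   added [1] covers [W * b = 0]. *)
pose s := r / (2 * W * b + 1).
have d0 : 0 < 2 * W * b + 1 by rewrite ltr_pwDr// !mulr_ge0.
have s0 : 0 < s by exact: divr_gt0.
have h : (W * (b * (2 * s + e n * (s^-1 + 2)))) @[n --> \oo] --> W * (b * (2 * s + 0 * (s^-1 + 2))).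
  by apply: cvgMr; apply: cvgMr; apply: cvgD; [exact: cvg_cst|exact: cvgMl].
apply: le_trans (ler_cvg_to (cvg_cst _) h _) _; first by apply: nearW => n; exact: main.
rewrite mul0r addr0 (_ : W * _ = 2 * W * b * s); last by ring.
by rewrite /s mulrA ler_pdivrMr// mulrC ler_wpM2l ?(ltW r0)// lerDl.
Qed.

End injectivity.

(** * Fixed positive matrices *)

Lemma mxint_psd d (T : measurableType d) (R : realType) (m : {measure set T -> \bar R}) n
    (F : T -> 'M[R[i]]_n) :
  (forall Z : 'M[R[i]]_n, rintegrable m (fun v => rtr (F v ** Z))) ->
  (forall v, psd (F v)) -> psd (mxint m F).
Proof.
move=> iF pF; have FE Y : rtr (Y ** mxint m F) = \int[m]_v rtr (Y ** F v).
  by rewrite rtrC -rtr_mxint//; apply: eq_Rintegral => v _; rewrite rtrC.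
split.
  apply: rtr_inj => Y; rewrite -rtrJ adjM adjK -rtr_mxint// FE.
  by apply: eq_Rintegral => v _; rewrite -rtrJ adjM adjK (pF v).1.
move=> y; rewrite cmulA rtrC cmulA FE; apply: Rintegral_ge0 => v _.
by apply: rtr_psd_mul; [exact: psd_sq|exact: pF].
Qed.

(** The trace of [A ** D] lies between [0] and that of [B ** D], and a product of positive matrices
    with zero trace vanishes. *)
Lemma psd_le_mul0 (R : realType) n (A B D : 'M[R[i]]_n) : psd A -> psd D -> psd (B - A) ->
  B ** D = 0 -> A ** D = 0.
Proof.
move=> pA pD pBA BD; apply: rtr_psd_mul0 => //; apply/eqP; rewrite eq_le rtr_psd_mul// andbT.
by have := rtr_psd_mul pBA pD; rewrite cmulBl BD sub0r rtrN oppr_ge0.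
Qed.

Lemma projector_mul0 (R : realType) n (P A B : 'M[R[i]]_n) : herm P -> herm A ->
  P ** A = A -> P ** B = 0 -> A ** B = 0.
Proof. by move=> hP hA PA PB; rewrite -hA -PA adjM hP -cmulA PB cmul0r. Qed.

Section fixed_states.
Context {R : realType} {k : nat}.
Local Notation C := R[i].
Local Notation Mk := 'M[C]_k.+1.
Local Notation PC := (borel (proj_space R k)).
Variable mu : {sigma_finite_measure set (borel Mk) -> \bar R}.
Hypothesis mu_nsq : rintegrable mu (fun v : borel Mk => nsq (v : Mk)).
Hypothesis mu_form : forall Y : Mk,
  \int[mu]_v rtr (adj (v : Mk) ** (v : Mk) ** Y) = rtr Y.
Hypothesis mu_pur : purification mu.

Definition channel (rho : Mk) : Mk :=
  mxint mu (fun v : borel Mk => (v : Mk) ** rho ** adj (v : Mk)).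

Lemma channel_rintegrable (rho Y : Mk) :
  rintegrable mu (fun v : borel Mk => rtr ((v : Mk) ** rho ** adj (v : Mk) ** Y)).
Proof.
have := @orbit_integrable R k mu mu_nsq _ _ 1%:M (@qfun_form R _ _ Y rho).
congr rintegrable; apply/funext => v.
by rewrite cmul1r rtrC [RHS]rtrC !cmulA.
Qed.

Lemma channel_rintegrableC (rho Y : Mk) :
  rintegrable mu (fun v : borel Mk => rtr (Y ** ((v : Mk) ** rho ** adj (v : Mk)))).
Proof. by under eq_fun do rewrite rtrC; exact: channel_rintegrable. Qed.

Lemma channelE (rho Y : Mk) :
  rtr (Y ** channel rho) = \int[mu]_v rtr (Y ** ((v : Mk) ** rho ** adj (v : Mk))).
Proof.
rewrite rtrC -rtr_mxint; last by move=> Z; exact: channel_rintegrable.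
by apply: eq_Rintegral => v _; rewrite rtrC.
Qed.

Lemma fixedP (rho : Mk) : fixed mu rho <-> channel rho = rho.
Proof.
split=> [h|h Y]; last by rewrite -channelE h.
by apply: rtr_inj => Y; rewrite channelE.
Qed.

Lemma channelB (rho sigma : Mk) : channel (rho - sigma) = channel rho - channel sigma.
Proof.
apply: rtr_inj => Y; rewrite cmulBr rtrB !channelE -RintegralB//; [|exact: channel_rintegrableC..].
by apply: eq_Rintegral => v _; rewrite cmulBr cmulBl cmulBr rtrB.
Qed.

Lemma channelZ (r : R) (rho : Mk) : channel (r%:C *: rho) = r%:C *: channel rho.
Proof.
apply: rtr_inj => Y; rewrite cmulZr rtrZ !channelE -RintegralZl//; last exact: channel_rintegrableC.
by apply: eq_Rintegral => v _; rewrite cmulZr cmulZl cmulZr rtrZ.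
Qed.

Lemma channel_psd (rho : Mk) : psd rho -> psd (channel rho).
Proof. by move=> p; apply: mxint_psd => [Z|v]; [exact: channel_rintegrable|exact: psd_conj]. Qed.

Lemma channel_rtr (rho : Mk) : rtr (channel rho) = rtr rho.
Proof.
rewrite -[channel _]cmul1l channelE -mu_form; apply: eq_Rintegral => v _.
by rewrite cmul1l rtrC cmulA.
Qed.

Definition state (rho : Mk) := psd rho /\ fixed mu rho.

Lemma state_rtr (rho : Mk) : state rho -> 0 <= rtr rho.
Proof. by move=> [/psd_rtr]. Qed.

Lemma state_sub (rho sigma : Mk) : state rho -> state sigma -> fixed mu (rho - sigma).
Proof. by move=> [_ /fixedP h] [_ /fixedP h']; apply/fixedP; rewrite channelB h h'. Qed.

Lemma stateZ (r : R) (rho : Mk) : 0 <= r -> state rho -> state (r%:C *: rho).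
Proof.
by move=> r0 [p /fixedP h]; split; [exact: psdZ|apply/fixedP; rewrite channelZ h].
Qed.

(* With [P] the spectral projector on the positive part, [tr (P (channel A1))] must equal
   [tr A1 = tr (channel A1)], so the channel preserves both parts. *)
Lemma jordan_state (A : Mk) : herm A -> fixed mu A -> exists P A1 A2 : Mk,
  [/\ projector P, state A1, state A2, A = A1 - A2 & P ** A1 = A1 /\ P ** A2 = 0].
Proof.
move=> hA fA; have [P [A1 [A2 [pP p1 p2 E [P1 P2]]]]] := jordan hA.
exists P, A1, A2.
have pP' := projectorC pP.
have e1 : channel A1 - channel A2 = A1 - A2 by rewrite -channelB -E; exact/fixedP.
have t1 : rtr (P ** channel A1) = rtr A1 + rtr (P ** channel A2).
  have : rtr (P ** (channel A1 - channel A2)) = rtr (P ** (A1 - A2)) by rewrite e1.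
  by rewrite !cmulBr !rtrB P1 P2 rtr0 subr0 => /eqP; rewrite subr_eq => /eqP.
have t2 : rtr ((1%:M - P) ** channel A1) = - rtr (P ** channel A2).
  by rewrite cmulBl cmul1l rtrB t1 channel_rtr opprD addrA subrr sub0r.
have g1 := rtr_psd_mul (projector_psd pP') (channel_psd p1).
have g2 := rtr_psd_mul (projector_psd pP) (channel_psd p2).
have z2 : rtr (P ** channel A2) = 0.
  by apply/eqP; rewrite eq_le g2 andbT -oppr_ge0 -t2.
have z1 : rtr ((1%:M - P) ** channel A1) = 0 by rewrite t2 z2 oppr0.
have {z2} z2 := rtr_psd_mul0 (projector_psd pP) (channel_psd p2) z2.
have {z1} := rtr_psd_mul0 (projector_psd pP') (channel_psd p1) z1.
rewrite cmulBl cmul1l => /subr0_eq z1.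
have f1 : channel A1 = A1.
  have : P ** (channel A1 - channel A2) = P ** (A1 - A2) by rewrite e1.
  by rewrite !cmulBr z2 P1 P2 !subr0 -z1.
have f2 : channel A2 = A2 by move: e1; rewrite f1 => /addrI/oppr_inj.
by split=> //; split=> //; exact/fixedP.
Qed.

Lemma bary_psd (nu : probability PC R) : psd (bary nu).
Proof.
apply: mxint_psd => [Z|p]; last exact: psd_sq.
have := lipP_rintegrable nu (@gform_lip R k Z).
by congr rintegrable; apply/funext => p; rewrite /gform rtrC.
Qed.

Lemma gform1 n (u : 'cV[C]_n) : gform 1%:M u = nsq u.
Proof. by rewrite /gform cmul1l rtr_sq. Qed.

Lemma bary_rtr (nu : probability PC R) : rtr (bary nu) = 1.
Proof.
rewrite -[bary nu]cmul1l baryE -[RHS](rint_cst nu); apply: eq_Rintegral => p _.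
by rewrite gform1 nsq_unit_rep.
Qed.

Lemma bary_state (nu : probability PC R) : invariant_measure mu nu -> state (bary nu).
Proof.
move=> /(invariantP mu_nsq mu_form) inv; split; first exact: bary_psd.
move=> Y; have [B E] := psd_factor (bary_psd nu); have [Y' hY] := markov_gform mu_nsq Y.
have -> : \int[mu]_v rtr (Y ** ((v : Mk) ** bary nu ** adj (v : Mk))) = gform Y' B.
  by rewrite -hY E; apply: eq_Rintegral => v _; rewrite /gform adjM !cmulA.
rewrite /gform -E !baryE -(inv _ (gform_lip Y)); apply: eq_Rintegral => p _.
by rewrite /step (@lift_of R k (gform Y)) ?hY//; have [] := @qfun_gform R k.+1 1 Y.
Qed.

Lemma exists_invariant : exists nu : probability PC R, invariant_measure mu nu.
Proof.
have [|nu [inv _]] := @invariant_exists R k mu mu_nsq mu_form 1 (delta_mx 0 0); last by exists nu.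
rewrite nsq_sum (bigD1 0)//= big_ord1 mxE !eqxx csqR expr1n big1 ?addr0// => i /negPf i0.
by rewrite big_ord1 mxE i0 csq0.
Qed.

Lemma state_measure (rho : Mk) : state rho -> exists2 nu : probability PC R,
  invariant_measure mu nu & rho = (rtr rho)%:C *: bary nu.
Proof.
move=> [p f]; have [t0|t0] := eqVneq (rtr rho) 0.
  have [nu inv] := exists_invariant; exists nu => //.
  by rewrite t0 scale0r; exact: psd_rtr0.
have tp : 0 < rtr rho by rewrite lt_def t0 psd_rtr.
have [|B E] := @psd_factor R _ ((rtr rho)^-1%:C *: rho).
  by apply: psdZ => //; rewrite invr_ge0 ltW.
have [|nu [inv bE]] := @invariant_exists R k mu mu_nsq mu_form _ B.
  by rewrite -rtr_sq -E rtrZ mulVf.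
exists nu => //; rewrite bE -E; last by apply: (stateZ _ (conj p f)).2; rewrite invr_ge0 ltW.
by rewrite scalerA -rmorphM divff// scale1r.
Qed.

(* Tested on [(|<y, u>|^2 - |y|^2 |P u|^2)^+], the measures of [rho] and [rho'] differ by
   those of [A1] (where the function vanishes) and [A2] (where [P u = 0]). *)
Lemma jordan_le (rho rho' P A1 A2 : Mk) : state rho -> state rho' -> state A1 -> state A2 ->
  projector P -> rho - rho' = A1 - A2 -> P ** A1 = A1 -> P ** A2 = 0 -> psd (rho' - A2).
Proof.
move=> s s' s1 s2 pP E P1 P2; split; first by rewrite /herm adjB s'.1.1 s2.1.1.
have [nu inv e] := state_measure s; have [nu' inv' e'] := state_measure s'.
have [n1 inv1 e1] := state_measure s1; have [n2 inv2 e2] := state_measure s2.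
move=> y; rewrite cmulA rtrC cmulA cmulBr rtrB subr_ge0.
pose a p : R := gform (y ** adj y) (unit_rep p); pose b p : R := gform P (unit_rep p).
pose m := nsq y; pose f (p : PC) := Num.max (a p - m * b p) 0.
have la : lipP a by exact: gform_lip.
have lb : lipP (fun p => m * b p) by apply: lipPZ; exact: gform_lip.
have fl : lipP f by apply: lipP_pos; exact: lipPB.
have ri g (n : probability PC R) : lipP g -> rintegrable n g by exact: lipP_rintegrable.
have gP (Q : Mk) p : projector Q -> 0 <= gform Q (unit_rep p).
  by move=> pQ; apply: rtr_psd_mul; [exact: projector_psd|exact: psd_sq].
have a0 p : 0 <= a p by apply: rtr_psd_mul; exact: psd_sq.
have am p : a p <= m.
  have -> : a p = nsq (adj y ** unit_rep p).
    by rewrite -rtr_sq adjM adjK /a /gform -cmulA rtrC -!cmulA.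
  by apply: le_trans (nsq_cmul_le _ _) _; rewrite nsqJ nsq_unit_rep mulr1.
(* The relation between barycenters lifts to the weighted measures. As the integral against [rho] is
   nonnegative, the one against [A2] is at most the sum of those against [rho'] and [A1]. *)
have inteq : rtr rho * \int[nu]_p f p - rtr rho' * \int[nu']_p f p
    - rtr A1 * \int[n1]_p f p + rtr A2 * \int[n2]_p f p = 0.
  pose c (i : 'I_4) := nth 0 [:: rtr rho; - rtr rho'; - rtr A1; rtr A2] i.
  pose n (i : 'I_4) := nth nu [:: nu; nu'; n1; n2] i.
  have := @bary_inj R k mu mu_nsq mu_form mu_pur _ c n _ _ f fl.
  rewrite !big_ord_recl !big_ord0 /= /c /n /= !addr0 !mulNr !addrA; apply.
    by case=> [[|[|[|[|?]]]]] ?.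
  rewrite !rmorphN !scaleNr -e -e' -e1 -e2.
  by rewrite E addrAC subrK subrr.
have h2 : rtr (y ** adj y ** A2) <= rtr A2 * \int[n2]_p f p.
  have : \int[n2]_p (a p - m * b p) <= \int[n2]_p f p.
    apply: rint_le; [exact/ri/lipPB|exact: ri|by move=> p; rewrite le_max lexx].
  rewrite RintegralB//; [|exact: ri..]; rewrite RintegralZl//; last exact/ri/gform_lip.
  rewrite -!baryE => h; rewrite {1}e2 cmulZr rtrZ.
  have z : rtr A2 * rtr (P ** bary n2) = 0 by rewrite -rtrZ -cmulZr -e2 P2 rtr0.
  have := ler_wpM2l (psd_rtr s2.1) h; rewrite mulrBr mulrCA z mulr0 subr0.
  by [].
have h1 : rtr A1 * \int[n1]_p f p <= 0.
  have : \int[n1]_p f p <= \int[n1]_p (m * gform (1%:M - P) (unit_rep p)).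
    apply: rint_le; [exact: ri|by apply/ri/lipPZ; exact: gform_lip|].
    move=> p; have g0 := gP _ p (projectorC pP).
    have gE : gform (1%:M - P) (unit_rep p) = 1 - b p.
      by rewrite /gform cmulBl rtrB -!/(gform _ _) gform1 nsq_unit_rep.
    rewrite /f ge_max mulr_ge0 ?nsq_ge0//= andbT gE mulrBr mulr1 lerD2r; exact: am.
  rewrite RintegralZl//; last exact/ri/gform_lip.
  rewrite -baryE => h.
  have z : rtr A1 * rtr ((1%:M - P) ** bary n1) = 0.
    by rewrite -rtrZ -cmulZr -e1 cmulBl cmul1l P1 subrr rtr0.
  by have := ler_wpM2l (psd_rtr s1.1) h; rewrite mulrCA z mulr0.
have h' : rtr rho' * \int[nu']_p f p <= rtr (y ** adj y ** rho').
  have : \int[nu']_p f p <= \int[nu']_p a p.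
    apply: rint_le; [exact: ri|exact: ri|].
    move=> p; rewrite /f ge_max a0 andbT gerBl mulr_ge0 ?nsq_ge0//; exact: gP.
  rewrite -baryE => h; rewrite [in leRHS]e' cmulZr rtrZ.
  by have := ler_wpM2l (psd_rtr s'.1) h.
have h0 : 0 <= rtr rho * \int[nu]_p f p.
  apply: mulr_ge0; first exact: state_rtr.
  by apply: Rintegral_ge0 => p _; rewrite le_max lexx orbT.
lra.
Qed.

Definition orth_family d (r : 'I_d -> Mk) :=
  (forall i, state (r i) /\ r i != 0) /\ forall i j, i != j -> r i ** r j = 0.

(** A nonzero column chosen in each [r i] gives [d] pairwise orthogonal vectors, since [r i] is
    Hermitian; their Gram matrix is invertible. *)
Lemma orth_family_le d (r : 'I_d -> Mk) : orth_family r -> (d <= k.+1)%N.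
Proof.
move=> [r1 r2].
have /choice[l hl] i : exists l, col l (r i) != 0.
  apply: contrapT => /forallNP h; have /negP[] := (r1 i).2; apply/eqP/matrixP => a b.
  have /negP := h b; rewrite negbK => /eqP/colP/(_ a); by rewrite !mxE.
pose X : 'M[C]_(k.+1, d) := \matrix_(a, i) col (l i) (r i) a 0.
pose D : 'M[C]_d := diag_mx (\row_i ((nsq (col (l i) (r i)))^-1)%:C).
have colX i : col i X = col (l i) (r i) by apply/colP => a; rewrite !mxE.
have XX : adj X ** X = diag_mx (\row_i (nsq (col (l i) (r i)))%:C).
  apply/matrixP => i j.
  have -> : (adj X ** X) i j = (adj (col i X) ** col j X) 0 0.
    by rewrite !cmul_mx; apply: eq_bigr => a _; rewrite !adj_mx !mxE.
  rewrite !colX !mxE; have [->|ij] := eqVneq i j.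
    by rewrite gram_cV mxE eqxx !mulr1n.
  have -> : adj (col (l i) (r i)) ** col (l j) (r j) = 0.
    rewrite !colE -!cmulE adjM (r1 i).1.1.1 cmulA -(cmulA _ (r i)) r2//.
    by rewrite cmul0r cmul0l.
  by rewrite mxE mulr0n.
have DX : D ** (adj X ** X) = 1%:M.
  rewrite XX cmulE mulmx_diag; apply/matrixP => i j; rewrite !mxE.
  by rewrite -rmorphM mulVf// gt_eqF// nsq_gt0.
have := mxrank1 C d; rewrite -DX cmulA cmulE => rk.
have := mxrankM_maxr (D ** adj X) X; rewrite rk => /leq_trans; apply.
exact: rank_leq_row.
Qed.

Lemma orth_family_cons d (r : 'I_d -> Mk) (tau : Mk) : orth_family r -> state tau ->
  tau != 0 -> (forall i, r i ** tau = 0) -> exists r' : 'I_d.+1 -> Mk, orth_family r'.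
Proof.
move=> [r1 r2] st t0 rt; exists (fun i => oapp r tau (unlift ord0 i)); split.
  by move=> i; case: unliftP => [j _|_] /=.
move=> i j; case: (unliftP ord0 i) => [i' ->|->]; case: (unliftP ord0 j) => [j' ->|->];
  rewrite ?liftK ?unlift_none /= => ij //.
- by apply: r2; apply: contra ij => /eqP ->.
- by apply: psd_mul0_sym; [exact: (r1 _).1.1.1|exact: st.1.1|exact: rt].
Qed.

Lemma orth_family_set d (r : 'I_d -> Mk) j (tau : Mk) : orth_family r -> state tau ->
  tau != 0 -> (forall i, i != j -> r i ** tau = 0) ->
  orth_family (fun i => if i == j then tau else r i).
Proof.
move=> [r1 r2] st t0 rt; split; first by move=> i; case: eqP.
move=> a b ab; have [aj|aj] := eqVneq a j; have [bj|bj] := eqVneq b j.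
- by rewrite aj bj eqxx in ab.
- by apply: psd_mul0_sym; [exact: (r1 _).1.1.1|exact: st.1.1|exact: rt].
- exact: rt.
- exact: r2.
Qed.

(** Maximal in cardinality rather than for inclusion, so that replacing a member by two orthogonal
    states is excluded. *)
Definition maximal_family d (r : 'I_d -> Mk) :=
  orth_family r /\ forall r' : 'I_d.+1 -> Mk, ~ orth_family r'.

Lemma exists_maximal_family : exists d (r : 'I_d -> Mk), (0 < d)%N /\ maximal_family r.
Proof.
pose p d := `[< exists r : 'I_d -> Mk, orth_family r >].
have p1 : p 1%N.
  have [nu inv] := exists_invariant; apply/asboolP.
  exists (fun=> bary nu); split; last by move=> i j; rewrite !ord1 eqxx.
  move=> _; split; first exact: bary_state.
  by apply/eqP => b0; have := bary_rtr nu; rewrite b0 rtr0 => /esym/eqP; rewrite oner_eq0.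
have [||d /asboolP[r hr] dmax] := @ex_maxnP p k.+1.
- by exists 1%N.
- by move=> d /asboolP[r]; exact: orth_family_le.
exists d, r; split; first exact: dmax.
split=> // r' hr'; have := dmax d.+1 (introT (asboolP _) (ex_intro _ r' hr')).
by rewrite ltnn.
Qed.

Section maximal.
Variables (d : nat) (r : 'I_d -> Mk).
Hypothesis r_max : maximal_family r.

Let r_state i : state (r i). Proof. exact: (r_max.1.1 i).1. Qed.
Let r_neq0 i : r i != 0. Proof. exact: (r_max.1.1 i).2. Qed.
Let r_orth i j : i != j -> r i ** r j = 0. Proof. exact: r_max.1.2. Qed.

Let state_rtr0 (rho : Mk) : state rho -> rho != 0 -> 0 < rtr rho.
Proof.
move=> s r0; rewrite lt_def state_rtr// andbT; apply: contra r0 => /eqP h.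
by apply/eqP; apply: psd_rtr0 => //; exact: s.1.
Qed.

(* Otherwise the two Jordan parts of [sigma - a r_j] could replace [r_j]. *)
Lemma maximal_minimal j (sigma : Mk) : state sigma ->
  (forall i, i != j -> sigma ** r i = 0) -> exists2 a, 0 <= a & sigma = a%:C *: r j.
Proof.
move=> s so; have tj := state_rtr0 (r_state j) (r_neq0 j).
(* With this [a] the difference has trace zero, so its Jordan parts have equal traces and both
   vanish as soon as one does. *)
pose a := rtr sigma / rtr (r j).
have a0 : 0 <= a by rewrite divr_ge0 ?state_rtr// ltW.
exists a => //; have sj := stateZ a0 (r_state j).
have [||P [A1 [A2 [pP s1 s2 E [P1 P2]]]]] := @jordan_state (sigma - a%:C *: r j).
- by rewrite /herm adjB s.1.1 sj.1.1.
- exact: state_sub.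
have le2 := jordan_le s sj s1 s2 pP E P1 P2.
(* The same comparison with the roles exchanged: [1 - P] is the projector for the opposite
   difference. *)
have le1 : psd (sigma - A1).
  have E' : a%:C *: r j - sigma = A2 - A1 by rewrite -(opprB sigma) E opprB.
  apply: (jordan_le sj s s2 s1 (projectorC pP) E').
    by rewrite cmulBl cmul1l P2 subr0.
  by rewrite cmulBl cmul1l P1 subrr.
have o1 i : i != j -> A1 ** r i = 0.
  by move=> ij; apply: (psd_le_mul0 s1.1 (r_state i).1 le1); exact: so.
have o2 i : i != j -> A2 ** r i = 0.
  move=> ij; apply: (psd_le_mul0 s2.1 (r_state i).1 le2).
  by rewrite cmulZl r_orth 1?eq_sym// scaler0.
have sym (X : Mk) i : state X -> X ** r i = 0 -> r i ** X = 0.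
  by move=> sX; apply: psd_mul0_sym; [exact: sX.1.1|exact: (r_state i).1.1].
have A12 : A1 ** A2 = 0.
  exact: projector_mul0 pP.1 s1.1.1 P1 P2.
have tE : rtr A1 = rtr A2.
  apply/eqP; rewrite -subr_eq0 -rtrB -E rtrB rtrZ /a divfK ?subrr//; exact: lt0r_neq0.
have z : A1 = 0 \/ A2 = 0.
  have [->|n1] := eqVneq A1 0; [by left|right]; apply/eqP/negP => /negP n2.
  have f1 := orth_family_set r_max.1 s1 n1 (fun i ij => sym _ _ s1 (o1 i ij)).
  have [|r' hr'] := orth_family_cons f1 s2 n2; last exact: (r_max.2 r').
  by move=> i; case: eqP => [_ //|/eqP ij]; exact/sym/o2.
have A10 : A1 = 0.
  by case: z => // z; apply: psd_rtr0; [exact: s1.1|rewrite tE z rtr0].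
have A20 : A2 = 0 by apply: psd_rtr0; [exact: s2.1|rewrite -tE A10 rtr0].
by apply: subr0_eq; rewrite E A10 A20 subrr.
Qed.

(** [A2] is dominated by a multiple of [r j], hence orthogonal to the other members, hence itself a
    multiple of [r j]. As it is nonzero, [A1], which is orthogonal to it, is orthogonal to [r j]. *)
Lemma maximal_split j (rho : Mk) : state rho -> exists (a : R) (tau : Mk),
  [/\ 0 <= a, state tau, rho = a%:C *: r j + tau, r j ** tau = 0 & psd (rho - tau)].
Proof.
move=> s; have tj := state_rtr0 (r_state j) (r_neq0 j).
(* This [c] gives the difference trace [-1], which forces [A2] to be nonzero. *)
pose c := (rtr rho + 1) / rtr (r j).
have t0 : 0 <= rtr rho by exact: state_rtr.
have c0 : 0 <= c by rewrite divr_ge0 ?addr_ge0// ltW.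
have sj := stateZ c0 (r_state j).
have [||P [A1 [A2 [pP s1 s2 E [P1 P2]]]]] := @jordan_state (rho - c%:C *: r j).
- by rewrite /herm adjB s.1.1 sj.1.1.
- exact: state_sub.
have le2 := jordan_le s sj s1 s2 pP E P1 P2.
have [|e e0 A2E] := @maximal_minimal j A2 s2.
  move=> i ij; apply: (psd_le_mul0 s2.1 (r_state i).1 le2).
  by rewrite cmulZl r_orth 1?eq_sym// scaler0.
have tE : rtr A1 - rtr A2 = rtr rho - c * rtr (r j) by rewrite -rtrB -E rtrB rtrZ.
have ct : c * rtr (r j) = rtr rho + 1 by rewrite divfK// lt0r_neq0.
have t2 : 0 < rtr A2 by have := psd_rtr s1.1; move: tE; rewrite ct; lra.
have e1 : 0 < e.
  by move: t2; rewrite A2E rtrZ pmulr_lgt0.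
have A12 : A1 ** A2 = 0.
  exact: projector_mul0 pP.1 s1.1.1 P1 P2.
have A21 : A2 ** A1 = 0 by exact: psd_mul0_sym s1.1.1 s2.1.1 A12.
have jA : r j ** A1 = 0.
  move: A21; rewrite A2E cmulZl => /eqP; rewrite scaler_eq0 => /orP[|/eqP //].
  by rewrite -[_ == 0]/(e%:C == (0 : R)%:C) (inj_eq (@complexI R)) gt_eqF.
have rE : rho = (c - e)%:C *: r j + A1.
  by rewrite rmorphB scalerBl -A2E -addrA (addrC (- A2)) -E addrC subrK.
have ce : 0 <= c - e.
  by have := psd_rtr le2; rewrite A2E -scalerBl -rmorphB rtrZ pmulr_lge0.
exists (c - e), A1; split=> //.
by rewrite {1}rE addrK; apply: psdZ => //; exact: (r_state j).1.
Qed.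

(** Peel off one member after the other. Each remainder is dominated by the previous one, so the
    orthogonality already gained persists; a remainder orthogonal to all members vanishes by
    maximality. *)
Theorem maximal_decomp (rho : Mk) : state rho -> exists2 a : 'I_d -> R,
  forall i, 0 <= a i & rho = \sum_i (a i)%:C *: r i.
Proof.
move=> s.
suff [a [tau [a0 st E o]]] : exists (a : 'I_d -> R) (tau : Mk),
    [/\ forall i, 0 <= a i, state tau, rho = \sum_i (a i)%:C *: r i + tau &
        forall i, i \in enum 'I_d -> r i ** tau = 0].
  exists a => //; have [t0|t0] := eqVneq tau 0; first by rewrite E t0 addr0.
  have [|r' /r_max.2 []] := orth_family_cons r_max.1 st t0.
  by move=> i; apply: o; rewrite mem_enum.
elim: (enum 'I_d) => [|j l [a [tau [a0 st E o]]]].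
  exists (fun=> 0), rho; split=> //; rewrite big1 ?add0r// => i _; exact: scale0r.
have [e [sigma [e0 ss tE jo le]]] := maximal_split j st.
exists (fun i => a i + (if i == j then e else 0)), sigma; split=> //.
- by move=> i; rewrite addr_ge0//; case: ifP.
- rewrite E tE addrA; congr (_ + _).
  under [RHS]eq_bigr do rewrite rmorphD scalerDl.
  rewrite big_split; congr (_ + _) => /=.
  rewrite (bigD1 j)//= eqxx big1 ?addr0// => i /negPf ->; exact: scale0r.
- move=> i; rewrite inE => /orP[/eqP -> //|il].
  apply: psd_mul0_sym; [exact: ss.1.1|exact: (r_state i).1.1|].
  apply: (psd_le_mul0 ss.1 (r_state i).1 le).
  by apply: psd_mul0_sym; [exact: (r_state i).1.1|exact: st.1.1|exact: o].
Qed.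

End maximal.

End fixed_states.

(** * Supports of measures and convex combinations *)

Section range_projector.
Context {R : realType} {k : nat}.
Local Notation C := R[i].
Local Notation Mk := 'M[C]_k.+1.
Local Notation PC := (borel (proj_space R k)).

Definition fixspace n (P : 'M[C]_n) : {vspace 'cV[C]_n} :=
  lker (linfun (mulmx (1%:M - P) : 'cV[C]_n -> 'cV[C]_n)).

Lemma mem_fixspace n (P : 'M[C]_n) (x : 'cV[C]_n) : x \in fixspace P <-> P ** x = x.
Proof.
rewrite memv_ker lfunE /= -cmulE cmulBl cmul1l subr_eq0.
by split=> [/eqP <-//|->].
Qed.

Lemma proj_sub_fixspace (P : Mk) :
  proj_sub (fixspace P) = [set p : PC | P ** unit_rep p = unit_rep p].
Proof.
apply/seteqP; split=> [_ [x /mem_fixspace Px <-]|p Pp] /=.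
  by have [a -> _] := unit_rep_class x; rewrite cmulZr Px.
exists (exist (fun x : 'cV[C]_k.+1 => x != 0) _ (unit_rep_neq0 p)).
  exact/mem_fixspace.
exact: proj_class_unit_rep.
Qed.

(** The integral of [nsq ((1 - P) u)] is [rtr ((1 - P) ** bary nu)], so the support condition
    depends on the barycenter alone. *)
Lemma proj_sub_bary (P : Mk) (nu : probability PC R) : projector P ->
  nu (proj_sub (fixspace P)) = 1%E <-> P ** bary nu = bary nu.
Proof.
move=> pP; rewrite proj_sub_fixspace; have pQ := projectorC pP.
pose g (p : PC) : R := gform (1%:M - P) (unit_rep p).
have gE p : g p = nsq ((1%:M - P) ** unit_rep p).
  rewrite /g /gform -rtr_sq adjM pQ.1 cmulA -[in LHS]pQ.2 -!cmulA rtrC.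
  by rewrite -!cmulA.
have g0 p : 0 <= g p by rewrite gE nsq_ge0.
have gl : lipP g by exact: gform_lip.
have gi : rintegrable nu g by exact: lipP_rintegrable.
have intg : \int[nu]_p g p = rtr ((1%:M - P) ** bary nu) by rewrite baryE.
set A := [set p | _].
have AE p : A p <-> g p = 0.
  rewrite gE cmulBl cmul1l; split=> [/= ->|/nsq_eq0 /subr0_eq//].
  by rewrite subrr nsq0.
have mA : measurable (A : set PC).
  have := lipP_measurable gl measurableT (measurable_set1 0).
  rewrite setTI; congr measurable; apply/seteqP; split=> p /=; first by move=> /AE.
  by move=> h; apply/AE.
have AS : A = [set p | g p = 0] by apply/seteqP; split=> p /AE.
have aeA : nu A = 1%E <-> {ae nu, forall p, g p = 0}.
  have aeN : {ae nu, forall p, g p = 0} <-> nu (~` A) = 0%E.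
    apply: iff_trans (negligibleP nu (measurableC mA)).
    by rewrite [in X in _ <-> X]AS; exact: iff_refl.
  apply: iff_trans (iff_sym aeN).
  rewrite probability_setC//; split=> [->|h]; first by rewrite subee.
  by rewrite -(setCK A) probability_setC ?probability_setC// ?h ?sube0//; exact: measurableC.
rewrite aeA; split=> [h|h].
  have : \int[nu]_p g p = 0.
    rewrite (rint_ae gi _ h) ?rint_cst//; exact: finite_measure_integrable_cst.
  rewrite intg => /(rtr_psd_mul0 (projector_psd pQ) (bary_psd nu)).
  by rewrite cmulBl cmul1l => /subr0_eq.
by apply: rint_ge0_ae => //; rewrite intg cmulBl cmul1l h subrr rtr0.
Qed.

(** As a relation between [d + 1] measures with coefficients [1] and [- t j], the combination can be
    tested on sets or on Lipschitz functions alike. *)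
Lemma hullP d (t : 'I_d -> R) (nu : 'I_d -> probability PC R) (nu' : probability PC R) :
  (forall S : set PC, measurable S -> (nu' S = \sum_j (t j)%:E * nu j S)%E) <->
  forall f, lipP f -> \int[nu']_p f p = \sum_j t j * \int[nu j]_p f p.
Proof.
pose c (i : 'I_d.+1) := oapp (fun j => - t j) 1 (unlift ord0 i).
pose n (i : 'I_d.+1) := oapp nu nu' (unlift ord0 i).
have cE (h : probability PC R -> R) :
    \sum_i c i * h (n i) = h nu' - \sum_j t j * h (nu j).
  rewrite big_ord_recl /c /n unlift_none /= mul1r -sumrN; congr (_ + _).
  by apply: eq_bigr => j _; rewrite liftK /= mulNr.
have finE S : measurable S -> (nu' S = \sum_j (t j)%:E * nu j S)%E <->
    fine (nu' S) - \sum_j t j * fine (nu j S) = 0.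
  move=> mS.
  have -> : (\sum_j (t j)%:E * nu j S = (\sum_j t j * fine (nu j S))%:E)%E.
    rewrite -sumEFin; apply: eq_bigr => j _.
    by rewrite EFinM fineK// fin_num_measure.
  split=> [->|/subr0_eq <-]; first by rewrite subrr.
  by rewrite fineK// fin_num_measure.
split=> [h f fl|h S mS].
  apply: subr0_eq; rewrite -(cE (fun m => \int[m]_p f p)).
  apply: indic_signed fl => S mS; rewrite (cE (fun m => fine (m S))).
  exact/finE/h.
apply/(finE _ mS); rewrite -(cE (fun m => fine (m S))).
apply: signed_indic mS => f fl; rewrite (cE (fun m => \int[m]_p f p)).
by rewrite h// subrr.
Qed.

End range_projector.

Theorem proposition2p5 (R : realType) (k : nat)
    (mu : {sigma_finite_measure set (borel 'M[R[i]]_k.+1) -> \bar R})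
    (mu_fin : (\int[mu]_v ((opnorm (v : 'M[R[i]]_k.+1)) ^+ 2)%:E < +oo)%E)
    (mu_id : mx_integral mu (fun v => v ^t* *m v) = 1%:M)
    (mu_pur : purification mu) :
  exists (d : nat) (F : 'I_d -> {vspace 'cV[R[i]]_k.+1})
         (nu : 'I_d -> probability (borel (proj_space R k)) R),
    [/\ (0 < d)%N,
        forall i j, i != j -> orthogonalv (F i) (F j),
        forall j,
          [/\ invariant_measure mu (nu j),
              nu j (proj_sub (F j)) = 1%E &
              forall nu' : probability (borel (proj_space R k)) R,
                invariant_measure mu nu' -> nu' (proj_sub (F j)) = 1%E ->
                forall S, measurable S -> nu' S = nu j S] &
        forall nu' : probability (borel (proj_space R k)) R,
          invariant_measure mu nu' <-> in_convex_hull nu nu'].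
Proof.
have mu_nsq := nsq_rintegrable mu_fin.
have mu_form := gram_integral mu_fin mu_id.
have [d [r [d0 r_max]]] := exists_maximal_family mu_nsq mu_form.
have r_st i : state mu (r i) := (r_max.1.1 i).1.
have t_gt0 i : 0 < rtr (r i).
  rewrite lt_def (state_rtr (r_st i)) andbT; apply/eqP => h; have /eqP[] := (r_max.1.1 i).2.
  by apply: psd_rtr0 => //; exact: (r_st i).1.
have /choice[nu /= hnu] i : exists nu : probability (borel (proj_space R k)) R,
    invariant_measure mu nu /\ r i = (rtr (r i))%:C *: bary nu.
  by have [nu inv e] := state_measure mu_nsq mu_form (r_st i); exists nu.
have inv i : invariant_measure mu (nu i) := (hnu i).1.
have rE i : r i = (rtr (r i))%:C *: bary (nu i) := (hnu i).2.
have bE i : bary (nu i) = (rtr (r i))^-1%:C *: r i.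
  by rewrite {2}rE scalerA -rmorphM mulVf ?scale1r// lt0r_neq0.
(* The factored form of the projectors transfers orthogonality to them from the barycenters. *)
have /choice[D hD] i := range_projector (bary (nu i)).
pose P i := bary (nu i) ** D i.
have pP i : projector (P i) := (hD i).1.
have PE i : P i ** bary (nu i) = bary (nu i) := (hD i).2.
have bb i j : i != j -> bary (nu i) ** bary (nu j) = 0.
  by move=> ij; rewrite !bE cmulZl cmulZr r_max.1.2// !scaler0.
have PP i j : i != j -> P i ** P j = 0.
  move=> ij; rewrite -(pP i).1 /P adjM (bary_psd _).1 -cmulA (cmulA (bary _)) bb//.
  by rewrite cmul0l cmul0r.
have decomp nu' : invariant_measure mu nu' -> exists2 a : 'I_d -> R,
    forall i, 0 <= a i & bary nu' = \sum_i (a i)%:C *: bary (nu i).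
  move=> /(bary_state mu_nsq mu_form)/(maximal_decomp mu_nsq mu_form mu_pur r_max)[a a0 aE].
  exists (fun i => a i * rtr (r i)); first by move=> i; rewrite mulr_ge0// ltW.
  by rewrite aE; apply: eq_bigr => i _; rewrite rmorphM -scalerA -rE.
have sum1 nu' (a : 'I_d -> R) : bary nu' = \sum_i (a i)%:C *: bary (nu i) -> \sum_i a i = 1.
  move=> aE; rewrite -(bary_rtr nu') aE rtr_sum; apply: eq_bigr => i _.
  by rewrite rtrZ bary_rtr mulr1.
have hull nu' (a : 'I_d -> R) : invariant_measure mu nu' ->
    bary nu' = \sum_i (a i)%:C *: bary (nu i) ->
    forall S, measurable S -> (nu' S = \sum_j (a j)%:E * nu j S)%E.
  move=> inv' aE.
  apply/hullP => f fl.
  pose c (i : 'I_d.+1) := oapp (fun j => - a j) 1 (unlift ord0 i).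
  pose n (i : 'I_d.+1) := oapp nu nu' (unlift ord0 i).
  have inv_n i : invariant_measure mu (n i) by rewrite /n; case: (unlift _ i).
  have h0 : \sum_i (c i)%:C *: bary (n i) = 0.
    rewrite big_ord_recl /c /n unlift_none /= scale1r aE -big_split big1//= => i _.
    by rewrite liftK /= rmorphN scaleNr subrr.
  apply: subr0_eq; rewrite -[RHS](bary_inj mu_nsq mu_form mu_pur inv_n h0 fl).
  rewrite big_ord_recl /c /n unlift_none /= mul1r -sumrN; congr (_ + _).
  by apply: eq_bigr => i _; rewrite liftK /= mulNr.
exists d, (fun i => fixspace (P i)), nu; split=> //.
- move=> i j ij x y /mem_fixspace Px /mem_fixspace Py.
  rewrite /hdot -Px -Py -adjE -cmulE adjM (pP i).1 -cmulA (cmulA (P i)) PP//.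
  by rewrite cmul0l cmul0r mxE.
- move=> j; split=> //; first exact/(proj_sub_bary _ (pP j)).
  move=> nu' inv' /(proj_sub_bary _ (pP j)) Pj S mS.
  have [a a0 aE] := decomp nu' inv'.
  (* The support condition makes [bary nu'] orthogonal to [bary (nu i)]; pairing the decomposition
     with the latter isolates [a i] times [nsq (bary (nu i))], whose second factor is nonzero. *)
  have ai i : i != j -> a i = 0.
    move=> ij; have z : bary nu' ** bary (nu i) = 0.
      apply: (@psd_mul0_sym R); [exact: (bary_psd _).1|exact: (bary_psd _).1|].
      have bP : bary (nu i) ** P i = bary (nu i).
        by rewrite -[LHS]adjK adjM (pP i).1 (bary_psd _).1 PE (bary_psd _).1.
      by rewrite -Pj -bP -cmulA (cmulA (P i)) PP// cmul0l cmul0r.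
    have : rtr (bary nu' ** bary (nu i)) = 0 by rewrite z rtr0.
    rewrite aE cmul_suml rtr_sum (bigD1 i)//= big1 => [|l li]; last first.
      by rewrite cmulZl rtrZ bb// rtr0 mulr0.
    rewrite addr0 cmulZl rtrZ -[in X in X ** _](bary_psd (nu i)).1 -nsqE => /eqP.
    rewrite mulf_eq0 => /orP[/eqP//|/eqP/nsq_eq0 b0].
    by have := bary_rtr (nu i); rewrite b0 rtr0 => /esym/eqP; rewrite oner_eq0.
  have aj : a j = 1.
    by have := sum1 _ _ aE; rewrite (bigD1 j)//= big1 ?addr0// => i /ai.
  rewrite (hull nu' a)// (bigD1 j)//= big1 ?adde0; last by move=> i /ai ->; rewrite mul0e.
  by rewrite aj mul1e.
- move=> nu'; split=> [inv'|[t [t0 t1 tE]]].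
    have [a a0 aE] := decomp nu' inv'.
    by exists a; split=> //; [exact: sum1 aE|move=> S mS; exact: hull].
  apply/(invariantP mu_nsq mu_form) => f fl.
  have E := (hullP t nu nu').1 tE.
  rewrite !E//; last exact: lipP_step.
  by apply: eq_bigr => i _; rewrite ((invariantP mu_nsq mu_form _).1 (inv i)).
Qed.
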